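(* Let $T>0$ and $p\ge1$, and let $a\in C(\mathbb{R})$ satisfy, for some $C>0$, $|a^{(j)}(\mu)|\le C(1+|\mu|^{p-j})$ for all $\mu\in\mathbb{R}$, with $j=0,1$ if $1\le p<2$ and $j=0,1,2$ if $p\ge2$. If $u\in L^\infty(0,T;H^1(\mathbb{R}))$ solves $$u_t-u_{xx}+u_{xxx}+a(u)u_x=0\ \text{ in }\mathbb{R}\times(0,T),\qquad u\equiv0\ \text{ in }\big((-\infty,-L)\cup(L,\infty)\big)\times(0,T),$$ for some $L>0$, then $u\equiv0$ in $\mathbb{R}\times(0,T)$.
   Context: The equation is understood in the sense of distributions on $\mathbb{R}\times(0,T)$. The growth condition includes the existence of the derivatives $a^{(j)}$ appearing in it. Functions are real-valued. *)

(* Defs.v *)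
From HB Require Import structures.
From mathcomp Require Import all_boot all_order all_algebra.
From mathcomp Require Import all_classical all_reals all_analysis.

Set Implicit Arguments.
Unset Strict Implicit.
Unset Printing Implicit Defensive.
Import Order.TTheory GRing.Theory Num.Theory.
Import numFieldNormedType.Exports.
Local Open Scope classical_set_scope.
Local Open Scope ring_scope.

Definition growth {R : realType} (p : R) (a : R -> R) : Prop :=
  exists2 C : R, 0 < C &
    forall j : nat, (j <= (if (p < 2)%R then 1 else 2))%N -> forall m : R,
      (forall i : nat, (i < j)%N -> derivable (derive1n i a) m 1) /\
      `|derive1n j a m| <= C * (1 + `|m| `^ (p - j%:R)).

(** ** The Sobolev space H^1(R) *)

Definition test_fun1 {R : realType} (phi : R -> R) : Prop :=
  (forall (n : nat) (x : R), derivable (derive1n n phi) x 1) /\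
  (exists2 K : set R, compact K & forall x, ~ K x -> phi x = 0).

Definition is_wderiv {R : realType} (f g : R -> R) : Prop :=
  forall phi : R -> R, test_fun1 phi ->
    \int[lebesgue_measure]_x (f x * derive1 phi x) =
    - \int[lebesgue_measure]_x (g x * phi x).

Definition L2 {R : realType} (f : R -> R) : Prop :=
  f \in Lfun (@lebesgue_measure R) 2%:E.

Definition H1 {R : realType} (f : R -> R) : Prop :=
  L2 f /\ exists2 g, L2 g & is_wderiv f g.

(* A weak derivative in L^2 (any one: it is unique almost everywhere), or the
   zero function when there is none. *)
Definition wderiv {R : realType} (f : R -> R) : R -> R :=
  xget (fun=> 0) [set g | L2 g /\ is_wderiv f g].

Definition H1norm {R : realType} (f : R -> R) : R :=
  Num.sqrt (\int[lebesgue_measure]_x (f x ^+ 2) +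
            \int[lebesgue_measure]_x (wderiv f x ^+ 2)).

(** ** The Bochner space L^oo(0, T; H^1(R)) *)

(* In all that follows, [u : R -> R -> R] is applied to the time first: [u t] is
   the element of H^1(R) at time [t], and [u t x] its value at [x]. *)

Definition H1_simple {R : realType} (s : R -> R -> R) : Prop :=
  exists (n : nat) (A : 'I_n -> set R) (f : 'I_n -> R -> R),
    (forall i, measurable (A i) /\ H1 (f i)) /\
    forall t x, s t x = \sum_(i < n) \1_(A i) t * f i x.

Definition H1_strongly_measurable {R : realType} (T : R) (u : R -> R -> R) :
    Prop :=
  exists2 s : nat -> R -> R -> R, (forall n, H1_simple (s n)) &
    \forall t \ae @lebesgue_measure R, t \in `]0, T[ ->
      H1norm (fun x => u t x - s n t x) @[n --> \oo] --> (0 : R).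

Definition Linfty_H1 {R : realType} (T : R) (u : R -> R -> R) : Prop :=
  [/\ (\forall t \ae @lebesgue_measure R, t \in `]0, T[ -> H1 (u t)),
      H1_strongly_measurable T u &
      exists M : R,
        \forall t \ae @lebesgue_measure R, t \in `]0, T[ -> H1norm (u t) <= M].

(* [u] vanishes on [X * (0, T)], as an element of L^oo(0, T; H^1(R)). *)
Definition vanishes_on {R : realType} (T : R) (X : set R) (u : R -> R -> R) :
    Prop :=
  \forall t \ae @lebesgue_measure R, t \in `]0, T[ ->
    \forall x \ae @lebesgue_measure R, X x -> u t x = 0.

(** ** Distributions on R * (0, T) *)

Definition ptime {R : realType} (phi : R -> R -> R) : R -> R -> R :=
  fun t x => derive1 (phi^~ x) t.

Definition pspace {R : realType} (phi : R -> R -> R) : R -> R -> R :=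
  fun t x => derive1 (phi t) x.

(* The iterated partial derivative encoded by a word: [true] stands for a time
   derivative and [false] for a space derivative. *)
Definition partials {R : realType} (w : seq bool) (phi : R -> R -> R) :
    R -> R -> R :=
  foldr (fun b psi => if b then ptime psi else pspace psi) phi w.

Definition smooth2 {R : realType} (phi : R -> R -> R) : Prop :=
  forall w : seq bool,
    (forall t x, derivable ((partials w phi)^~ x) t 1 /\
                 derivable (partials w phi t) x 1) /\
    continuous (fun z : R * R => partials w phi z.1 z.2).

(* Elements of C_c^oo(R * (0, T)), extended by 0. *)
Definition test_fun2 {R : realType} (T : R) (phi : R -> R -> R) : Prop :=
  smooth2 phi /\
  exists K : set (R * R),
    [/\ compact K, K `<=` [set z | 0 < z.1 < T] &
        forall t x, ~ K (t, x) -> phi t x = 0].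

(* Only the values of functionals on [test_fun2 T] matter. *)
Definition regular_distr {R : realType} (T : R) (f : R -> R -> R)
    (phi : R -> R -> R) : R :=
  \int[lebesgue_measure]_(t in `]0, T[)
    \int[lebesgue_measure]_x (f t x * phi t x).

Definition dt {R : realType} (D : (R -> R -> R) -> R) (phi : R -> R -> R) : R :=
  - D (ptime phi).

Definition dx {R : realType} (D : (R -> R -> R) -> R) (phi : R -> R -> R) : R :=
  - D (pspace phi).

(* The nonlinear term a(u) u_x is a function: [a \o u t] is bounded and the
   weak derivative of [u t] is in L^2. *)
Definition KdVB_solution {R : realType} (T : R) (a : R -> R) (u : R -> R -> R) :
    Prop :=
  let U := regular_distr T u in
  forall phi, test_fun2 T phi ->
    dt U phi - dx (dx U) phi + dx (dx (dx U)) phi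
    + regular_distr T (fun t x => a (u t x) * wderiv (u t) x) phi = 0.

(* Main.v *)
Require Import Defs.
From HB Require Import structures.
From mathcomp Require Import all_boot all_order all_algebra.
From mathcomp Require Import all_classical all_reals all_analysis.
From mathcomp Require Import measurable_realfun.
From mathcomp Require Import ring lra.
Set Implicit Arguments.
Unset Strict Implicit.
Unset Printing Implicit Defensive.
Import Order.TTheory GRing.Theory Num.Theory.
Import numFieldNormedType.Exports.
Local Open Scope classical_set_scope.
Local Open Scope ring_scope.

(** The proof is a Carleman inequality in which the weight in space is a plain
    exponential: as u vanishes outside ]-L, L[, it can be proved mode by mode,
    with Fourier series on that interval.

    Put y(t, x) = exp(l x) u_x(t, x). For a frequency xi of ]-L, L[ and
    zeta = l + i xi, let Y be the coefficient of y at xi, and G that of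
    a(u) y. Testing the equation against psi(t) times the derivative of
    exp(zeta x), and moving that derivative to u, gives, without boundary terms
    since u vanishes outside [-L, L],
      Y' = (zeta^2 + zeta^3) Y + zeta G
    ([weak_equation]). Multiply Y by a weight r(t) that vanishes near 0 and T,
    and take Fourier series in time. Whatever tau is, the modulus of
    i tau - (zeta^2 + zeta^3) is at least that of s = Re (zeta^2 + zeta^3), so
    that ([time_estimate])
      s^2 |r Y|^2 <= 2 |r' Y|^2 + 2 |zeta|^2 |r G|^2    (norms of L^2(0, T)).
    The last term loses a factor |zeta|, and s has zeros as a function of a real
    xi. But the frequencies are discrete, and l can be taken arbitrarily large
    with those zeros halfway between two of them; then |s| >= K |zeta| at every
    frequency, for K as large as desired ([frequency_choice]). Divide by
    |zeta|^2 and sum over xi, with the inequalities of Parseval for y and of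
    Bessel for a(u) y, a(u) being bounded as u is. With |y| the norm in space,
    this gives [carleman]:
      K^2 int r^2 |y|^2 <= 2 / l^2 int r'^2 |y|^2 + 2 sup |a(u)|^2 int r^2 |y|^2.

    The weight is r = exp (- n (1/(t - eta) + 1/(T - eta - t))) with n = 3 L l.
    Where the sum of the inverses is at most th, |r'| <= n th^2 r, and the
    factor n^2 / l^2 does not depend on l: this part is absorbed on the left by
    a fixed K. Elsewhere r and r' are smaller than on [2 eta, T - 2 eta] by an
    exponential of n. Since |y| lies between exp(- l L) |u_x| and
    exp(l L) |u_x|, what remains is that the integral of u_x^2 over
    [2 eta, T - 2 eta] is O(exp(- 2 L l)) ([weighted_decay]). Hence
    u_x = 0 ([grad_eq0]), and u = 0 because u vanishes outside [-L, L]
    ([sobolev]).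

    Two points need care. The map u takes values in classes of functions, and its
    modes are measurable in time only up to null sets, through the approximation
    of u by simple functions ([flux_meas]). And a is replaced by a bounded
    Lipschitz function b that agrees with it on the range of u
    ([growth_lipschitz]). *)

(** * Integration *)

Notation intb D f := ((@lebesgue_measure _).-integrable D (EFin \o f)).

Section Integration.
Context {R : realType}.
Local Notation mu := (@lebesgue_measure R).
Implicit Types (D : set R) (f g : R -> R).

Lemma aeS (P Q : R -> Prop) : (forall x, P x -> Q x) ->
  (\forall x \ae mu, P x) -> \forall x \ae mu, Q x.
Proof. exact: (@filterS _ _ (ae_filter_ringOfSetsType mu)). Qed.

Lemma aeI (P Q : R -> Prop) : (\forall x \ae mu, P x) ->
  (\forall x \ae mu, Q x) -> \forall x \ae mu, P x /\ Q x.
Proof. exact: (@filterI _ _ (ae_filter_ringOfSetsType mu)). Qed.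

Lemma aeS2 (P Q P' : R -> Prop) : (forall x, P x -> Q x -> P' x) ->
  (\forall x \ae mu, P x) -> (\forall x \ae mu, Q x) ->
  \forall x \ae mu, P' x.
Proof. by move=> h p q; apply: (aeS _ (aeI p q)) => x [? ?]; exact: h. Qed.

Lemma aeW (P : R -> Prop) : (forall x, P x) -> \forall x \ae mu, P x.
Proof. by move=> p; apply: measure_negligible.aeW. Qed.

Lemma intb_meas D f : intb D f -> measurable_fun D f.
Proof. by move=> /integrableP[/measurable_EFinP]. Qed.

Lemma intbD D f g : measurable D -> intb D f -> intb D g ->
  intb D (fun x => f x + g x).
Proof. by move=> mD fi gi; have := @integrableD _ _ _ mu _ mD _ _ fi gi. Qed.

Lemma intbZ D c f : measurable D -> intb D f -> intb D (fun x => c * f x).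
Proof. by move=> mD fi; have := @integrableZl _ _ _ mu _ mD c _ fi. Qed.

Lemma intbN D f : measurable D -> intb D f -> intb D (fun x => - f x).
Proof. by move=> mD fi; have := @integrableN _ _ _ mu D _ fi. Qed.

Lemma intbB D f g : measurable D -> intb D f -> intb D g ->
  intb D (fun x => f x - g x).
Proof. by move=> mD fi gi; apply: intbD => //; apply: intbN. Qed.

Lemma intb_le D f g : measurable D -> measurable_fun D f ->
  (forall x, D x -> `|f x| <= g x) -> intb D g -> intb D f.
Proof.
move=> mD mf fg; apply: le_integrable => //; first exact/measurable_EFinP.
by move=> x Dx; rewrite lee_fin (le_trans (fg x Dx)) ?ler_norm.
Qed.

Lemma intb_norm D f : measurable D -> intb D f -> intb D (fun x => `|f x|).
Proof. by move=> mD fi; apply: integrable_norm. Qed.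

Lemma intbMb D f g M : measurable D -> measurable_fun D g ->
  (forall x, D x -> `|g x| <= M) -> intb D f -> intb D (fun x => f x * g x).
Proof.
move=> mD mg gM fi.
apply: (@intb_le _ _ (fun x => M * `|f x|)) => //.
- by apply: measurable_funM => //; exact: intb_meas.
- by move=> x Dx; rewrite normrM mulrC ler_wpM2r // gM.
- by apply: intbZ => //; apply: intb_norm.
Qed.

Lemma intb_cst D c : measurable D -> (mu D < +oo)%E -> intb D (fun=> c).
Proof.
move=> mD fD; apply: measurable_bounded_integrable => //.
exact: bounded_cst.
Qed.

Lemma intb_bounded D f M : measurable D -> (mu D < +oo)%E ->
  measurable_fun D f -> (forall x, D x -> `|f x| <= M) -> intb D f.
Proof.
by move=> mD fD mf fM; apply: (@intb_le _ _ (fun=> M)) => //; apply: intb_cst.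
Qed.

Lemma intb_eq D f g : measurable D -> (forall x, D x -> f x = g x) ->
  intb D f -> intb D g.
Proof.
move=> mD fg; apply: eq_integrable => // x /set_mem Dx /=.
by rewrite fg.
Qed.

Lemma intb_ext D f g : f =1 g -> intb D f -> intb D g.
Proof. by move=> /funext ->. Qed.

Lemma intbS D E f : measurable D -> measurable E -> D `<=` E ->
  intb E f -> intb D f.
Proof. by move=> mD mE DE; exact: integrableS. Qed.

Lemma intb_sum D n (F : nat -> R -> R) : measurable D ->
  (forall k, intb D (F k)) -> intb D (fun x => \sum_(k < n) F k x).
Proof.
move=> mD Fi; elim: n => [|n IH].
  apply: (@intb_eq _ (fun=> 0)) => //; last exact: integrable0.
  by move=> x _; rewrite big_ord0.
apply: (@intb_ext _ (fun x => \sum_(k < n) F k x + F n x)).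
  by move=> x; rewrite big_ord_recr.
exact: intbD.
Qed.

Lemma RintD D f g : measurable D -> intb D f -> intb D g ->
  \int[mu]_(x in D) (f x + g x) = \int[mu]_(x in D) f x + \int[mu]_(x in D) g x.
Proof. by move=> mD fi gi; rewrite -RintegralD. Qed.

Lemma RintZ D c f : measurable D -> intb D f ->
  \int[mu]_(x in D) (c * f x) = c * \int[mu]_(x in D) f x.
Proof. by move=> mD fi; rewrite RintegralZl. Qed.

Lemma Rint_lin D c d f g : measurable D -> intb D f -> intb D g ->
  \int[mu]_(x in D) (c * f x + d * g x) =
  c * \int[mu]_(x in D) f x + d * \int[mu]_(x in D) g x.
Proof. by move=> mD fi gi; rewrite RintD ?RintZ//; exact: intbZ. Qed.

Lemma RintN D f : measurable D -> intb D f ->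
  \int[mu]_(x in D) (- f x) = - \int[mu]_(x in D) f x.
Proof.
move=> mD fi; rewrite -mulN1r -RintZ//; apply: eq_Rintegral => x _.
by rewrite mulN1r.
Qed.

Lemma RintB D f g : measurable D -> intb D f -> intb D g ->
  \int[mu]_(x in D) (f x - g x) = \int[mu]_(x in D) f x - \int[mu]_(x in D) g x.
Proof. by move=> mD fi gi; rewrite RintD ?RintN//; exact: intbN. Qed.

Lemma Rint_sum D n (F : nat -> R -> R) : measurable D ->
  (forall k, intb D (F k)) ->
  \int[mu]_(x in D) (\sum_(k < n) F k x) = \sum_(k < n) \int[mu]_(x in D) F k x.
Proof.
move=> mD Fi; elim: n => [|n IH].
  rewrite big_ord0; under eq_Rintegral do rewrite big_ord0.
  by rewrite Rintegral_cst// mul0r.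
rewrite big_ord_recr /= -IH -RintD//; last exact: intb_sum.
by apply: eq_Rintegral => x _; rewrite big_ord_recr.
Qed.

Lemma Rint_le D f g : measurable D -> intb D f -> intb D g ->
  (forall x, D x -> f x <= g x) ->
  \int[mu]_(x in D) f x <= \int[mu]_(x in D) g x.
Proof. by move=> mD fi gi fg; apply: le_Rintegral. Qed.

Lemma Rint_norm_le D f : measurable D -> intb D f ->
  `|\int[mu]_(x in D) f x| <= \int[mu]_(x in D) `|f x|.
Proof. by move=> mD fi; apply: le_normr_Rintegral. Qed.

Local Open Scope ereal_scope.

Import HBNNSimple.

Let nnint (f : R -> \bar R) := ereal_sup [set sintegral mu h |
  h in [set h : {nnsfun (measurableTypeR R) >-> R} | forall x, (h x)%:E <= f x]].

Let nnint_ae (f g : R -> \bar R) (N : set R) : measurable N -> mu N = 0 ->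
  (forall x, 0 <= g x) ->
  (forall x, ~ N x -> f x <= g x) -> nnint f <= nnint g.
Proof.
move=> mN N0 g0 fg; apply: le_ereal_sup => _ [h hf <-].
have mNC : measurable (~` N) by apply: measurableC.
exists (proj_nnsfun h mNC) => /=.
  move=> x; rewrite /proj_nnsfun /= mindicE.
  have [xN|xN] := boolP (x \in ~` N).
    by rewrite mulr1 (le_trans (hf x))// fg//; move: xN; rewrite inE.
  by rewrite mulr0.
rewrite -!integralT_nnsfun.
apply: ae_eq_integral => //; [|
  |exists N; split => //; move=> x /= /not_implyP[_ hx]].
- exact/measurable_EFinP.
- exact/measurable_EFinP.
- apply: contra_notP hx => xN; congr EFin.
  by rewrite /= mindicE mem_set ?mulr1.
Qed.

(** The integral of a function, measurable or not, is a supremum over simple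
    functions, and each of these can be cut off on a null set at no cost. *)
Lemma integral_ae D (f g : R -> \bar R) :
  (\forall x \ae mu, D x -> f x = g x) ->
  \int[mu]_(x in D) f x = \int[mu]_(x in D) g x.
Proof.
move=> [N [mN N0 fgN]].
have fg x : ~ N x -> (f \_ D) x = (g \_ D) x.
  move=> Nx; rewrite !patchE; case: ifPn => // /set_mem Dx.
  by apply: contra_notP Nx => fgx; apply: fgN => /= /(_ Dx).
rewrite /integral; congr (_ - _); apply/eqP; rewrite eq_le;
  apply/andP; split; apply: (@nnint_ae _ _ N) => // x Nx;
  by rewrite ?funeposE ?funenegE fg.
Qed.

End Integration.

(** * Square-integrable functions *)

Section SquareIntegrable.
Context {R : realType}.
Local Notation mu := (@lebesgue_measure R).
Implicit Types (D : set R) (f g : R -> R).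

Lemma Rint_ae D f g : (\forall x \ae mu, D x -> f x = g x) ->
  \int[mu]_(x in D) f x = \int[mu]_(x in D) g x.
Proof.
move=> fg; rewrite /Rintegral (@integral_ae _ D _ (EFin \o g))//.
by apply: (aeS _ fg) => x fgx Dx /=; rewrite fgx.
Qed.

Lemma Rint_ext D f g : (forall x, D x -> f x = g x) ->
  \int[mu]_(x in D) f x = \int[mu]_(x in D) g x.
Proof. by move=> fg; apply: eq_Rintegral => x /set_mem; exact: fg. Qed.

Lemma Rint0 D : \int[mu]_(x in D) (0 : R) = 0.
Proof. by rewrite /Rintegral integral0. Qed.

Lemma Rint_setT_sub D f : (\forall x \ae mu, ~ D x -> f x = 0) ->
  \int[mu]_x f x = \int[mu]_(x in D) f x.
Proof.
move=> f0; rewrite [RHS]Rintegral_mkcond; apply: Rint_ae.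
apply: (aeS _ f0) => x fx _; rewrite patchE.
by case: ifPn => // /negP; rewrite inE => /fx.
Qed.

Lemma Rint_indic D E f : E `<=` D ->
  \int[mu]_(x in D) (f x * \1_E x) = \int[mu]_(x in E) f x.
Proof.
move=> ED; rewrite [RHS]Rintegral_mkcond [LHS]Rintegral_mkcond.
apply: Rint_ext => x _; rewrite !patchE indicE.
have [xE|xE] := boolP (x \in E); last by rewrite mulr0; case: ifP.
by rewrite ifT ?mulr1// inE; apply: ED; rewrite -inE.
Qed.

Lemma intb_patch E f : measurable E -> intb E f -> intb setT (f \_ E).
Proof.
by move=> mE fi; rewrite -restrict_EFin; apply/integrable_restrict; rewrite ?setTI.
Qed.

Lemma mu_oo_fin (a b : R) : (mu `]a, b[%classic < +oo)%E.
Proof.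
by rewrite lebesgue_measure_itv /=; case: ifP => _; rewrite // -EFinB ltry.
Qed.

Lemma mu_oo (a b : R) : a <= b -> fine (mu `]a, b[%classic) = b - a.
Proof.
move=> ab; rewrite lebesgue_measure_itv /= lte_fin; case: ltP => //= ba.
have -> : a = b by apply/eqP; rewrite eq_le ab.
by rewrite subrr.
Qed.

Lemma Rint_bound (a b M : R) f : a <= b -> intb `]a, b[ f ->
  (forall x, a < x < b -> `|f x| <= M) ->
  `|\int[mu]_(x in `]a, b[) f x| <= M * (b - a).
Proof.
move=> ab fi fM; rewrite -mu_oo// -Rintegral_cst//.
apply: (le_trans (Rint_norm_le _ fi)) => //.
apply: Rint_le => //; first exact: intb_norm.
by apply: intb_cst => //; exact: mu_oo_fin.
Qed.

Lemma Rint_eq0 D f : measurable D -> intb D f -> (forall x, D x -> 0 <= f x) ->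
  \int[mu]_(x in D) f x = 0 -> \forall x \ae mu, D x -> f x = 0.
Proof.
move=> mD fi f0 If0.
have : ae_eq mu D (EFin \o f) (cst 0%E).
  apply: (@ae_eq_integral_abs _ _ _ mu D mD _ (measurable_int _ fi)).1.
  rewrite -[LHS]fineK; last first.
    by have /integrableP[_] := fi; rewrite ge0_fin_numE// integral_ge0.
  congr EFin; rewrite -[RHS]If0 /Rintegral; congr fine.
  by apply: eq_integral => x /set_mem Dx /=; rewrite ger0_norm ?f0.
by apply: aeS => x /[apply] /= -[].
Qed.

Lemma Rint_le_ae D f g : measurable D -> intb D f -> intb D g ->
  (\forall x \ae mu, D x -> f x <= g x) ->
  \int[mu]_(x in D) f x <= \int[mu]_(x in D) g x.
Proof.
move=> mD fi gi fg.
rewrite (@Rint_ae D f (fun x => g x - `|g x - f x|)); last first.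
  by apply: (aeS _ fg) => x h /h gf; rewrite ger0_norm ?subr_ge0// opprB addrCA subrr addr0.
apply: Rint_le => //; last by move=> x _; rewrite gerBl.
apply: intbB => //; exact: (intb_norm mD (intbB mD gi fi)).
Qed.

Lemma Rint_dominated D (f_ : nat -> R -> R) f g : measurable D ->
  (forall n, measurable_fun D (f_ n)) -> measurable_fun D f ->
  (\forall x \ae mu, D x -> f_ n x @[n --> \oo] --> f x) -> intb D g ->
  (\forall x \ae mu, forall n, D x -> `|f_ n x| <= g x) ->
  \int[mu]_(x in D) f_ n x @[n --> \oo] --> \int[mu]_(x in D) f x.
Proof.
move=> mD mf_ mf f_f gi f_g.
have f_f' : \forall x \ae mu, D x -> (f_ n x)%:E @[n --> \oo] --> (f x)%:E.
  by apply: (aeS _ f_f) => x h Dx; apply: cvg_EFin; [exact: nearW | exact: h].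
have f_g' : \forall x \ae mu, forall n, D x -> (`|(f_ n x)%:E| <= (g x)%:E)%E.
  by apply: (aeS _ f_g) => x h n Dx; rewrite lee_fin; exact: h.
have [fi _ cf] := @dominated_convergence _ _ _ mu D mD
  (fun n => EFin \o f_ n) (EFin \o f) (EFin \o g)
  (fun n => (measurable_EFinP _ _).2 (mf_ n)) ((measurable_EFinP _ _).2 mf)
  f_f' gi f_g'.
apply: fine_cvg; rewrite fineK ?integrable_fin_num//; exact: cf.
Qed.

Definition sq D f : Prop :=
  measurable_fun D f /\ intb D (fun x => f x ^+ 2).

Lemma sqM_intb D f g : measurable D -> sq D f -> sq D g ->
  intb D (fun x => f x * g x).
Proof.
move=> mD [mf fi] [mg gi].
apply: (@intb_le _ _ _ (fun x => f x ^+ 2 + g x ^+ 2)) => //.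
- exact: measurable_funM.
- move=> x _; rewrite normrM -(real_normK (num_real (f x))).
  rewrite -(real_normK (num_real (g x))).
  have := sqr_ge0 (`|f x| - `|g x|).
  have := mulr_ge0 (normr_ge0 (f x)) (normr_ge0 (g x)); nra.
- exact: intbD.
Qed.

Lemma sqD D f g : measurable D -> sq D f -> sq D g -> sq D (fun x => f x + g x).
Proof.
move=> mD sf sg; have [[mf fi] [mg gi]] := (sf, sg); split.
  exact: measurable_funD.
apply: (@intb_ext _ _ (fun x => (f x ^+ 2 + g x ^+ 2) + 2 * (f x * g x))).
  by move=> x; ring.
by apply: intbD => //; [apply: intbD | apply: intbZ => //; apply: sqM_intb].
Qed.

Lemma sqZ D c f : measurable D -> sq D f -> sq D (fun x => c * f x).
Proof.
move=> mD [mf fi]; split; first exact: measurable_funM.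
apply: (@intb_ext _ _ (fun x => c ^+ 2 * f x ^+ 2)).
  by move=> x; rewrite exprMn.
exact: intbZ.
Qed.

Lemma sqB D f g : measurable D -> sq D f -> sq D g -> sq D (fun x => f x - g x).
Proof.
move=> mD sf /(sqZ (-1) mD) sg; have [mh hi] := sqD mD sf sg.
have e : (fun x => f x - g x) = (fun x => f x + -1 * g x).
  by apply/funext => x; rewrite mulN1r.
by rewrite e.
Qed.

Lemma sqMb D f g M : measurable D -> measurable_fun D g ->
  (forall x, D x -> `|g x| <= M) -> sq D f -> sq D (fun x => f x * g x).
Proof.
move=> mD mg gM [mf fi]; split; first exact: measurable_funM.
apply: (@intb_ext _ _ (fun x => f x ^+ 2 * g x ^+ 2)).
  by move=> x; rewrite exprMn.
apply: (@intbMb _ _ _ _ (M ^+ 2)) => //; first exact: measurable_funX.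
by move=> x Dx; rewrite normrX lerXn2r ?nnegrE ?gM// (le_trans _ (gM x Dx)).
Qed.

Lemma sq_norm D f : sq D f -> sq D (fun x => `|f x|).
Proof.
move=> [mf fi]; split; first exact: measurableT_comp.
by apply: intb_ext fi => x; rewrite real_normK ?num_real.
Qed.

Lemma sq_bounded D f M : measurable D -> (mu D < +oo)%E ->
  measurable_fun D f -> (forall x, D x -> `|f x| <= M) -> sq D f.
Proof.
move=> mD fD mf fM; split=> //; apply: (@intb_bounded _ _ _ (M ^+ 2)) => //.
  exact: measurable_funX.
by move=> x Dx; rewrite normrX lerXn2r ?nnegrE ?fM// (le_trans _ (fM x Dx)).
Qed.

Lemma sqS D E f : measurable D -> measurable E -> D `<=` E -> sq E f -> sq D f.
Proof.
move=> mD mE DE [mf fi]; split; first exact: measurable_funS mf.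
exact: intbS fi.
Qed.

Lemma sq_intb D f : measurable D -> (mu D < +oo)%E -> sq D f -> intb D f.
Proof.
move=> mD fD sf; apply: (@intb_ext _ _ (fun x => f x * 1)).
  by move=> x; rewrite mulr1.
apply: sqM_intb => //.
by apply: (@sq_bounded _ _ 1) => // x _; rewrite normr1.
Qed.

Lemma Rint_sq_ge0 D f : 0 <= \int[mu]_(x in D) (f x ^+ 2).
Proof. by apply: Rintegral_ge0 => x _; exact: sqr_ge0. Qed.

Lemma Rint_sqD D f g : measurable D -> sq D f -> sq D g ->
  \int[mu]_(x in D) ((f x + g x) ^+ 2) =
  \int[mu]_(x in D) (f x ^+ 2) + 2 * \int[mu]_(x in D) (f x * g x) +
  \int[mu]_(x in D) (g x ^+ 2).
Proof.
move=> mD sf sg; have [[mf fi] [mg gi]] := (sf, sg).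
have fgi : intb D (fun x => 2 * (f x * g x)).
  by apply: intbZ => //; exact: sqM_intb.
rewrite -RintZ//; last exact: sqM_intb.
rewrite -(RintD mD fi fgi) -(RintD mD (intbD mD fi fgi) gi).
by apply: Rint_ext => x _; ring.
Qed.

Lemma cauchy_schwarz D f g : measurable D -> sq D f -> sq D g ->
  (\int[mu]_(x in D) (f x * g x)) ^+ 2 <=
  \int[mu]_(x in D) (f x ^+ 2) * \int[mu]_(x in D) (g x ^+ 2).
Proof.
move=> mD sf sg.
set F := \int[mu]_(x in D) (f x ^+ 2); set G := \int[mu]_(x in D) (g x ^+ 2).
set I := \int[mu]_(x in D) (f x * g x).
have pos s : 0 <= F + 2 * (s * I) + s ^+ 2 * G.
  have := Rint_sq_ge0 D (fun x => f x + s * g x).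
  rewrite Rint_sqD//; last exact: sqZ.
  have -> : \int[mu]_(x in D) (f x * (s * g x)) = s * I.
    rewrite -RintZ//; last exact: sqM_intb.
    by apply: Rint_ext => x _; ring.
  have -> // : \int[mu]_(x in D) ((s * g x) ^+ 2) = s ^+ 2 * G.
  rewrite -RintZ//; last by case: sg.
  by apply: Rint_ext => x _; ring.
have F0 : 0 <= F by exact: Rint_sq_ge0.
have [G0|G0] := eqVneq G 0.
  rewrite G0 mulr0; suff -> : I = 0 by rewrite expr0n.
  apply/eqP/negPn/negP => I0.
  have := pos (- (F + 1) / (2 * I)).
  have -> : - (F + 1) / (2 * I) * I = - (F + 1) / 2 by field.
  by rewrite G0 mulr0; lra.
have Gp : 0 < G by rewrite lt_neqAle eq_sym G0 Rint_sq_ge0.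
have := pos (- I / G).
have -> : F + 2 * (- I / G * I) + (- I / G) ^+ 2 * G = (F * G - I ^+ 2) / G.
  by field.
by rewrite pmulr_lge0 ?invr_gt0// subr_ge0.
Qed.

Lemma sq_L2 f : L2 f -> sq setT f.
Proof.
move=> fL2; split; last exact: (@Lfun2_integrable_sqr _ _ _ mu).
by move: fL2; rewrite /L2 inE => /andP[]; rewrite inE.
Qed.

Lemma L2D f g : L2 f -> L2 g -> L2 (fun x => f x + g x).
Proof.
move=> fi gi; have [_ h] := @Lfun_addr_closed _ _ R mu 2%:E (@lee1n R 2).
exact: h.
Qed.

Lemma L2Z c f : L2 f -> L2 (fun x => c * f x).
Proof.
move=> /(@Lfun_scale _ _ _ mu _ c 2 (ler1n _ 2)).
by have -> : (c \o* f) = (fun x => c * f x) by apply/funext => x; rewrite mulrC.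
Qed.

Lemma L2B f g : L2 f -> L2 g -> L2 (fun x => f x - g x).
Proof.
move=> fi /(L2Z (-1)) gi; have := L2D fi gi; congr L2.
by apply/funext => x; rewrite mulN1r.
Qed.

End SquareIntegrable.

(** * Smooth functions *)

Section Smooth.
Context {R : realType}.
Implicit Types (f g : R -> R).

(** A variant rather than a definition, so that unification does not unfold
    it. *)
Variant smooth f : Prop :=
  Smooth of forall (n : nat) (x : R), derivable (derive1n n f) x 1.

Lemma smooth_derivable f n (x : R) : smooth f -> derivable (derive1n n f) x 1.
Proof. by case. Qed.

Lemma isdE f x d : is_derive x (1 : R) f d -> derivable f x 1 /\ (derive1 f) x = d.
Proof.
by move=> fd; split; [exact: ex_derive | rewrite derive1E derive_val].
Qed.

Lemma isdP f x : derivable f x 1 -> is_derive x (1 : R) f ((derive1 f) x).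
Proof. by move=> fd; rewrite derive1E; exact: derivableP. Qed.

Lemma isd_funE f f' : (forall x, is_derive x (1 : R) f (f' x)) -> (derive1 f) = f'.
Proof. by move=> fd; apply/funext => x; have [] := isdE (fd x). Qed.

Lemma isd_eq f x d d' : is_derive x (1 : R) f d -> d = d' ->
  is_derive x (1 : R) f d'.
Proof. by move=> ? <-. Qed.

Lemma isd_ext f g x d : f =1 g -> is_derive x (1 : R) f d ->
  is_derive x (1 : R) g d.
Proof. by move=> /funext ->. Qed.

Lemma isdD f g x df dg : is_derive x (1 : R) f df -> is_derive x (1 : R) g dg ->
  is_derive x (1 : R) (fun y => f y + g y) (df + dg).
Proof. by move=> fd gd; exact: is_deriveD. Qed.

Lemma isdM f g x df dg : is_derive x (1 : R) f df -> is_derive x (1 : R) g dg ->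
  is_derive x (1 : R) (fun y => f y * g y) (df * g x + f x * dg).
Proof.
by move=> fd gd; apply: isd_eq (is_deriveM fd gd) _; rewrite /GRing.scale /=; ring.
Qed.

Lemma isdZ c f x df : is_derive x (1 : R) f df ->
  is_derive x (1 : R) (fun y => c * f y) (c * df).
Proof. by move=> fd; exact: is_deriveZ. Qed.

Lemma isd_comp f g x df dg : is_derive (g x) (1 : R) f df ->
  is_derive x (1 : R) g dg ->
  is_derive x (1 : R) (fun y => f (g y)) (df * dg).
Proof. by move=> fd gd; exact: is_derive1_comp. Qed.

Lemma smooth_derive f : smooth f <->
  (forall x, derivable f x 1) /\ smooth (derive1 f).
Proof.
split=> [[fs]|[fd [fs]]].
  split=> [x|]; first exact: (fs 0%N).
  by split=> n x; have := fs n.+1 x; rewrite /derive1n iterSr.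
by split; case=> [|n] x; [exact: fd | rewrite /derive1n iterSr; exact: fs].
Qed.

(** The functions built from a class [B] by sums, products and composition.
    Differentiation maps such a class to itself as soon as it maps [B] to it,
    so that smoothness only has to be looked at on the generators. *)
Inductive generated (B : set (R -> R)) : (R -> R) -> Prop :=
| gen_base f : B f -> generated B f
| gen_cst c : generated B (fun=> c)
| gen_id : generated B id
| gen_add f g : generated B f -> generated B g ->
    generated B (fun x => f x + g x)
| gen_mul f g : generated B f -> generated B g ->
    generated B (fun x => f x * g x)
| gen_comp f g : generated B f -> generated B g ->
    generated B (fun x => f (g x)).

Lemma generated_smooth (B : set (R -> R)) :
  (forall f, B f -> exists2 f', generated B f' &
     forall x, is_derive x (1 : R) f (f' x)) ->
  forall f, generated B f -> smooth f.
Proof.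
move=> Bd f Bf.
have dgen g : generated B g -> exists2 g', generated B g' &
    forall x, is_derive x (1 : R) g (g' x).
  elim=> {g} [g /Bd //|c||g h _ [g' Bg' dg] _ [h' Bh' dh]
    |g h Bg [g' Bg' dg] Bh [h' Bh' dh]|g h Bg [g' Bg' dg] Bh [h' Bh' dh]].
  - by exists (fun=> 0); [exact: gen_cst | move=> x; exact: is_derive_cst].
  - by exists (fun=> 1); [exact: gen_cst | move=> x; exact: is_derive_id].
  - by exists (fun x => g' x + h' x); [exact: gen_add | move=> x; exact: isdD].
  - exists (fun x => g' x * h x + g x * h' x); last by move=> x; exact: isdM.
    by apply: gen_add; apply: gen_mul.
  - exists (fun x => g' (h x) * h' x); last by move=> x; exact: isd_comp.
    by apply: gen_mul => //; exact: gen_comp.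
suff H n : forall g, generated B g -> generated B (derive1n n g).
  by split=> n x; have [f' _ /(_ x) /isdE[]] := dgen _ (H n f Bf).
elim: n => [//|n IH] g Bg; rewrite /derive1n iterSr.
by have [g' Bg' /isd_funE ->] := dgen g Bg; exact: IH.
Qed.

Lemma gen_smooth f : generated smooth f -> smooth f.
Proof.
apply: generated_smooth => {}f /smooth_derive[fd f's].
by exists (derive1 f); [exact: gen_base | move=> x; exact/isdP].
Qed.

Lemma smoothD f g : smooth f -> smooth g -> smooth (fun x => f x + g x).
Proof. by move=> fs gs; apply/gen_smooth/gen_add; exact: gen_base. Qed.

Lemma smoothM f g : smooth f -> smooth g -> smooth (fun x => f x * g x).
Proof. by move=> fs gs; apply/gen_smooth/gen_mul; exact: gen_base. Qed.

Lemma smooth_comp f g : smooth f -> smooth g -> smooth (fun x => f (g x)).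
Proof.
by move=> fs gs; apply/gen_smooth/(@gen_comp _ f g); exact: gen_base.
Qed.

Lemma smooth_cst c : smooth (fun=> c).
Proof. exact/gen_smooth/gen_cst. Qed.

Lemma smooth_id : smooth id.
Proof. exact/gen_smooth/gen_id. Qed.

Lemma smooth_affine a b : smooth (fun x => a * x + b).
Proof.
apply: smoothD; last exact: smooth_cst.
by apply: smoothM; [exact: smooth_cst | exact: smooth_id].
Qed.

Lemma smooth_expR : smooth (@expR R).
Proof.
apply: (@generated_smooth [set expR]); last exact: gen_base.
by move=> _ ->; exists expR; [exact: gen_base | exact: is_derive_expR].
Qed.

Let smooth_trig f : [set sin; cos] f -> smooth f.
Proof.
move=> Bf; apply: (@generated_smooth [set sin; cos]); last exact: gen_base.
move=> {Bf}_ [] ->.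
  by exists cos; [apply: gen_base; right | exact: is_derive_sin].
exists (fun x => -1 * sin x).
  by apply: gen_mul; [exact: gen_cst | apply: gen_base; left].
by move=> x; apply: isd_eq (is_derive_cos x) _; rewrite mulN1r.
Qed.

Lemma smooth_sin : smooth (@sin R).
Proof. by apply: smooth_trig; left. Qed.

Lemma smooth_cos : smooth (@cos R).
Proof. by apply: smooth_trig; right. Qed.

Lemma derivable_cont f x : derivable f x 1 -> {for x, continuous f}.
Proof. by move=> /derivable1_diffP; exact: differentiable_continuous. Qed.

Lemma smooth_isd f x : smooth f -> is_derive x (1 : R) f ((derive1 f) x).
Proof. by move=> fs; have := @smooth_derivable f 0%N x fs => /isdP. Qed.

Lemma smooth_d f : smooth f -> smooth (derive1 f).
Proof. by move=> /smooth_derive[]. Qed.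

Lemma smooth_cont f : smooth f -> continuous f.
Proof. by move=> fs x; apply: derivable_cont; exact: (@smooth_derivable f 0%N x fs). Qed.

Lemma smooth_meas f D : smooth f -> measurable D -> measurable_fun D f.
Proof.
move=> /smooth_cont fc mD; apply: measurable_funTS.
exact: continuous_measurable_fun.
Qed.

(** ** The flat function exp(-1/x) *)

(** The functions x^-m exp(-1/x) are closed under differentiation, up to linear
    combinations, and all of them are o(x) at 0. *)
Definition flatm (m : nat) (x : R) : R :=
  if 0 < x then x^-1 ^+ m * expR (- x^-1) else 0.

Lemma flatm_bound m x : `|flatm m x| <= m.+2`!%:R * x ^+ 2.
Proof.
rewrite /flatm; case: ifPn => [x0|_]; last first.
  by rewrite normr0 mulr_ge0// sqr_ge0.
have y0 : 0 < x^-1 by rewrite invr_gt0.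
rewrite ger0_norm; last by rewrite mulr_ge0 ?expR_ge0// exprn_ge0// ltW.
have := @expR_ge1Dxn R x^-1 m.+1 (ltW y0).
rewrite expRN ler_pdivrMr ?expR_gt0// => h.
apply: le_trans (ler_wpM2l _ h); last by rewrite mulr_ge0// sqr_ge0.
have f0 : (0 : R) < m.+2`!%:R by rewrite ltr0n fact_gt0.
apply: (@le_trans _ _ (m.+2`!%:R * x ^+ 2 * (x^-1 ^+ m.+2 / m.+2`!%:R))).
  move: f0; set F := m.+2`!%:R => f0; rewrite 2!(exprS x^-1).
  set y := _ ^+ m; rewrite le_eqVlt; apply/orP; left; apply/eqP.
  by field; rewrite !gt_eqF.
apply: ler_wpM2l; first by rewrite mulr_ge0// sqr_ge0.
by rewrite lerDr.
Qed.

Lemma flatm_isd m x :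
  is_derive x (1 : R) (flatm m) (flatm m.+2 x - m%:R * flatm m.+1 x).
Proof.
have [x0|x0|->] := ltgtP x 0.
- have nx : \near x, (fun=> 0 : R) x = flatm m x.
    have : \near x, x < 0 by exact: lt_nbhsl.
    by apply: filterS => y y0; rewrite /flatm ltNge (ltW y0).
  apply: near_eq_is_derive nx _; apply: isd_eq (is_derive_cst _ _ _) _.
  by rewrite /flatm ltNge (ltW x0) /=; ring.
- have nx : \near x, x^-1 ^+ m * expR (- x^-1) = flatm m x.
    have : \near x, 0 < x by exact: lt_nbhsr.
    by apply: filterS => y y0; rewrite /flatm y0.
  apply: near_eq_is_derive nx _.
  have xn0 : x != 0 by rewrite gt_eqF.
  have dV : is_derive x (1 : R) (fun y => y^-1) (- x ^- 2).
    by apply: isd_eq (is_deriveV xn0 (is_derive_id _ _)) _; rewrite /GRing.scale /= mulr1.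
  have dP : is_derive x (1 : R) (fun y => y^-1 ^+ m)
      (m%:R * x^-1 ^+ m.-1 * - x ^- 2).
    by have := is_deriveX m dV; rewrite exprfctE.
  have dE : is_derive x (1 : R) (fun y => expR (- y^-1)) (expR (- x^-1) * x ^- 2).
    apply: isd_eq (isd_comp (is_derive_expR _) (is_deriveN dV)) _.
    by rewrite opprK.
  apply: isd_eq (isdM dP dE) _; rewrite /flatm x0.
  case: m {dP} => [|m] /=; rewrite ?exprS; field => //.
- have f00 k : flatm k 0 = 0 by rewrite /flatm ltxx.
  rewrite !f00 mulr0 subr0.
  have lim0 : h^-1 *: (flatm m (h *: 1 + 0) - flatm m 0) @[h --> 0^'] --> (0 : R).
    apply/cvgr0Pnorm_le => e e0.
    near=> h.
    have hn0 : h != 0 by near: h; exact: nbhs_dnbhs_neq.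
    rewrite f00 subr0 addr0 /GRing.scale /= mulr1 normrM normfV.
    rewrite ler_pdivrMl ?normr_gt0//.
    apply: (le_trans (flatm_bound m h)).
    rewrite -(real_normK (num_real h)) expr2 mulrCA ler_pM2l ?normr_gt0//.
    rewrite -ler_pdivlMl ?ltr0n ?fact_gt0//.
    near: h; apply: dnbhs0_le; rewrite mulr_gt0// invr_gt0 ltr0n fact_gt0//.
  apply: DeriveDef; first by apply/cvg_ex; exists 0; exact: lim0.
  exact: cvg_lim.
Unshelve. all: by end_near.
Qed.

Lemma smooth_flatm m : smooth (flatm m).
Proof.
apply: (@generated_smooth [set f | exists k, f = flatm k]); last first.
  by apply: gen_base; exists m.
move=> _ [k ->].
exists (fun x => flatm k.+2 x + - k%:R * flatm k.+1 x).
  apply: gen_add; first by apply: gen_base; exists k.+2.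
  by apply: gen_mul; [exact: gen_cst | apply: gen_base; exists k.+1].
by move=> x; apply: isd_eq (flatm_isd k x) _; rewrite mulNr.
Qed.

Definition flat : R -> R := flatm 0.

Lemma flatE x : flat x = if 0 < x then expR (- x^-1) else 0.
Proof. by rewrite /flat /flatm; case: ifP; rewrite ?expr0 ?mul1r. Qed.

Lemma flat_ge0 x : 0 <= flat x.
Proof. by rewrite flatE; case: ifP; rewrite ?expR_ge0. Qed.

Lemma flat_gt0 x : 0 < x -> 0 < flat x.
Proof. by rewrite flatE => ->; rewrite expR_gt0. Qed.

Lemma flat_le0 x : x <= 0 -> flat x = 0.
Proof. by move=> x0; rewrite flatE ltNge x0. Qed.

Lemma smooth_flat : smooth flat.
Proof. exact: smooth_flatm. Qed.

End Smooth.

(** * Cutoff functions and localisation of integral bounds *)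

Section Cutoffs.
Context {R : realType}.
Local Notation mu := (@lebesgue_measure R).
Implicit Types (f g : R -> R).

Lemma mean_value f df (a b : R) : (forall x, is_derive x (1 : R) f (df x)) ->
  a < b -> exists2 c, a < c < b & f b - f a = df c * (b - a).
Proof.
move=> fd ab.
have [|c] := @MVT R f df a b ab (fun x _ => fd x); last first.
  by rewrite in_itv /= => cab e; exists c.
apply: continuous_subspaceT => x; apply: derivable_cont.
exact: (@ex_derive _ _ _ _ _ _ _ (fd x)).
Qed.

Lemma isd_nondecr f df (a b : R) : (forall x, is_derive x (1 : R) f (df x)) ->
  (forall x, 0 <= df x) -> a <= b -> f a <= f b.
Proof.
move=> fd df0; rewrite le_eqVlt => /predU1P[->//|ab].
have [c _ e] := mean_value fd ab.
by rewrite -subr_ge0 e mulr_ge0// subr_ge0 ltW.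
Qed.

Lemma isd_cst f df (a b : R) : (forall x, is_derive x (1 : R) f (df x)) ->
  (forall x, a <= x -> df x = 0) -> a <= b -> f a = f b.
Proof.
move=> fd df0; rewrite le_eqVlt => /predU1P[->//|ab].
have [c /andP[ac _] e] := mean_value fd ab.
by apply/eqP; rewrite eq_sym -subr_eq0 e df0 ?mul0r ?ltW.
Qed.

Lemma cont_intb_cc (a b : R) f : continuous f -> intb `[a, b] f.
Proof.
move=> fc; apply: continuous_compact_integrable; first exact: segment_compact.
exact: continuous_subspaceT.
Qed.

Lemma cont_intb_oo (a b : R) f : continuous f -> intb `]a, b[ f.
Proof.
move=> fc; apply: (@intbS _ _ `[a, b]) => //; last exact: cont_intb_cc.
exact: subset_itv_oo_cc.
Qed.

Lemma cont_meas f (D : set R) : continuous f -> measurable D -> measurable_fun D f.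
Proof.
move=> fc mD; apply: measurable_funTS; exact: continuous_measurable_fun.
Qed.

Lemma cont_sum n (F : nat -> R -> R) : (forall k, continuous (F k)) ->
  continuous (fun x => \sum_(k < n) F k x).
Proof.
move=> Fc; elim: n => [|n IH] x.
  by under eq_fun do rewrite big_ord0; exact: cvg_cst.
under eq_fun do rewrite big_ord_recr.
by apply: cvgD; [exact: IH | exact: Fc].
Qed.

Lemma cont_bounded (a b : R) f : continuous f ->
  exists2 M, 0 <= M & forall x, a <= x <= b -> `|f x| <= M.
Proof.
move=> fc.
have [M [_ HM]] : bounded_set (f @` `[a, b]).
  apply: compact_bounded; apply: continuous_compact; last exact: segment_compact.
  exact: continuous_subspaceT.
exists (`|M| + 1) => [|x xab]; first by rewrite addr_ge0.
apply: HM; first by rewrite ltr_pwDr// ler_norm.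
by exists x => //=; rewrite in_itv.
Qed.

Lemma Rint_oo_cc (a b : R) f : intb `[a, b] f ->
  \int[mu]_(x in `]a, b[) f x = \int[mu]_(x in `[a, b]) f x.
Proof.
move=> fi; rewrite Rintegral_itv_bndo_bndc ?Rintegral_itv_obnd_cbnd//.
  by apply: (@intbS _ _ `[a, b]) => //; exact: subset_itv_oc_cc.
by apply: (@intbS _ _ `[a, b]) => //; exact: subset_itv_oo_cc.
Qed.

Lemma Rint_FTC (a b : R) F f : a < b -> (forall x, is_derive x (1 : R) F (f x)) ->
  continuous f -> \int[mu]_(x in `]a, b[) f x = F b - F a.
Proof.
move=> ab Fd fc; rewrite Rint_oo_cc; last exact: cont_intb_cc.
have Fc : continuous F.
  by move=> x; apply: derivable_cont; have [] := isdE (Fd x).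
rewrite /Rintegral (@continuous_FTC2 _ f F)//.
- exact: continuous_subspaceT.
- split; first by move=> x _; have [] := isdE (Fd x).
  + exact/cvg_at_right_filter/Fc.
  + exact/cvg_at_left_filter/Fc.
- by move=> x _; have [] := isdE (Fd x).
Qed.

(** The primitive of a function that vanishes on the left of [c]; integrating
    from [c - 1] makes the two descriptions of it, near [c], overlap. *)
Definition prim (c : R) g (x : R) : R := \int[mu]_(t in `[c - 1, x]) g t.

Section Primitive.
Variables (c : R) (g : R -> R).
Hypotheses (gc : continuous g) (g0 : forall x, x <= c -> g x = 0).

Lemma prim_eq0 x : x <= c -> prim c g x = 0.
Proof.
move=> xc; rewrite /prim -[RHS](Rint0 `[c - 1, x]); apply: Rint_ext => t /=.
by rewrite in_itv /= => /andP[_ tx]; rewrite g0// (le_trans tx).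
Qed.

Lemma prim_isd x : is_derive x (1 : R) (prim c g) (g x).
Proof.
have [xc|cx] := ltP x c.
  have nx : \near x, (fun=> 0 : R) x = prim c g x.
    have : \near x, x < c by exact: lt_nbhsl.
    by apply: filterS => y /ltW /prim_eq0.
  by apply: near_eq_is_derive nx _; rewrite g0 ?ltW//; exact: is_derive_cst.
have h1 : c - 1 < x by rewrite (lt_le_trans _ cx)// ltrBlDr ltrDl.
have h2 : x < x + 1 by rewrite ltrDl.
have [h3 <-] := continuous_FTC1_closed h2 (cont_intb_cc _ _ gc) h1 (@gc x).
exact: isdP.
Qed.

Lemma prim_le (d x : R) : (forall x, d <= x -> g x = 0) ->
  `|prim c g x| <= \int[mu]_(t in `]c, d[) `|g t|.
Proof.
move=> gd; have gn : continuous (fun t => `|g t|).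
  by move=> t; apply: cvg_norm; exact: gc.
apply: (le_trans (Rint_norm_le _ (cont_intb_cc _ _ gc))) => //.
rewrite Rintegral_mkcond [leRHS]Rintegral_mkcond.
have i1 : intb setT ((fun t => `|g t|) \_ `[c - 1, x]).
  by apply: intb_patch => //; exact: cont_intb_cc.
have i2 : intb setT ((fun t => `|g t|) \_ `]c, d[).
  by apply: intb_patch => //; exact: cont_intb_oo.
apply: Rint_le => // t _.
rewrite !patchE; case: (t \in `[_, _]%classic); last first.
  by case: ifP => // _; exact: normr_ge0.
case: ifPn => //; rewrite notin_setE /= in_itv /= => /negP; rewrite negb_and -!leNgt.
by move=> /orP[/g0|/gd] ->; rewrite normr0.
Qed.

Lemma smooth_prim : smooth g -> smooth (prim c g).
Proof.
move=> gs; apply/smooth_derive; split=> [x|]; first by have [] := isdE (prim_isd x).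
by rewrite (isd_funE prim_isd).
Qed.

End Primitive.

(** ** A smooth step and the plateaus made from it *)

Let bmp (x : R) : R := flat x * flat (1 - x).

Let smooth_bmp : smooth bmp.
Proof.
apply: smoothM; first exact: smooth_flat.
have -> : (fun x : R => flat (1 - x)) = (fun x => flat (-1 * x + 1)).
  by apply/funext => x; rewrite mulN1r addrC.
apply: (smooth_comp smooth_flat); exact: smooth_affine.
Qed.

Let bmp_ge0 x : 0 <= bmp x. Proof. by rewrite mulr_ge0// flat_ge0. Qed.

Let bmp_le0 (x : R) : x <= 0 -> bmp x = 0.
Proof. by move=> x0; rewrite /bmp flat_le0// mul0r. Qed.

Let bmp_ge1 x : 1 <= x -> bmp x = 0.
Proof. by move=> x1; rewrite /bmp (@flat_le0 _ (1 - x)) ?mulr0// subr_le0. Qed.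

Let P := prim 0 bmp.
Let P_isd x : is_derive x (1 : R) P (bmp x).
Proof. exact: (prim_isd (smooth_cont smooth_bmp) bmp_le0). Qed.

Let P_le0 (x : R) : x <= 0 -> P x = 0. Proof. exact: prim_eq0. Qed.

Let P_ge0 x : 0 <= P x.
Proof.
have [/P_le0 ->//|/ltW x0] := leP x 0.
by rewrite -(P_le0 (lexx 0)); exact: isd_nondecr P_isd _ x0.
Qed.

Let P_le1 x : P x <= P 1.
Proof.
have [x1|/ltW x1] := leP x 1; first exact: isd_nondecr P_isd _ x1.
by rewrite (isd_cst P_isd bmp_ge1 x1).
Qed.

Let P1_gt0 : 0 < P 1.
Proof.
rewrite lt_neqAle P_ge0 andbT; apply/eqP => P10.
have e : P = fun=> 0.
  by apply/funext => x; apply/eqP; rewrite eq_le P_ge0 andbT P10 P_le1.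
have [_] := isdE (P_isd 2^-1); rewrite e derive1E derive_cst => /esym/eqP.
by rewrite gt_eqF// mulr_gt0// flat_gt0//; lra.
Qed.

Definition step (x : R) : R := P x / P 1.

Lemma smooth_step : smooth step.
Proof.
apply: smoothM; last exact: smooth_cst.
apply: smooth_prim => //; exact: smooth_cont.
Qed.

Lemma step_ge0 x : 0 <= step x. Proof. by rewrite divr_ge0. Qed.

Lemma step_le1 x : step x <= 1. Proof. by rewrite ler_pdivrMr// mul1r. Qed.

Lemma step_le0 (x : R) : x <= 0 -> step x = 0.
Proof. by move=> x0; rewrite /step P_le0// mul0r. Qed.

Lemma step_ge1 (x : R) : 1 <= x -> step x = 1.
Proof. by move=> x1; rewrite /step -(isd_cst P_isd bmp_ge1 x1) mulfV ?gt_eqF. Qed.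

Definition plateau (n c d x : R) : R := step (n * (x - c)) * step (n * (d - x)).

Lemma smooth_plateau n c d : smooth (plateau n c d).
Proof.
apply: smoothM; apply: (smooth_comp smooth_step).
  have -> : (fun x => n * (x - c)) = (fun x => n * x + (- (n * c))).
    by apply/funext => x; rewrite mulrBr.
  exact: smooth_affine.
have -> : (fun x => n * (d - x)) = (fun x => - n * x + n * d).
  by apply/funext => x; ring.
exact: smooth_affine.
Qed.

Lemma plateau_ge0 n c d x : 0 <= plateau n c d x.
Proof. by rewrite mulr_ge0// step_ge0. Qed.

Lemma plateau_le1 n c d x : plateau n c d x <= 1.
Proof. by rewrite mulr_ile1// ?step_ge0// step_le1. Qed.

Lemma plateau_out n c d x : 0 <= n -> ~ (c < x < d) -> plateau n c d x = 0.
Proof.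
move=> n0 /negP; rewrite negb_and -!leNgt => /orP[] h; rewrite /plateau.
  by rewrite step_le0 ?mul0r// mulr_ge0_le0// subr_le0.
by rewrite (@step_le0 (n * (d - x))) ?mulr0// mulr_ge0_le0// subr_le0.
Qed.

Lemma plateau_in (n c d x : R) : 1 <= n * (x - c) -> 1 <= n * (d - x) ->
  plateau n c d x = 1.
Proof. by move=> h1 h2; rewrite /plateau !step_ge1// mulr1. Qed.

Lemma plateau_cvg (c d x : R) : c < x < d -> plateau n%:R c d x @[n --> \oo] --> (1 : R).
Proof.
move=> /andP[cx xd].
have h (y : R) : 0 < y -> \forall n \near \oo, 1 <= n%:R * y.
  move=> y0; near=> n.
  rewrite -(ler_pdivrMr _ _ y0) mul1r; near: n; exact: nbhs_infty_ger.
apply: cvg_near_cst; apply: filterS2 (h (x - c) _) (h (d - x) _).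
- by move=> n; exact: plateau_in.
- by rewrite subr_gt0.
- by rewrite subr_gt0.
Unshelve. all: by end_near.
Qed.

(** ** Bounds by duality *)

(** Smooth plateaus converge to indicators of intervals, so the bound passes to
    the increments of a primitive of [f], which is almost everywhere
    differentiable with derivative [f]. *)
Lemma dual_bound (a b C : R) f : intb `]a, b[ f ->
  (forall phi c d, smooth phi -> a < c -> c < d -> d < b ->
     (forall x, ~ (c < x < d) -> phi x = 0) -> (forall x, 0 <= phi x <= 1) ->
     `|\int[mu]_(x in `]a, b[) (f x * phi x)| <=
       C * \int[mu]_(x in `]a, b[) phi x) ->
  \forall x \ae mu, a < x < b -> `|f x| <= C.
Proof.
move=> fi fphi.
pose D : set R := `]a, b[%classic.
have mD : measurable D by exact: measurable_itv.
have mf : measurable_fun D f := intb_meas fi.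
have subD (c d : R) : a < c -> d < b -> `]c, d[%classic `<=` D.
  move=> ac db x; rewrite /D /= !in_itv /= => /andP[cx xd].
  by rewrite (lt_trans ac cx) (lt_trans xd db).
have incr (c d : R) : a < c -> c < d -> d < b ->
    `|\int[mu]_(x in `]c, d[) f x| <= C * (d - c).
  move=> ac cd db.
  have mphi n : measurable_fun D (plateau n c d).
    by apply: smooth_meas => //; exact: smooth_plateau.
  have ptw x : plateau n%:R c d x @[n --> \oo] --> (\1_(`]c, d[%classic) x : R).
    rewrite indicE; have [|] := boolP (x \in _).
      by rewrite inE /= in_itv /=; exact: plateau_cvg.
    rewrite notin_setE /= in_itv /= => h.
    by apply: cvg_near_cst; apply: nearW => n; exact: plateau_out.
  have eqI g := Rint_indic g (subD c d ac db).
  have c1 : \int[mu]_(x in D) (f x * plateau n%:R c d x) @[n --> \oo] -->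
      \int[mu]_(x in `]c, d[) f x.
    rewrite -eqI; apply: (@Rint_dominated _ _ _ _ (fun x => `|f x|)) => //.
    - by move=> n; exact: measurable_funM.
    - by apply: measurable_funM => //; exact: measurable_indic.
    - by apply: aeW => x _; apply: cvgMr; exact: ptw.
    - exact: intb_norm.
    - apply: aeW => x n _; rewrite normrM ler_piMr// ger0_norm ?plateau_ge0//.
      exact: plateau_le1.
  have i1 : intb D (fun=> 1).
    by apply: intb_cst => //; exact: mu_oo_fin.
  have c2 : \int[mu]_(x in D) plateau n%:R c d x @[n --> \oo] --> d - c.
    rewrite -(mu_oo (ltW cd)) -[fine _]mul1r -Rintegral_cst// -eqI.
    apply: (@Rint_dominated _ _ _ _ (fun=> 1)) => //.
    - by apply: measurable_funM => //; exact: measurable_indic.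
    - by apply: aeW => x _; rewrite mul1r; exact: ptw.
    - apply: aeW => x n _; rewrite ger0_norm ?plateau_ge0//.
      exact: plateau_le1.
  have c3 : C * \int[mu]_(x in D) plateau n%:R c d x @[n --> \oo] --> C * (d - c).
    by apply: cvgMr; exact: c2.
  apply: ler_cvg_to (cvg_norm c1) c3 _.
  apply: nearW => n; apply: (fphi _ c d) => //; first exact: smooth_plateau.
  - by move=> x; exact: plateau_out.
  - by move=> x; rewrite plateau_ge0 plateau_le1.
pose g : R -> R := f \_ D.
have gi : intb setT g.
  exact: intb_patch.
pose F (x : R) : R := \int[mu]_(t in `]-oo, x]) g t.
have gF : {ae mu, forall x : R, derivable F x 1 /\ derive1 F x = g x}.
  apply: FTC1Ny; first by move=> y; exact: intbS gi.
  exact: open_integrable_locally openT gi.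
apply: (aeS _ gF) => x [Fd F'] /andP[ax xb].
have -> : f x = g x by rewrite /g patchE ifT// inE /D /= in_itv /= ax.
have lim : h^-1 * (F (h + x) - F x) @[h --> 0^'] --> g x.
  move: F'; rewrite derive1E /derive => <-.
  have := Fd; rewrite /derivable => /cvg_ex[l Hl].
  rewrite (cvg_lim _ Hl)//.
  by under eq_cvg do rewrite -[X in F (X + x)]mulr1; exact: Hl.
apply: ler_cvg_to (cvg_norm lim) (cvg_cst C) _.
near=> h.
have hn0 : h != 0 by near: h; exact: nbhs_dnbhs_neq.
have xh : a < h + x < b.
  have : `|h| < x - a by near: h; apply: dnbhs0_lt; rewrite subr_gt0.
  have : `|h| < b - x by near: h; apply: dnbhs0_lt; rewrite subr_gt0.
  by rewrite !ltr_norml => /andP[_ h1] /andP[h2 _]; apply/andP; split; lra.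
rewrite normrM normfV ler_pdivrMl ?normr_gt0// mulrC.
have FB (y z : R) : a < y -> y < z -> z < b -> `|F z - F y| <= C * (z - y).
  move=> ay yz zb.
  have -> : F z - F y = \int[mu]_(t in `]y, z]) g t.
    by apply: Rintegral_itvB; [exact: intbS gi | | rewrite bnd_simp ltW].
  rewrite -Rintegral_itv_bndo_bndc; last exact: intbS gi.
  suff -> : \int[mu]_(t in `]y, z[) g t = \int[mu]_(t in `]y, z[) f t.
    exact: incr.
  apply: Rint_ext => t ht; rewrite /g patchE mem_set//.
  exact: (subD y z).
have [h0|h0|] := ltgtP 0 h; last by move=> e; rewrite -e eqxx in hn0.
- rewrite (gtr0_norm h0) (le_trans (FB _ _ _ _ _))//; first by rewrite ltrDr.
    by case/andP: xh.
  by rewrite addrK.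
- rewrite (ltr0_norm h0) distrC (le_trans (FB _ _ _ _ _))//.
  + by case/andP: xh.
  + by rewrite gtrDr.
  + by rewrite opprD addrCA subrr addr0.
Unshelve. all: by end_near.
Qed.

End Cutoffs.

Section Clip.
Context {R : realType}.
Implicit Types (m x y : R).

(** Truncation at level [m], in a form whose continuity is plain. *)
Definition clip (m x : R) : R := (`|x + m| - `|x - m|) / 2.

Lemma clip_id m x : `|x| <= m -> clip m x = x.
Proof.
rewrite /clip ler_norml => /andP[h1 h2].
by rewrite ger0_norm ?ler0_norm; lra.
Qed.

Lemma clip_le m x : 0 <= m -> `|clip m x| <= m.
Proof.
move=> m0; rewrite /clip ler_norml; apply/andP.
by case: (ger0P (x + m)) => ?; case: (ger0P (x - m)) => ?; split; lra.
Qed.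

Lemma clip_lip m x y : 0 <= m -> `|clip m x - clip m y| <= `|x - y|.
Proof.
move=> m0; rewrite /clip ler_norml; apply/andP.
by case: (ger0P (x + m)) => ?; case: (ger0P (x - m)) => ?;
  case: (ger0P (y + m)) => ?; case: (ger0P (y - m)) => ?;
  case: (ger0P (x - y)) => ?; split; lra.
Qed.

Lemma clip_sq_le m x : 0 <= m -> clip m x ^+ 2 <= x * clip m x.
Proof.
move=> m0; rewrite /clip.
by case: (ger0P (x + m)) => ?; case: (ger0P (x - m)) => ?; nra.
Qed.

Lemma clip_cont m : continuous (clip m).
Proof.
move=> x; rewrite /clip; apply: cvgM; last exact: cvg_cst.
by apply: cvgB; apply: cvg_norm; [apply: cvgD | apply: cvgB] => //;
  exact: cvg_cst.
Qed.

Lemma clip_meas m f (D : set R) : measurable_fun D f ->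
  measurable_fun D (fun x : R => clip m (f x)).
Proof.
by move=> mf; apply: measurableT_comp mf; apply: continuous_measurable_fun;
  exact: clip_cont.
Qed.

End Clip.

(** * Fourier series on an interval *)

Section Fourier.
Context {R : realType}.
Local Notation mu := (@lebesgue_measure R).
Variables A B : R.
Hypothesis AB : A < B.
Implicit Types (f g h : R -> R) (k j n : nat).

Let D : set R := `]A, B[%classic.
Let mD : measurable D. Proof. exact: measurable_itv. Qed.
Let finD : (mu D < +oo)%E. Proof. exact: mu_oo_fin. Qed.

Let P : R := B - A.
Let P_gt0 : 0 < P. Proof. by rewrite subr_gt0. Qed.
Definition freq : R := 2 * pi / (B - A).
Local Notation w := freq.

Let w_gt0 : 0 < w.
Proof. by rewrite /freq divr_gt0 ?mulr_gt0 ?pi_gt0. Qed.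

Definition cs k (x : R) : R := cos (k%:R * w * x).
Definition sn k (x : R) : R := sin (k%:R * w * x).

Lemma smooth_cs k : smooth (cs k).
Proof.
apply: (smooth_comp smooth_cos).
by apply: smoothM; [exact: smooth_cst | exact: smooth_id].
Qed.

Lemma smooth_sn k : smooth (sn k).
Proof.
apply: (smooth_comp smooth_sin).
by apply: smoothM; [exact: smooth_cst | exact: smooth_id].
Qed.

Lemma cs_isd k (x : R) : is_derive x (1 : R) (cs k) (- (k%:R * w) * sn k x).
Proof.
apply: isd_eq (isd_comp (is_derive_cos _) (isdZ _ (is_derive_id _ _))) _.
by rewrite /sn; ring.
Qed.

Lemma sn_isd k (x : R) : is_derive x (1 : R) (sn k) (k%:R * w * cs k x).
Proof.
apply: isd_eq (isd_comp (is_derive_sin _) (isdZ _ (is_derive_id _ _))) _.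
by rewrite /cs; ring.
Qed.

Let cs_cont k : continuous (cs k).
Proof. by apply: smooth_cont; exact: smooth_cs. Qed.
Let sn_cont k : continuous (sn k).
Proof. by apply: smooth_cont; exact: smooth_sn. Qed.
Let cs_meas k : measurable_fun D (cs k).
Proof. exact: cont_meas. Qed.
Let sn_meas k : measurable_fun D (sn k).
Proof. exact: cont_meas. Qed.
Lemma cs_le1 k x : `|cs k x| <= 1. Proof. exact: cos_max. Qed.
Lemma sn_le1 k x : `|sn k x| <= 1. Proof. exact: sin_max. Qed.

Lemma cs0 x : cs 0 x = 1. Proof. by rewrite /cs !mul0r cos0. Qed.
Lemma sn0 x : sn 0 x = 0. Proof. by rewrite /sn !mul0r sin0. Qed.

Let endpoint k : k%:R * w * B = k%:R * w * A + (pi *+ 2) *+ k.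
Proof.
have P0 : B - A != 0 by rewrite gt_eqF.
by rewrite /freq -[_ *+ k]mulr_natl -mulr_natl; field.
Qed.

Let cs_AB k : cs k B = cs k A.
Proof. by rewrite /cs endpoint (periodicn (@cosD2pi R)). Qed.
Let sn_AB k : sn k B = sn k A.
Proof. by rewrite /sn endpoint (periodicn (@sinD2pi R)). Qed.

Lemma int_cs k : (0 < k)%N -> \int[mu]_(x in D) cs k x = 0.
Proof.
move=> k0; have kw : k%:R * w != 0 by rewrite mulf_neq0 ?gt_eqF ?ltr0n.
have Fd x : is_derive x (1 : R) (fun x => (k%:R * w)^-1 * sn k x) (cs k x).
  by apply: isd_eq (isdZ _ (sn_isd k x)) _; rewrite mulrA mulVf ?mul1r.
by rewrite (Rint_FTC AB Fd (@cs_cont k)) sn_AB subrr.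
Qed.

Lemma int_sn k : \int[mu]_(x in D) sn k x = 0.
Proof.
have [->|k0] := posnP k.
  by under eq_Rintegral do rewrite sn0; rewrite Rint0.
have kw : k%:R * w != 0 by rewrite mulf_neq0 ?gt_eqF ?ltr0n.
have Fd x : is_derive x (1 : R) (fun x => - (k%:R * w)^-1 * cs k x) (sn k x).
  by apply: isd_eq (isdZ _ (cs_isd k x)) _; rewrite mulrA mulrNN mulVf ?mul1r.
by rewrite (Rint_FTC AB Fd (@sn_cont k)) cs_AB subrr.
Qed.

Let int1 : \int[mu]_(x in D) (1 : R) = P.
Proof. by rewrite Rintegral_cst// mul1r mu_oo// ltW. Qed.

Let ci f : continuous f -> intb D f. Proof. exact: cont_intb_oo. Qed.

Lemma csD j k x : cs (j + k) x = cs j x * cs k x - sn j x * sn k x.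
Proof. by rewrite /cs natrD !mulrDl cosD. Qed.
Let snD j k x : sn (j + k) x = sn j x * cs k x + cs j x * sn k x.
Proof. by rewrite /sn natrD !mulrDl sinD. Qed.

Let cs_sq k x : cs k x ^+ 2 + sn k x ^+ 2 = 1. Proof. exact: cos2Dsin2. Qed.

Let half_int c1 c2 f g : continuous f -> continuous g ->
  \int[mu]_(x in D) (c1 * f x + c2 * g x) =
  c1 * \int[mu]_(x in D) f x + c2 * \int[mu]_(x in D) g x.
Proof.
move=> /ci fi /ci gi; rewrite RintD//; [|exact: intbZ..].
by rewrite !RintZ.
Qed.

(** The product of two modes is a combination of the modes at the difference and
    at the sum of their frequencies: hence orthogonality. *)
Let prodE j k x :
  [/\ cs j x * cs (j + k) x = 2^-1 * cs k x + 2^-1 * cs (j + (j + k)) x,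
      sn j x * sn (j + k) x = 2^-1 * cs k x + - 2^-1 * cs (j + (j + k)) x,
      sn j x * cs (j + k) x = 2^-1 * sn (j + (j + k)) x + - 2^-1 * sn k x &
      cs j x * sn (j + k) x = 2^-1 * sn (j + (j + k)) x + 2^-1 * sn k x].
Proof.
rewrite !(csD, snD); have := cs_sq j x.
set a := cs j x; set b := sn j x; set c := cs k x; set d := sn k x => e.
have e0 : a ^+ 2 + b ^+ 2 - 1 = 0 by rewrite e subrr.
split; apply/eqP; rewrite -subr_eq0; apply/eqP.
- by transitivity (2^-1 * c * (a ^+ 2 + b ^+ 2 - 1)); [field | rewrite e0 mulr0].
- by transitivity (2^-1 * c * (a ^+ 2 + b ^+ 2 - 1)); [field | rewrite e0 mulr0].
- by transitivity (- 2^-1 * d * (a ^+ 2 + b ^+ 2 - 1)); [field | rewrite e0 mulr0].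
- by transitivity (2^-1 * d * (a ^+ 2 + b ^+ 2 - 1)); [field | rewrite e0 mulr0].
Qed.

Lemma int_cs_orth j k : (0 < k)%N -> \int[mu]_(x in D) (cs j x * cs (j + k) x) = 0.
Proof.
move=> k0; rewrite (Rint_ext (g := fun x => 2^-1 * cs k x + 2^-1 * cs (j + (j + k)) x)).
  by rewrite half_int// !int_cs ?addn_gt0 ?k0 ?orbT// !mulr0 addr0.
by move=> x _; have [] := prodE j k x.
Qed.

Let orthS j k : (0 < k)%N -> \int[mu]_(x in D) (sn j x * sn (j + k) x) = 0.
Proof.
move=> k0; rewrite (Rint_ext (g := fun x => 2^-1 * cs k x + - 2^-1 * cs (j + (j + k)) x)).
  by rewrite half_int// !int_cs ?addn_gt0 ?k0 ?orbT// !mulr0 addr0.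
by move=> x _; have [] := prodE j k x.
Qed.

Let orthSC j k : \int[mu]_(x in D) (sn j x * cs (j + k) x) = 0.
Proof.
rewrite (Rint_ext (g := fun x => 2^-1 * sn (j + (j + k)) x + - 2^-1 * sn k x)).
  by rewrite half_int// !int_sn !mulr0 addr0.
by move=> x _; have [] := prodE j k x.
Qed.

Let orthCS j k : \int[mu]_(x in D) (cs j x * sn (j + k) x) = 0.
Proof.
rewrite (Rint_ext (g := fun x => 2^-1 * sn (j + (j + k)) x + 2^-1 * sn k x)).
  by rewrite half_int// !int_sn !mulr0 addr0.
by move=> x _; have [] := prodE j k x.
Qed.

(** The inverse of the squared norm of the cosine, and for [k > 0] also of the
    sine, of frequency [k]. *)
Definition wt k : R := (if k == 0%N then 1 else 2) / (B - A).

Lemma wt_gt0 k : 0 < wt k.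
Proof. by rewrite /wt; case: ifP => _; rewrite divr_gt0. Qed.

Lemma int_cs_sq k : \int[mu]_(x in D) (cs k x * cs k x) = (wt k)^-1.
Proof.
have P0 : B - A != 0 by rewrite gt_eqF.
have [->|k0] := posnP k.
  by under eq_Rintegral do rewrite !cs0 mulr1; rewrite int1 /wt /= /P div1r invrK.
rewrite (Rint_ext (g := fun x => 2^-1 * cs 0 x + 2^-1 * cs (k + (k + 0)) x)).
  rewrite half_int// (@int_cs (k + _)) ?addn_gt0 ?k0//.
  under eq_Rintegral do rewrite cs0.
  by rewrite int1 /wt gtn_eqF// /P; field.
by move=> x _; have [] := prodE k 0 x; rewrite addn0.
Qed.

Let normS k : wt k * \int[mu]_(x in D) (sn k x * sn k x) <= 1.
Proof.
have P0 : B - A != 0 by rewrite gt_eqF.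
have [->|k0] := posnP k.
  by under eq_Rintegral do rewrite !sn0 mulr0; rewrite Rint0 mulr0.
rewrite (Rint_ext (g := fun x => 2^-1 * cs 0 x + - 2^-1 * cs (k + (k + 0)) x)).
  rewrite half_int// (@int_cs (k + _)) ?addn_gt0 ?k0//.
  under eq_Rintegral do rewrite cs0.
  rewrite int1 /wt gtn_eqF// /P le_eqVlt; apply/orP; left; apply/eqP.
  by field.
by move=> x _; have [] := prodE k 0 x; rewrite addn0.
Qed.

Definition fc f k : R := \int[mu]_(x in D) (f x * cs k x).
Definition fs f k : R := \int[mu]_(x in D) (f x * sn k x).
Definition energy f n : R := \sum_(k < n) wt k * (fc f k ^+ 2 + fs f k ^+ 2).

Let mode f k x : R := wt k * fc f k * cs k x + wt k * fs f k * sn k x.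
Let psum f n x : R := \sum_(k < n) mode f k x.

Let cont_lin (a b : R) g h : continuous g -> continuous h ->
  continuous (fun x => a * g x + b * h x).
Proof.
by move=> gc hc x; apply: cvgD; apply: cvgMr; [exact: gc | exact: hc].
Qed.

Let mode_cont f k : continuous (mode f k). Proof. exact: cont_lin. Qed.

Let psum_cont f n : continuous (psum f n).
Proof. by apply: cont_sum => k; exact: mode_cont. Qed.

Let contM g h : continuous g -> continuous h -> continuous (fun x => g x * h x).
Proof. by move=> gc hc x; apply: cvgM; [exact: gc | exact: hc]. Qed.

Let cont_sq g : continuous g -> sq D g.
Proof. by move=> gc; split; [exact: cont_meas | apply: ci; exact: contM]. Qed.

Let mode_orth f j n : (j < n)%N -> \int[mu]_(x in D) (mode f j x * mode f n x) = 0.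
Proof.
move=> jn; have -> : n = (j + (n - j))%N by rewrite subnKC // ltnW.
set k := (n - j)%N; have k0 : (0 < k)%N by rewrite subn_gt0.
rewrite /mode; set a := wt j * _; set b := wt j * _; set c := wt _ * _; set d := wt _ * _.
rewrite (Rint_ext (g := fun x =>
  1 * ((a * c) * (cs j x * cs (j + k) x) + (b * d) * (sn j x * sn (j + k) x)) +
  1 * ((a * d) * (cs j x * sn (j + k) x) + (b * c) * (sn j x * cs (j + k) x)))).
  rewrite half_int; [|by apply: cont_lin; exact: contM..].
  rewrite !half_int; [|exact: contM..].
  by rewrite int_cs_orth// orthS// orthCS orthSC !(mulr0, addr0).
by move=> x _; ring.
Qed.

Let psum_orth f n : \int[mu]_(x in D) (psum f n x * mode f n x) = 0.
Proof.
rewrite (Rint_ext (g := fun x => \sum_(k < n) (if (k < n)%N then mode f k x * mode f n x else 0))).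
  rewrite (@Rint_sum _ _ _ (fun k x => if (k < n)%N then mode f k x * mode f n x else 0))//.
    rewrite big1// => k _; under eq_Rintegral do rewrite ltn_ord.
    exact: mode_orth.
  move=> k; case: ltnP => _; last exact: integrable0.
  by apply: ci; exact: contM.
by move=> x _; rewrite /psum mulr_suml; apply: eq_bigr => k _; rewrite ltn_ord.
Qed.

Let mode_norm f n : \int[mu]_(x in D) (mode f n x ^+ 2) <=
  wt n * (fc f n ^+ 2 + fs f n ^+ 2).
Proof.
rewrite /mode; set a := fc f n; set b := fs f n.
rewrite (Rint_ext (g := fun x => 1 * ((wt n * a) ^+ 2 * (cs n x * cs n x)
    + (wt n * b) ^+ 2 * (sn n x * sn n x))
    + (2 * (wt n * a) * (wt n * b)) * (sn n x * cs (n + 0) x))); last first.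
  by move=> x _; rewrite addn0; ring.
rewrite half_int; [|by apply: cont_lin; exact: contM|exact: contM].
rewrite half_int; [|exact: contM..].
rewrite orthSC mulr0 addr0 mul1r int_cs_sq.
have := normS n; have := wt_gt0 n; set v := wt n; set I := \int[mu]_(x in D) _.
move=> v0 vI; have -> : (v * a) ^+ 2 / v = v * a ^+ 2 by field; rewrite gt_eqF.
rewrite mulrDr lerD2l.
have -> : (v * b) ^+ 2 * I = v * b ^+ 2 * (v * I) by ring.
by rewrite ler_piMr// mulr_ge0 ?sqr_ge0// ltW.
Qed.

Lemma energyS f n : energy f n.+1 = energy f n +
  wt n * (fc f n ^+ 2 + fs f n ^+ 2).
Proof. by rewrite /energy big_ord_recr. Qed.

Lemma bessel f n : sq D f -> energy f n <= \int[mu]_(x in D) (f x ^+ 2).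
Proof.
move=> sf; have fi : intb D f by exact: sq_intb.
have icos k : intb D (fun x => f x * cs k x).
  by apply: (@intbMb _ _ _ _ 1) => // x _; exact: cs_le1.
have isin k : intb D (fun x => f x * sn k x).
  by apply: (@intbMb _ _ _ _ 1) => // x _; exact: sn_le1.
have fm k : \int[mu]_(x in D) (f x * mode f k x) =
    wt k * (fc f k ^+ 2 + fs f k ^+ 2).
  rewrite (Rint_ext (g := fun x => wt k * fc f k * (f x * cs k x) +
      wt k * fs f k * (f x * sn k x))); last by move=> x _; rewrite /mode; ring.
  rewrite RintD//; [|exact: intbZ..].
  by rewrite !RintZ// -/(fc f k) -/(fs f k); ring.
have sm k : sq D (mode f k) by exact/cont_sq/mode_cont.
have sp k : sq D (psum f k) by exact/cont_sq/psum_cont.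
suff [h1 h2] : \int[mu]_(x in D) (f x * psum f n x) = energy f n /\
    \int[mu]_(x in D) (psum f n x ^+ 2) <= energy f n.
  have := Rint_sq_ge0 D (fun x => f x + -1 * psum f n x).
  rewrite Rint_sqD//; last exact: sqZ.
  have -> : \int[mu]_(x in D) (f x * (-1 * psum f n x)) =
      -1 * \int[mu]_(x in D) (f x * psum f n x).
    by rewrite -RintZ; [apply: Rint_ext => x _; ring | | exact: sqM_intb].
  have -> : \int[mu]_(x in D) ((-1 * psum f n x) ^+ 2) =
      \int[mu]_(x in D) (psum f n x ^+ 2).
    by apply: Rint_ext => x _; ring.
  rewrite h1.
  move: h2; set X := \int[mu]_(x in D) _; set Y := \int[mu]_(x in D) _.
  move: X Y (energy f n) => X Y e h2; lra.
elim: n => [|n [IH1 IH2]].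
  rewrite /energy big_ord0.
  by split; [|rewrite le_eqVlt; apply/orP; left; apply/eqP];
    rewrite -[RHS](Rint0 D); apply: Rint_ext => x _;
    rewrite /psum big_ord0 ?mulr0// expr0n.
have pS x : psum f n.+1 x = psum f n x + mode f n x.
  by rewrite /psum big_ord_recr.
split.
  rewrite (Rint_ext (g := fun x => f x * psum f n x + f x * mode f n x)); last first.
    by move=> x _; rewrite pS mulrDr.
  by rewrite RintD//; [rewrite IH1 fm energyS | exact: sqM_intb..].
rewrite (Rint_ext (g := fun x => (psum f n x + mode f n x) ^+ 2)); last first.
  by move=> x _; rewrite pS.
rewrite Rint_sqD// psum_orth mulr0 addr0 energyS.
by apply: lerD => //; exact: mode_norm.
Qed.

End Fourier.

(** ** Completeness of the trigonometric system *)

Section Parseval.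
Context {R : realType}.
Local Notation mu := (@lebesgue_measure R).
Variables A B : R.
Hypothesis AB : A < B.
Implicit Types (f g h : R -> R) (k j n : nat).

Let D : set R := `]A, B[%classic.
Let mD : measurable D. Proof. exact: measurable_itv. Qed.
Let finD : (mu D < +oo)%E. Proof. exact: mu_oo_fin. Qed.

Local Notation w := (freq A B).
Local Notation cs := (cs A B).
Local Notation sn := (sn A B).
Local Notation fc := (fc A B).
Local Notation fs := (fs A B).
Local Notation wt := (wt A B).
Local Notation energy := (energy A B).

Let P_gt0 : 0 < B - A. Proof. by rewrite subr_gt0. Qed.
Let w_gt0 : 0 < w. Proof. by rewrite /freq divr_gt0 ?mulr_gt0 ?pi_gt0. Qed.
Let cs_cont k : continuous (cs k).
Proof. by apply: smooth_cont; exact: smooth_cs. Qed.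
Let sn_cont k : continuous (sn k).
Proof. by apply: smooth_cont; exact: smooth_sn. Qed.
Let cs_meas k : measurable_fun D (cs k). Proof. exact: cont_meas. Qed.
Let sn_meas k : measurable_fun D (sn k). Proof. exact: cont_meas. Qed.
Let ci f : continuous f -> intb D f. Proof. exact: cont_intb_oo. Qed.

(** The even trigonometric polynomials of degree at most [n]. *)
Definition cospoly n f : Prop :=
  exists c : nat -> R, forall z, f z = \sum_(k < n.+1) c k * cs k z.

Let cospolyD n f g : cospoly n f -> cospoly n g -> cospoly n (fun z => f z + g z).
Proof.
move=> [c fE] [d gE]; exists (fun k => c k + d k) => z.
by rewrite fE gE -big_split; apply: eq_bigr => k _; rewrite mulrDl.
Qed.

Let cospolyZ n a f : cospoly n f -> cospoly n (fun z => a * f z).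
Proof.
move=> [c fE]; exists (fun k => a * c k) => z.
by rewrite fE mulr_sumr; apply: eq_bigr => k _; rewrite mulrA.
Qed.

Let cospoly_cs n k : (k <= n)%N -> cospoly n (cs k).
Proof.
move=> kn; exists (fun j => if j == k then 1 else 0) => z.
have kn' : (k < n.+1)%N by [].
rewrite (bigD1 (Ordinal kn')) //= eqxx mul1r big1 ?addr0// => j jk.
rewrite ifF ?mul0r//; apply: contra_neqF jk => /eqP jk.
exact: val_inj.
Qed.

Let cospoly_ext n f g : f =1 g -> cospoly n f -> cospoly n g.
Proof. by move=> fg [c fE]; exists c => z; rewrite -fg. Qed.

Let cospoly_mul n f : cospoly n f -> cospoly n.+1 (fun z => cs 1 z * f z).
Proof.
move=> [c fE].
have step k : (k <= n)%N -> cospoly n.+1 (fun z => cs 1 z * cs k z).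
  case: k => [|k] kn.
    apply: (@cospoly_ext _ (cs 1)); last exact: cospoly_cs.
    by move=> z; rewrite cs0 mulr1.
  apply: (@cospoly_ext _ (fun z => 2^-1 * cs k.+2 z + 2^-1 * cs k z)).
    move=> z; rewrite -(addn2 k) -(addn1 k) !csD -[2%N]/(1 + 1)%N csD.
    rewrite /sn natrD !mulrDl sinD -/(sn 1 z) -/(cs 1 z).
    have := cos2Dsin2 (1 * w * z); rewrite -/(sn 1 z) -/(cs 1 z).
    set a := cs 1 z; set b := sn 1 z; set c1 := cs k z.
    set d := sin _ => e.
    have e0 : a ^+ 2 + b ^+ 2 - 1 = 0 by rewrite e subrr.
    apply/eqP; rewrite -subr_eq0; apply/eqP.
    by transitivity (- 2^-1 * c1 * (a ^+ 2 + b ^+ 2 - 1)); [field | rewrite e0 mulr0].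
  by apply: cospolyD; apply: cospolyZ; apply: cospoly_cs => //; rewrite ltnW ?ltnS ?(ltnW kn).
have sumP (m : nat) : (m <= n.+1)%N -> cospoly n.+1 (fun z => \sum_(k < m) c k * (cs 1 z * cs k z)).
  elim: m => [|m IH] mn.
    exists (fun=> 0) => z; rewrite big_ord0 big1// => k _; by rewrite mul0r.
  apply: (@cospoly_ext _ (fun z => (\sum_(k < m) c k * (cs 1 z * cs k z)) + c m * (cs 1 z * cs m z))).
    by move=> z; rewrite big_ord_recr.
  by apply: cospolyD; [exact/IH/ltnW | apply: cospolyZ; exact: step].
apply: cospoly_ext (sumP n.+1 (leqnn _)) => z /=.
by rewrite fE mulr_sumr; apply: eq_bigr => k _; ring.
Qed.

(** An approximate identity by trigonometric polynomials: the powers of the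
    cosine bump (1 + cos)/2, to be divided by their integral. *)
Definition kern n (z : R) : R := ((1 + cs 1 z) / 2) ^+ n.

Let base_ge0 z : 0 <= (1 + cs 1 z) / 2.
Proof.
rewrite divr_ge0// -lerBlDl sub0r.
by have := cs_le1 A B 1 z; rewrite ler_norml => /andP[].
Qed.

Let base_le1 z : (1 + cs 1 z) / 2 <= 1.
Proof. by have := cs_le1 A B 1 z; rewrite ler_norml => /andP[_ ?]; lra. Qed.

Let kern_ge0 n z : 0 <= kern n z. Proof. exact: exprn_ge0. Qed.
Let kern_le1 n z : kern n z <= 1. Proof. exact: exprn_ile1. Qed.

Let kern_cospoly n : cospoly n (kern n).
Proof.
elim: n => [|n IH].
  by exists (fun=> 1) => z; rewrite big_ord1 cs0 mulr1.
have H : cospoly n.+1 (kern n).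
  have [c cE] := IH; exists (fun k => if (k < n.+1)%N then c k else 0) => z.
  rewrite big_ord_recr /= ltnn mul0r addr0 cE.
  by apply: eq_bigr => k _; rewrite ltn_ord.
apply: (@cospoly_ext _ (fun z => 2^-1 * kern n z + 2^-1 * (cs 1 z * kern n z))).
  by move=> z; rewrite /kern exprS; field.
by apply: cospolyD; apply: cospolyZ => //; exact: cospoly_mul.
Qed.

Let kern_cont n : continuous (kern n).
Proof.
have s : smooth (fun z : R => (1 + cs 1 z) / 2).
  apply: smoothM; last exact: smooth_cst.
  by apply: smoothD; [exact: smooth_cst | exact: smooth_cs].
apply: smooth_cont; elim: n => [|n IH].
  have -> : kern 0 = fun=> 1 by apply/funext => z; rewrite /kern expr0.
  exact: smooth_cst.
have -> : kern n.+1 = fun z => (1 + cs 1 z) / 2 * kern n z.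
  by apply/funext => z; rewrite /kern exprS.
exact: smoothM.
Qed.

Let csB k (x s : R) : cs k (x - s) = cs k x * cs k s + sn k x * sn k s.
Proof. by rewrite /cs /sn mulrBr cosB. Qed.

Let cs_at0 k : cs k 0 = 1. Proof. by rewrite /cs mulr0 cos0. Qed.
Let sn_at0 k : sn k 0 = 0. Proof. by rewrite /sn mulr0 sin0. Qed.

Let csf_intb f k : intb D f -> intb D (fun s => f s * cs k s).
Proof.
by move=> fi; apply: (@intbMb _ _ _ _ 1) => // x _; exact: cs_le1.
Qed.

Let snf_intb f k : intb D f -> intb D (fun s => f s * sn k s).
Proof.
by move=> fi; apply: (@intbMb _ _ _ _ 1) => // x _; exact: sn_le1.
Qed.

Let shift_cont g (x : R) : continuous g -> continuous (fun s => g (x - s)).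
Proof.
move=> gc s; apply: (@continuous_comp _ _ _ (fun s => x - s) g); last exact: gc.
by apply: cvgB => //; exact: cvg_cst.
Qed.

Let kernf_intb n f (x : R) : intb D f -> intb D (fun s => f s * kern n (x - s)).
Proof.
move=> fi; apply: (@intbMb _ _ _ _ 1) => //.
  by apply: cont_meas => //; exact/shift_cont/kern_cont.
by move=> s _; rewrite ger0_norm.
Qed.

Let conv n h (x : R) : R := \int[mu]_(s in D) (h s * kern n (x - s)).

Let convE n (c : nat -> R) h x : (forall z, kern n z = \sum_(k < n.+1) c k * cs k z) ->
  intb D h -> conv n h x =
  \sum_(k < n.+1) c k * (cs k x * fc h k + sn k x * fs h k).
Proof.
move=> cE hi.
have ik k : intb D (fun s => c k * (cs k x * (h s * cs k s) + sn k x * (h s * sn k s))).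
  by apply: intbZ => //; apply: intbD => //; apply: intbZ => //;
    [exact: csf_intb | exact: snf_intb].
transitivity (\sum_(k < n.+1) \int[mu]_(s in D)
    (c k * (cs k x * (h s * cs k s) + sn k x * (h s * sn k s)))).
  rewrite -(@Rint_sum _ D n.+1 (fun k s =>
    c k * (cs k x * (h s * cs k s) + sn k x * (h s * sn k s))))//.
  apply: Rint_ext => s _; rewrite cE mulr_sumr; apply: eq_bigr => k _.
  by rewrite csB; ring.
apply: eq_bigr => k _; rewrite RintZ//; last first.
  by apply: intbD => //; apply: intbZ => //; [exact: csf_intb | exact: snf_intb].
congr (_ * _); rewrite RintD//; [|by apply: intbZ => //; exact: csf_intb
  |by apply: intbZ => //; exact: snf_intb].
by rewrite !RintZ//; [exact: snf_intb | exact: csf_intb].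
Qed.

Let i1 : intb D (fun=> 1). Proof. exact: intb_cst. Qed.

Let fc1 k : fc (fun=> 1) k = if k == 0%N then B - A else 0.
Proof.
rewrite /fc; under eq_Rintegral do rewrite mul1r.
case: eqP => [->|/eqP]; last by rewrite -lt0n; exact: int_cs.
under eq_Rintegral do rewrite cs0.
by rewrite Rintegral_cst// mul1r mu_oo// ltW.
Qed.

Let fs1 k : fs (fun=> 1) k = 0.
Proof. by rewrite /fs; under eq_Rintegral do rewrite mul1r; exact: int_sn. Qed.

(** The mass of the kernel does not depend on the centre, being carried by the
    constant mode, and it dominates the coefficients of all the modes. *)
Let kern_mass n : exists c : nat -> R, exists2 I : R,
  [/\ forall z, kern n z = \sum_(k < n.+1) c k * cs k z,
      forall x, conv n (fun=> 1) x = I & 0 < I] &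
  forall k, (k < n.+1)%N -> `|c k| <= I * wt k.
Proof.
have [c cE] := kern_cospoly n.
pose I := c 0%N * (B - A).
have convI x : conv n (fun=> 1) x = I.
  rewrite (convE _ cE)// big_ord_recl /= fc1 eqxx fs1 cs0 mul1r mulr0 addr0.
  by rewrite big1 ?addr0// => k _; rewrite fc1 fs1 !(mulr0, addr0).
have Kint : \int[mu]_(x in D) kern n x = I.
  rewrite -(convI 0) /conv; apply: Rint_ext => s _.
  by rewrite mul1r sub0r /kern /cs mulrN cosN.
have I0 : 0 <= I by rewrite -Kint; apply: Rintegral_ge0.
have ck k : (k < n.+1)%N -> c k = wt k * \int[mu]_(x in D) (kern n x * cs k x).
  move=> kn.
  have e : conv n (cs k) 0 = \int[mu]_(x in D) (kern n x * cs k x).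
    by apply: Rint_ext => s _; rewrite mulrC sub0r /kern /(cs 1) mulrN cosN.
  rewrite -e (convE _ cE); last by apply: ci.
  have orth j : j != k -> fc (cs k) j = 0.
    move=> jk; rewrite /fc.
    have h a b : (a < b)%N -> \int[mu]_(x in D) (cs a x * cs b x) = 0.
      move=> ab; rewrite -(subnKC (ltnW ab)); apply: int_cs_orth => //.
      by rewrite subn_gt0.
    have [kj|jk'|kj] := ltngtP k j; first exact: h.
      by under eq_Rintegral do rewrite mulrC; exact: h.
    by rewrite kj eqxx in jk.
  rewrite (bigD1 (Ordinal kn)) //= big1 ?addr0.
    rewrite sn_at0 mul0r addr0 cs_at0 mul1r.
    rewrite /fc int_cs_sq// mulrCA mulfV ?mulr1// gt_eqF//; exact: wt_gt0.
  move=> j jk; rewrite orth; last by apply: contra_neq jk => jk; exact: val_inj.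
  by rewrite sn_at0 mul0r !(mulr0, addr0).
have ckI k : (k < n.+1)%N -> `|c k| <= I * wt k.
  move=> kn; rewrite ck// normrM (gtr0_norm (wt_gt0 AB k)) [leRHS]mulrC.
  apply: ler_wpM2l; first by rewrite ltW// wt_gt0.
  have ki : intb D (fun x => kern n x * cs k x).
    by apply: csf_intb; apply: ci; exact: kern_cont.
  rewrite (le_trans (Rint_norm_le mD ki))// -Kint; apply: Rint_le => //.
  - exact: intb_norm.
  - by apply: ci; exact: kern_cont.
  - move=> x _; rewrite normrM ger0_norm// ler_piMr//; exact: cs_le1.
exists c; exists I => //; split=> //.
rewrite lt_neqAle I0 andbT; apply/eqP => I00.
have c0 (k : 'I_n.+1) : c k = 0.
  by apply/eqP; have := ckI k (ltn_ord k); rewrite -I00 mul0r normr_le0.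
have := cE 0; rewrite big1; last by move=> k _; rewrite c0 mul0r.
rewrite /kern cs_at0 => /eqP.
by rewrite expf_eq0 => /andP[_]; rewrite (_ : (1 + 1) / 2 = 1) ?oner_eq0//; lra.
Qed.

Let mass n : R := conv n (fun=> 1) 0.

Let massE n x : conv n (fun=> 1) x = mass n.
Proof. by have [c [I [_ cI _] _]] := kern_mass n; rewrite /mass !cI. Qed.

Let mass_gt0 n : 0 < mass n.
Proof. by have [c [I [_ cI ?] _]] := kern_mass n; rewrite /mass cI. Qed.

Let cos_anti (x y : R) : 0 <= x -> x <= y -> y <= pi -> cos y <= cos x.
Proof.
move=> x0 xy ypi; rewrite leNgt; apply/negP.
have xi : x \in `[0, pi] by rewrite in_itv /= x0 (le_trans xy ypi).
have yi : y \in `[0, pi] by rewrite in_itv /= (le_trans x0 xy) ypi.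
by rewrite (ltr_cos yi xi) ltNge xy.
Qed.

Let wP : w * (B - A) = 2 * pi.
Proof. by rewrite /freq divfK// gt_eqF. Qed.

Let cs_near (d z : R) : w * d <= pi -> `|z| <= d -> cos (w * d) <= cs 1 z.
Proof.
move=> dpi zd; rewrite /cs mul1r.
have -> : cos (w * z) = cos (w * `|z|).
  by have [z0|z0] := ger0P z; rewrite // mulrN cosN.
apply: cos_anti => //; first by rewrite mulr_ge0// ltW.
by rewrite ler_pM2l.
Qed.

Let cs_far (d z : R) : 0 <= d -> d <= `|z| -> `|z| <= (B - A) - d ->
  cs 1 z <= cos (w * d).
Proof.
move=> d0 dz zd; rewrite /cs mul1r.
have -> : cos (w * z) = cos (w * `|z|).
  by have [z0|z0] := ger0P z; rewrite // mulrN cosN.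
have wd : w * d <= w * `|z| by rewrite ler_pM2l.
have zw : w * `|z| <= 2 * pi - w * d by rewrite -wP -mulrBr ler_pM2l.
have wd0 : 0 <= w * d by rewrite mulr_ge0// ltW.
have [h|h] := leP (w * `|z|) pi; first exact: cos_anti.
have -> : cos (w * `|z|) = cos (2 * pi - w * `|z|).
  by rewrite -[LHS]cosN -(@cosD2pi R (- _)) addrC; congr (cos (_ - _)); ring.
apply: cos_anti => //; first by rewrite lerBrDl -lerBrDr.
by rewrite lerBlDl -lerBlDr; have := ltW h; lra.
Qed.

(** Around [x], the kernel is at least [c1 ^+ n] within [d / 2] and at most
    [c2 ^+ n] beyond [d], and [c2 < c1]: in the limit only the values of [h]
    close to [x] count. *)
Let conv_cvg h x : continuous h -> A < x < B ->
  conv n h x / mass n @[n --> \oo] --> h x.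
Proof.
move=> hc /andP[Ax xB].
have [M M0 hM] := cont_bounded A B hc.
have xAB : A <= x <= B by rewrite !ltW.
apply/cvgrPdist_le => e e0.
pose e2 := e / 2; have e20 : 0 < e2 by rewrite divr_gt0.
have /cvgrPdist_lt /(_ _ e20) [d0 /= d00 hd0] := hc x.
pose d := Num.min d0 (Num.min (x - A) (B - x)).
have d_gt0 : 0 < d by rewrite !lt_min d00 !subr_gt0 Ax.
have dA : d <= x - A by rewrite !ge_min lexx orbT.
have dB : d <= B - x by rewrite !ge_min lexx !orbT.
have hd s : `|x - s| < d -> `|h s - h x| <= e2.
  move=> xs; rewrite distrC ltW//; apply: hd0 => /=.
  by rewrite (lt_le_trans xs)// ge_min lexx.
have wdpi : w * d <= pi.
  have : 2 * (w * d) <= 2 * pi.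
    by rewrite -wP mulrCA ler_pM2l//; lra.
  by rewrite ler_pM2l.
pose c1 := (1 + cos (w * (d / 2))) / 2; pose c2 := (1 + cos (w * d)) / 2.
have wd2 : w * (d / 2) < w * d by rewrite ltr_pM2l//; lra.
have wd20 : 0 < w * (d / 2) by rewrite mulr_gt0// divr_gt0.
have c21 : c2 < c1.
  have i1' : w * d \in `[0, pi].
    by rewrite in_itv /= wdpi andbT (le_trans (ltW wd20) (ltW wd2)).
  have i2 : w * (d / 2) \in `[0, pi].
    by rewrite in_itv /= (ltW wd20) (le_trans (ltW wd2) wdpi).
  by rewrite ltr_pM2r ?invr_gt0// ltrD2l (ltr_cos i2 i1').
have c20 : 0 <= c2.
  by rewrite divr_ge0// -lerBlDl sub0r; have := cos_max (w * d); rewrite ler_norml => /andP[].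
have c10 : 0 < c1 by exact: le_lt_trans c20 c21.
have massL n : d * c1 ^+ n <= mass n.
  rewrite -(massE n x).
  have sub : `]x - d / 2, x + d / 2[%classic `<=` D.
    by move=> s; rewrite /D /= !in_itv /= => /andP[? ?]; apply/andP; split; lra.
  have -> : d * c1 ^+ n = \int[mu]_(s in D) (c1 ^+ n * \1_(`]x - d / 2, x + d / 2[%classic) s).
    rewrite (Rint_indic _ sub) Rintegral_cst// mu_oo; last by lra.
    by rewrite mulrC; congr (_ * _); lra.
  apply: Rint_le => //.
  - apply: (@intb_bounded _ _ _ (c1 ^+ n)) => //.
      by apply: measurable_funM => //; exact: measurable_indic.
    move=> s _; rewrite normrM ger0_norm ?exprn_ge0 ?(ltW c10)//.
    by rewrite ler_piMr ?exprn_ge0 ?(ltW c10)// indicE; case: (_ \in _); rewrite ?normr1 ?normr0.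
  - exact: kernf_intb.
  - move=> s _; rewrite indicE mul1r.
    have [|_] := boolP (s \in _); last by rewrite mulr0.
    rewrite inE /= in_itv /= => /andP[s1 s2]; rewrite mulr1 /kern.
    rewrite lerXn2r ?nnegrE ?(ltW c10)// ler_pM2r ?invr_gt0// lerD2l.
    apply: cs_near; first by rewrite (le_trans (ltW wd2)).
    by rewrite ler_norml; apply/andP; split; lra.
have est n : `|conv n h x - h x * mass n| <=
    e2 * mass n + 2 * M * c2 ^+ n * (B - A).
  have hi : intb D h by exact: ci.
  have ki := kernf_intb n x i1.
  have hki := kernf_intb n x hi.
  have -> : conv n h x - h x * mass n =
      \int[mu]_(s in D) ((h s - h x) * kern n (x - s)).
    rewrite -(massE n x) /conv -RintZ// -RintB//; last exact: intbZ.
    by apply: Rint_ext => s _; ring.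
  have -> : 2 * M * c2 ^+ n * (B - A) = \int[mu]_(s in D) (2 * M * c2 ^+ n).
    by rewrite Rintegral_cst// mu_oo// ltW.
  have di : intb D (fun s => (h s - h x) * kern n (x - s)).
    by apply: (kernf_intb n x (f := fun s => h s - h x)); apply: intbB => //; exact: intb_cst.
  rewrite (le_trans (Rint_norm_le mD di))// -(massE n x) /conv -RintZ//.
  rewrite -RintD//; [|exact: intbZ | exact: intb_cst].
  apply: Rint_le => //; first exact: intb_norm.
    by apply: intbD => //; [exact: intbZ | exact: intb_cst].
  move=> s; rewrite /D /= in_itv /= => /andP[As sB].
  rewrite normrM mul1r (ger0_norm (kern_ge0 n _)).
  have k0 := kern_ge0 n (x - s).
  have M2 : `|h s - h x| <= 2 * M.
    rewrite (le_trans (ler_normB _ _))// mulr_natl mulr2n lerD// hM//.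
    by rewrite !ltW.
  have [xs|xs] := ltP `|x - s| d.
    rewrite (le_trans (ler_wpM2r k0 (hd _ xs)))// lerDl.
    by rewrite !mulr_ge0// exprn_ge0.
  have kc : kern n (x - s) <= c2 ^+ n.
    rewrite /kern lerXn2r ?nnegrE// ler_pM2r ?invr_gt0// lerD2l.
    apply: cs_far; [exact: ltW | exact: xs |].
    by rewrite ler_norml; apply/andP; split; lra.
  rewrite (le_trans (ler_pM _ k0 M2 kc))// lerDr.
  by rewrite mulr_ge0// ltW.
have rat : (c2 / c1) ^+ n @[n --> \oo] --> (0 : R).
  apply: cvg_expr; rewrite ger0_norm ?divr_ge0 ?(ltW c10)//.
  by rewrite ltr_pdivrMr// mul1r.
have C0 : 0 < 2 * M * (B - A) + 1 by rewrite ltr_wpDl// !mulr_ge0// ltW.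
have /cvgr0_norm_le /(_ (e2 * d / (2 * M * (B - A) + 1))) H := rat.
have {}H := H (divr_gt0 (mulr_gt0 e20 d_gt0) C0).
near=> n.
have Hn : `|(c2 / c1) ^+ n| <= e2 * d / (2 * M * (B - A) + 1) by near: n; exact: H.
have m0 := mass_gt0 n.
have -> : h x - conv n h x / mass n = (h x * mass n - conv n h x) / mass n.
  by field; rewrite gt_eqF.
rewrite normrM normfV (gtr0_norm m0) ler_pdivrMr// distrC.
rewrite (le_trans (est n))//.
have -> : e * mass n = e2 * mass n + e2 * mass n by rewrite /e2; field.
rewrite lerD2l.
move: Hn; rewrite ger0_norm; last by rewrite exprn_ge0// divr_ge0// ltW.
rewrite expr_div_n ler_pdivrMr ?exprn_gt0// => Hn.
apply: (@le_trans _ _ (e2 * (d * c1 ^+ n))); last by rewrite ler_pM2l.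
have c2n : 0 <= c2 ^+ n by exact: exprn_ge0.
apply: (@le_trans _ _ ((2 * M * (B - A) + 1) * c2 ^+ n)).
  have -> : (2 * M * (B - A) + 1) * c2 ^+ n =
    2 * M * c2 ^+ n * (B - A) + c2 ^+ n by ring.
  by rewrite lerDl.
rewrite (le_trans (ler_wpM2l (ltW C0) Hn))// le_eqVlt; apply/orP; left.
by apply/eqP; field; rewrite gt_eqF.
Unshelve. all: by end_near.
Qed.

Let conv_le h M n x : intb D h -> (forall s, D s -> `|h s| <= M) ->
  `|conv n h x| <= M * mass n.
Proof.
move=> hi hM; have hk := kernf_intb n x hi; have ki := kernf_intb n x i1.
apply: (le_trans (Rint_norm_le mD hk)).
rewrite -(massE n x) -RintZ//; apply: Rint_le => //.
- exact: intb_norm.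
- exact: intbZ.
- move=> s Ds; rewrite mul1r normrM (ger0_norm (kern_ge0 n _)).
  by rewrite ler_wpM2r// hM.
Qed.

(** The pairing of [f] with the convolution of [h] by the kernel is a sum of
    products of coefficients, with multipliers at most [wt k]. Splitting each
    product by 2 c d <= c^2 + d^2 leaves an inhomogeneous bound, which becomes
    homogeneous when [h] is a truncation of [f]. *)
Let pairing_cont f h M : intb D f -> (forall n, energy f n <= M) ->
  continuous h ->
  \int[mu]_(x in D) (f x * h x) <=
  2^-1 * (M + \int[mu]_(x in D) (h x ^+ 2)).
Proof.
move=> fi fM hc; have hi : intb D h by exact: ci.
have sh : sq D h.
  split; first exact: cont_meas.
  by apply: ci => x; apply: cvgM; exact: hc.
have [Mh Mh0 hM] := cont_bounded A B hc.
have hMD s : D s -> `|h s| <= Mh.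
  by rewrite /D /= in_itv /= => /andP[? ?]; apply: hM; rewrite !ltW.
have cconv n : continuous (conv n h).
  have [c [I [cE _ _] _]] := kern_mass n.
  have -> : conv n h = fun x => \sum_(k < n.+1) c k * (cs k x * fc h k + sn k x * fs h k).
    by apply/funext => x; exact: convE.
  apply: (cont_sum (F := fun k x => c k * (cs k x * fc h k + sn k x * fs h k))).
  move=> k x; apply: cvgMr; apply: cvgD; apply: cvgMl; [exact: cs_cont | exact: sn_cont].
have qle n x : `|conv n h x / mass n| <= Mh.
  rewrite normrM normfV (gtr0_norm (mass_gt0 n)) ler_pdivrMr ?mass_gt0//.
  exact: conv_le.
have qm n : measurable_fun D (fun x => conv n h x / mass n).
  by apply: measurable_funM => //; exact: cont_meas.
have lim : \int[mu]_(x in D) (f x * (conv n h x / mass n)) @[n --> \oo] -->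
    \int[mu]_(x in D) (f x * h x).
  apply: (@Rint_dominated _ _ _ _ (fun x => Mh * `|f x|)) => //.
  - by move=> n; apply: measurable_funM => //; exact: intb_meas.
  - by apply: measurable_funM; [exact: intb_meas | exact: cont_meas].
  - apply: aeW => x; rewrite /D /= in_itv /= => xAB.
    by apply: cvgMr; exact: conv_cvg.
  - by apply: intbZ => //; exact: intb_norm.
  - by apply: aeW => x n _; rewrite normrM mulrC ler_wpM2r.
apply: ler_cvg_to lim (cvg_cst _) _; apply: nearW => n.
have [c [I [cE cI I0] cw]] := kern_mass n.
have mI : mass n = I by rewrite /mass cI.
have -> : \int[mu]_(x in D) (f x * (conv n h x / mass n)) =
    \sum_(k < n.+1) (c k / I) * (fc f k * fc h k + fs f k * fs h k).
  transitivity (\sum_(k < n.+1) \int[mu]_(x in D)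
      ((c k / I) * (fc h k * (f x * cs k x) + fs h k * (f x * sn k x)))).
    rewrite -(@Rint_sum _ D n.+1 (fun k x =>
      (c k / I) * (fc h k * (f x * cs k x) + fs h k * (f x * sn k x))))//; last first.
      by move=> k; apply: intbZ => //; apply: intbD => //; apply: intbZ => //;
        [exact: csf_intb | exact: snf_intb].
    apply: Rint_ext => x _; rewrite mI (convE _ cE)// mulr_suml mulr_sumr.
    by apply: eq_bigr => k _; ring.
  apply: eq_bigr => k _; rewrite RintZ//; last first.
    by apply: intbD => //; apply: intbZ => //; [exact: csf_intb | exact: snf_intb].
  rewrite RintD//; [|by apply: intbZ => //; exact: csf_intb
    |by apply: intbZ => //; exact: snf_intb].
  rewrite !RintZ//; [|exact: snf_intb | exact: csf_intb].
  by rewrite -/(fc f k) -/(fs f k); ring.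
apply: (@le_trans _ _ (2^-1 * (energy f n.+1 + energy h n.+1))); last first.
  by rewrite ler_pM2l ?invr_gt0// lerD// bessel.
rewrite /energy -big_split mulr_sumr; apply: ler_sum => k _ /=.
set a := fc f k; set b := fc h k; set a' := fs f k; set b' := fs h k.
have w0 := wt_gt0 AB k; set W := wt k in w0 *.
have cW : `|c k / I| <= W.
  by rewrite normrM normfV (gtr0_norm I0) ler_pdivrMr// mulrC cw.
apply: (le_trans (ler_norm _)); rewrite normrM.
apply: (@le_trans _ _ (W * `|a * b + a' * b'|)); first by rewrite ler_wpM2r.
have -> : 2^-1 * (W * (a ^+ 2 + a' ^+ 2) + W * (b ^+ 2 + b' ^+ 2)) =
  W * (2^-1 * (a ^+ 2 + a' ^+ 2 + b ^+ 2 + b' ^+ 2)) by ring.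
rewrite ler_pM2l// ler_norml.
have := sqr_ge0 (a + b); have := sqr_ge0 (a' + b').
have := sqr_ge0 (a - b); have := sqr_ge0 (a' - b').
by move=> h1 h2 h3 h4; apply/andP; split; nra.
Qed.

(** Continuous functions are dense in L^1; truncating the approximations at the
    bound of [h] keeps them close to [h] in L^2 too. *)
Let pairing_bounded f h M m : sq D f -> (forall n, energy f n <= M) ->
  0 <= m -> measurable_fun D h -> (forall x, D x -> `|h x| <= m) ->
  \int[mu]_(x in D) (f x * h x) <=
  2^-1 * (M + \int[mu]_(x in D) (h x ^+ 2)).
Proof.
move=> sf fM m0 mh hm.
have fi : intb D f by exact: sq_intb.
have hi : intb D h by exact: (@intb_bounded _ _ _ m).
have sh : sq D h by exact: (@sq_bounded _ _ _ m).
have [g [gc gi glim]] := approximation_continuous_integrable mD finD hi.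
pose e n := \int[mu]_(x in D) `|h x - g n x|.
have elim0 : e n @[n --> \oo] --> (0 : R) by exact: fine_cvg glim.
pose q n x := clip m (g n x).
have qc n : continuous (q n).
  by move=> x; apply: (@continuous_comp _ _ _ (g n) (clip m)); [exact: gc | exact: clip_cont].
have qm n x : `|q n x| <= m by exact: clip_le.
have hq n x : D x -> `|h x - q n x| <= `|h x - g n x|.
  by move=> Dx; rewrite -{1}(clip_id (hm x Dx)); exact: clip_lip.
set F := \int[mu]_(x in D) (f x ^+ 2).
have F0 : 0 <= F by exact: Rint_sq_ge0.
set H := \int[mu]_(x in D) (h x ^+ 2).
have di n : intb D (fun x => `|h x - g n x|).
  by apply: intb_norm => //; apply: intbB.
have sqq n : sq D (q n).
  by apply: (@sq_bounded _ _ _ m) => //; exact: cont_meas.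
have key t n : 0 < t -> \int[mu]_(x in D) (f x * h x) <=
    2^-1 * (M + H) + t * F + (m / t + m) * e n.
  move=> t0.
  have b1 : \int[mu]_(x in D) (q n x ^+ 2) <= H + 2 * m * e n.
    rewrite -RintZ// -RintD//; [|by case: sh | exact: intbZ].
    apply: Rint_le => //; first by case: (sqq n).
      by apply: intbD => //; [case: sh | exact: intbZ].
    move=> x Dx; have := hq n x Dx; have := qm n x; have := hm x Dx.
    set a := h x; set b := q n x; set c := `|_ - g n x|.
    rewrite !ler_norml => /andP[? ?] /andP[? ?] /andP[? ?]; nra.
  have b2 : \int[mu]_(x in D) (f x * h x) <=
      \int[mu]_(x in D) (f x * q n x) + t * F + m / t * e n.
    have i1' : intb D (fun x => f x * q n x) by exact: sqM_intb.
    have i2 : intb D (fun x => t * f x ^+ 2) by apply: intbZ => //; case: sf.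
    have i3 : intb D (fun x => m / t * `|h x - g n x|) by exact: intbZ.
    have i12 := intbD mD i1' i2.
    rewrite -[t * F]RintZ//; last by case: sf.
    rewrite -[m / t * e n]RintZ// -(RintD mD i1' i2) -(RintD mD i12 i3).
    apply: Rint_le => //; [exact: sqM_intb | exact: intbD |].
    move=> x Dx.
    have s1 : `|h x - q n x| ^+ 2 <= 2 * m * `|h x - g n x|.
      rewrite expr2; apply: ler_pM => //; last exact: hq.
      rewrite (le_trans (ler_normB _ _))// mulr_natl mulr2n lerD//; exact: hm.
    have s2 : f x * (h x - q n x) <= t * f x ^+ 2 + `|h x - q n x| ^+ 2 / (2 * t).
      rewrite -subr_ge0 real_normK ?num_real//.
      set a := f x; set b := h x - q n x.
      have -> : t * a ^+ 2 + b ^+ 2 / (2 * t) - a * b =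
         (2 * t ^+ 2 * a ^+ 2 + b ^+ 2 - 2 * t * a * b) / (2 * t).
        by field; rewrite gt_eqF.
      rewrite divr_ge0 ?mulr_ge0 ?(ltW t0)//.
      have := sqr_ge0 (t * a - b); have := sqr_ge0 (t * a); nra.
    have s3 : `|h x - q n x| ^+ 2 / (2 * t) <= m / t * `|h x - g n x|.
      rewrite ler_pdivrMr ?mulr_gt0//.
      have -> : m / t * `|h x - g n x| * (2 * t) = 2 * m * `|h x - g n x|.
        by field; rewrite gt_eqF.
      exact: s1.
    by move: s2 s3; rewrite mulrBr; lra.
  have := pairing_cont fi fM (qc n).
  set X := \int[mu]_(x in D) (f x * h x) in b2 *.
  set Y := \int[mu]_(x in D) (f x * q n x) in b2 *.
  set Z := \int[mu]_(x in D) _ in b1 *.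
  move: b1 b2; move: X Y Z (e n) => X Y Z en b1 b2 b3.
  rewrite mulrDl; set u := m / t * en in b2 *; set v := t * F in b2 *.
  by nra.
have key2 t : 0 < t -> \int[mu]_(x in D) (f x * h x) <= 2^-1 * (M + H) + t * F.
  move=> t0.
  have lim : 2^-1 * (M + H) + t * F + (m / t + m) * e n @[n --> \oo] -->
      2^-1 * (M + H) + t * F + (m / t + m) * 0.
    by apply: cvgD; [exact: cvg_cst | apply: cvgMr; exact: elim0].
  rewrite mulr0 addr0 in lim.
  by apply: ler_cvg_to (cvg_cst _) lim _; apply: nearW => n; exact: key.
apply/ler_addgt0Pr => eps eps0.
apply: (le_trans (key2 (eps / (F + 1)) _)).
  by rewrite divr_gt0// ltr_wpDl.
have F1 : 0 < F + 1 by rewrite ltr_wpDl.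
rewrite lerD2l -mulrA ler_piMr ?(ltW eps0)//.
by rewrite ler_pdivrMl// mulr1 lerDl.
Qed.

(** Pair [f] with its own truncations, which are bounded, and let the level of
    truncation tend to infinity. *)
Lemma parseval f M : sq D f -> (forall n, energy f n <= M) ->
  \int[mu]_(x in D) (f x ^+ 2) <= M.
Proof.
move=> sf fM; have mf : measurable_fun D f by case: sf.
have mc m : measurable_fun D (fun x => clip m (f x)) by exact: clip_meas.
have sc (m : R) : 0 <= m -> sq D (fun x => clip m (f x)).
  by move=> m0; apply: (@sq_bounded _ _ _ m) => // x _; exact: clip_le.
have bnd n : \int[mu]_(x in D) (clip n%:R (f x) ^+ 2) <= M.
  have n0 : (0 : R) <= n%:R by [].
  have h := pairing_bounded sf fM n0 (mc _) (fun x _ => clip_le (f x) n0).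
  have : \int[mu]_(x in D) (clip n%:R (f x) ^+ 2) <=
      \int[mu]_(x in D) (f x * clip n%:R (f x)).
    apply: Rint_le => //; first by case: (sc _ n0).
      by apply: sqM_intb => //; exact: sc.
    by move=> x _; exact: clip_sq_le.
  move: h; set X := \int[mu]_(x in D) _; set Y := \int[mu]_(x in D) _.
  by move: X Y => X Y; lra.
have lim : \int[mu]_(x in D) (clip n%:R (f x) ^+ 2) @[n --> \oo] -->
    \int[mu]_(x in D) (f x ^+ 2).
  apply: (@Rint_dominated _ _ _ _ (fun x => f x ^+ 2)) => //.
  - by move=> n; exact: measurable_funX.
  - exact: measurable_funX.
  - apply: aeW => x _; apply: cvg_near_cst; near=> n.
    rewrite clip_id//; near: n; exact: nbhs_infty_ger.
  - by case: sf.
  - apply: aeW => x n _; rewrite normrX.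
    have := clip_lip (m := n%:R) (f x) 0 (ler0n _ n).
    rewrite (@clip_id _ n%:R 0) ?normr0// !subr0 => h.
    by rewrite -(real_normK (num_real (f x))) lerXn2r ?nnegrE.
by apply: ler_cvg_to lim (cvg_cst M) _; apply: nearW => n; exact: bnd.
Unshelve. all: by end_near.
Qed.

End Parseval.

(** * Weak derivatives *)

Section WeakDerivatives.
Context {R : realType}.
Local Notation mu := (@lebesgue_measure R).
Implicit Types (f g h : R -> R).

Lemma test_smooth f : test_fun1 f -> smooth f.
Proof. by case=> fs _; split. Qed.

Lemma smooth_test f (a b : R) : smooth f -> (forall x, ~ (a <= x <= b) -> f x = 0) ->
  test_fun1 f.
Proof.
move=> [fs] f0; split=> //; exists `[a, b]%classic; first exact: segment_compact.
by move=> x /=; rewrite in_itv /= => /f0.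
Qed.

Lemma test_bounded f : test_fun1 f -> exists M, forall x, `|f x| <= M.
Proof.
move=> tf; have fc := smooth_cont (test_smooth tf).
have [_ [K Kc f0]] := tf.
have [M [_ HM]] : bounded_set (f @` K).
  apply: compact_bounded; apply: continuous_compact; last exact: Kc.
  exact: continuous_subspaceT.
exists (`|M| + 1) => x; have [Kx|Kx] := pselect (K x).
  by apply: HM; [rewrite ltr_pwDr// ler_norm | exists x].
by rewrite f0// normr0 addr_ge0.
Qed.

Lemma test_support f : test_fun1 f -> exists2 r, 0 < r & forall x, r < `|x| -> f x = 0.
Proof.
move=> [_ [K Kc f0]]; have [M [_ HM]] := compact_bounded Kc.
exists (`|M| + 1) => [|x xM]; first by rewrite ltr_wpDl.
apply: f0 => Kx; have : `|x| <= `|M| + 1 by apply: HM => //; rewrite ltr_pwDr// ler_norm.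
by rewrite leNgt xM.
Qed.

Lemma test_d f : test_fun1 f -> test_fun1 (derive1 f).
Proof.
move=> tf; have [r r0 fr] := test_support tf.
apply: (@smooth_test _ (- r) r); first exact/smooth_d/test_smooth.
move=> x xr; have rx : r < `|x| by rewrite ltNge ler_norml; apply/negP.
have nx : \near x, (fun=> 0 : R) x = f x.
  have : \forall y \near x, r < `|y|.
    exact: (@cvgr_gt R R (nbhs x) (nbhs_filter x) _ _ (@norm_continuous R R x) r rx).
  by apply: filterS => y ry; rewrite fr.
have [] // := isdE (near_eq_is_derive nx (is_derive_cst _ _ _)).
Qed.

Lemma test_sq f : test_fun1 f -> sq setT f.
Proof.
move=> tf; have mf : measurable_fun setT f by apply: smooth_meas => //; exact: test_smooth.
split=> //.
have [r r0 fr] := test_support tf; have [M hM] := test_bounded tf.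
pose E : set R := `[- r, r]%classic.
apply: (@intb_ext _ _ ((fun x => f x ^+ 2) \_ E)).
  move=> x; rewrite patchE; case: ifPn => //.
  rewrite notin_setE /E /= in_itv /= -ler_norml => /negP; rewrite -ltNge => /fr ->.
  by rewrite expr0n.
apply: intb_patch; first exact: measurable_itv.
by apply: cont_intb_cc => x; apply: cvgM; apply: smooth_cont; exact: test_smooth.
Qed.

Lemma wderiv_spec f : H1 f -> L2 (wderiv f) /\ is_wderiv f (wderiv f).
Proof.
move=> [_ [g gL2 fg]]; rewrite /wderiv; case: xgetP => [h -> []//|].
by move=> /(_ g) []; split.
Qed.

Lemma wderiv_lin f f' g g' (c : R) : L2 f -> L2 f' -> L2 g -> L2 g' ->
  is_wderiv f f' -> is_wderiv g g' ->
  is_wderiv (fun x => f x + c * g x) (fun x => f' x + c * g' x).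
Proof.
move=> /sq_L2 sf /sq_L2 sf' /sq_L2 sg /sq_L2 sg' df dg phi tphi.
have sphi := test_sq tphi; have sphi' := test_sq (test_d tphi).
have mT : @measurable _ (measurableTypeR R) setT by [].
have e h h' (k k' : R -> R) : sq setT h -> sq setT h' -> sq setT k ->
    \int[mu]_x ((h x + c * h' x) * k x) =
    \int[mu]_x (h x * k x) + c * \int[mu]_x (h' x * k x).
  move=> sh sh' sk.
  rewrite -RintZ//; last exact: sqM_intb.
  rewrite -RintD//; [|exact: sqM_intb|by apply: intbZ => //; exact: sqM_intb].
  by apply: Rint_ext => x _; ring.
by rewrite !e// df// dg//; ring.
Qed.

Lemma eq0_of_tests g (a b : R) : a < b -> sq setT g ->
  (forall phi, test_fun1 phi -> (forall x, ~ (a < x < b) -> phi x = 0) ->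
     \int[mu]_x (g x * phi x) = 0) ->
  \forall x \ae mu, a < x < b -> g x = 0.
Proof.
move=> ab sg g0.
have sgD : sq `]a, b[ g by exact: sqS sg.
have gi : intb `]a, b[ g by apply: sq_intb => //; exact: mu_oo_fin.
have : \forall x \ae mu, a < x < b -> `|g x| <= 0.
  apply: dual_bound => // phi c d phis ac cd db phi0 _.
  have out x : ~ (a < x < b) -> phi x = 0.
    move=> h; apply: phi0; apply: contra_not h => /andP[cx xd].
    by rewrite (lt_trans ac cx) (lt_trans xd db).
  have tphi : test_fun1 phi.
    apply: (@smooth_test _ c d) => // x h; apply: phi0; apply: contra_not h.
    by move=> /andP[? ?]; rewrite !ltW.
  rewrite mul0r -(Rint_setT_sub (D := `]a, b[%classic)) ?g0 ?normr0//.
  apply: aeW => x /=; rewrite in_itv /= => /out ->.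
  by rewrite mulr0.
by apply: aeS => x h /h; rewrite normr_le0 => /eqP.
Qed.

Lemma ae_neq (a : R) : \forall x \ae mu, x <> a.
Proof.
exists [set a]; split; [exact: measurable_set1 | exact: lebesgue_measure_set1|].
by move=> x /= /contrapT.
Qed.

Lemma ae_all (P : nat -> R -> Prop) : (forall n, \forall x \ae mu, P n x) ->
  \forall x \ae mu, forall n, P n x.
Proof. by move=> h; apply/ae_foralln. Qed.

Lemma wderiv_unique f g1 g2 : L2 g1 -> L2 g2 -> is_wderiv f g1 ->
  is_wderiv f g2 -> \forall x \ae mu, g1 x = g2 x.
Proof.
move=> l1 l2 d1 d2; have s := sq_L2 (L2B l1 l2).
have h n : \forall x \ae mu, - n.+1%:R < x < n.+1%:R -> g1 x - g2 x = 0.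
  apply: eq0_of_tests => //; first by rewrite gtrN.
  move=> phi tphi _; have sphi := test_sq tphi.
  transitivity (\int[mu]_x (g1 x * phi x - g2 x * phi x)).
    by apply: Rint_ext => x _; ring.
  rewrite RintB//; [|apply: sqM_intb => //; exact: sq_L2..].
  by apply/eqP; rewrite subr_eq0 -eqr_opp -d1// -d2.
apply: (aeS _ (ae_all h)) => x hx; apply/eqP; rewrite -subr_eq0; apply/eqP.
apply: (hx (Num.bound x)).
rewrite -ltr_norml (lt_le_trans (archi_boundP (normr_ge0 x)))//.
by rewrite ler_nat /Num.bound normr_id.
Qed.

Lemma derive1n_eq_on f g (a b : R) n : (forall x, a < x < b -> f x = g x) ->
  forall x, a < x < b -> derive1n n f x = derive1n n g x.
Proof.
move=> fg; elim: n => [|n IH] x xab; first exact: fg.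
rewrite /derive1n !iterS !derive1E; apply: near_eq_derive.
have : x \in `]a, b[ by rewrite in_itv.
by move=> /near_in_itvoo; apply: filterS => y; rewrite in_itv /= => /IH.
Qed.

Section Localised.
Variable L : R.
Hypothesis L_gt0 : 0 < L.
Let D : set R := `]- L, L[%classic.
Let mD : measurable D. Proof. exact: measurable_itv. Qed.

(** Multiplied by this cutoff, a smooth function becomes a test function and is
    unchanged near [-L, L]. *)
Definition cutoff : R -> R := plateau 1 (- (L + 2)) (L + 2).

Lemma cutoff_smooth : smooth cutoff. Proof. exact: smooth_plateau. Qed.

Lemma cutoff_in (x : R) : - (L + 1) < x < L + 1 -> cutoff x = 1.
Proof. by move=> /andP[? ?]; apply: plateau_in; lra. Qed.

Lemma cutoff_test f : smooth f -> test_fun1 (fun x => f x * cutoff x).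
Proof.
move=> fs; apply: (@smooth_test _ (- (L + 2)) (L + 2)).
  by apply: smoothM => //; exact: cutoff_smooth.
move=> x h; rewrite /cutoff plateau_out ?mulr0//.
by apply: contra_not h => /andP[? ?]; rewrite !ltW.
Qed.

Lemma cutoff_derive f n (x : R) : - (L + 1) < x < L + 1 ->
  derive1n n (fun x => f x * cutoff x) x = derive1n n f x.
Proof. by apply: derive1n_eq_on => y h; rewrite cutoff_in// mulr1. Qed.

Lemma D_inside (x : R) : D x -> - (L + 1) < x < L + 1.
Proof. by rewrite /D /= in_itv /= => /andP[? ?]; apply/andP; split; lra. Qed.

Definition vanish_out f : Prop :=
  \forall x \ae mu, (`]-oo, (- L)[ `|` `]L, +oo[)%classic x -> f x = 0.

(** The two endpoints are a null set. *)
Lemma vanish_outD f : vanish_out f -> \forall x \ae mu, ~ D x -> f x = 0.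
Proof.
move=> f0.
apply: (aeS2 _ (aeI (ae_neq (- L)) (ae_neq L)) f0) => x [xL xL'] h.
rewrite /D /= in_itv /= => /negP; rewrite negb_and -!leNgt => xD; apply: h.
case/orP: xD; rewrite le_eqVlt => /orP[/eqP|].
- by move=> /xL.
- by left; rewrite /= in_itv.
- by move=> /esym/xL'.
- by right; rewrite /= in_itv /= andbT.
Qed.

(** Test functions supported outside [-L, L] only see the values of [f] there;
    intervals (L, L + n) and (- L - n, - L) exhaust that region. *)
Lemma wderiv_vanish f : H1 f -> vanish_out f -> vanish_out (wderiv f).
Proof.
move=> fH1 f0; have [gL2 fg] := wderiv_spec fH1.
have key (a b : R) : a < b -> `]a, b[%classic `<=` (`]-oo, (- L)[ `|` `]L, +oo[)%classic ->
    \forall x \ae mu, a < x < b -> wderiv f x = 0.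
  move=> ab sub; apply: eq0_of_tests => //; first exact: sq_L2.
  move=> phi tphi phi0; apply/eqP; rewrite -oppr_eq0 -fg//; apply/eqP.
  rewrite -[RHS](Rint0 setT); apply: Rint_ae.
  apply: (aeS2 _ (aeI (ae_neq a) (ae_neq b)) f0) => x [xa xb] fx _.
  have [xab|xab] := boolP (a < x < b).
    by rewrite fx ?mul0r//; apply: sub; rewrite /= in_itv.
  suff nx : \near x, (fun=> 0 : R) x = phi x.
    by have [_ ->] := isdE (near_eq_is_derive nx (is_derive_cst _ _ _)); rewrite mulr0.
  move: xab; rewrite negb_and -!leNgt => /orP[]; rewrite le_eqVlt => /predU1P[] // h.
    have : \near x, x < a by exact: lt_nbhsl.
    by apply: filterS => y ya; rewrite phi0// => /andP[/lt_trans /(_ ya)]; rewrite ltxx.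
  by move: xb; rewrite h.
have : \near x, b < x by exact: lt_nbhsr.
  by apply: filterS => y yb; rewrite phi0// => /andP[_ /(lt_trans yb)]; rewrite ltxx.
have kp n : \forall x \ae mu, L < x < L + n.+1%:R -> wderiv f x = 0.
  apply: key; first by rewrite ltrDl.
  by move=> x; rewrite /= in_itv /= => /andP[Lx _]; right; rewrite /= in_itv /= Lx.
have kn n : \forall x \ae mu, - (L + n.+1%:R) < x < - L -> wderiv f x = 0.
  apply: key; first by rewrite ltrN2 ltrDl.
  by move=> x; rewrite /= in_itv /= => /andP[_ Lx]; left; rewrite /= in_itv.
apply: (aeS2 _ (ae_all kp) (ae_all kn)) => x hp hn.
have bd : `|x| < (Num.bound x).+1%:R.
  rewrite (lt_le_trans (archi_boundP (normr_ge0 x)))//.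
  by rewrite ler_nat /Num.bound normr_id leqnSn.
move: bd; rewrite ltr_norml => /andP[b1 b2].
case; rewrite /= in_itv /= ?andbT => xL.
  apply: (hn (Num.bound x)); rewrite xL andbT opprD.
  by rewrite (le_lt_trans _ b1)// gerDr oppr_le0 ltW.
apply: (hp (Num.bound x)); rewrite xL /=.
by rewrite (lt_le_trans b2)// lerDr ltW.
Qed.

(** Integration by parts against an arbitrary smooth function: outside [D]
    nothing is seen of it, so it may be cut off. *)
Lemma wderiv_local f phi : H1 f -> vanish_out f -> smooth phi ->
  \int[mu]_(x in D) (f x * derive1 phi x) =
  - \int[mu]_(x in D) (wderiv f x * phi x).
Proof.
move=> fH1 f0 phis; have [gL2 fg] := wderiv_spec fH1.
have := fg _ (cutoff_test phis).
rewrite (Rint_setT_sub (D := D)); last first.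
  by apply: (aeS _ (vanish_outD f0)) => x h /h ->; rewrite mul0r.
rewrite (Rint_setT_sub (D := D) (f := fun x => _ * (_ * _))); last first.
  by apply: (aeS _ (vanish_outD (wderiv_vanish fH1 f0))) => x h /h ->; rewrite mul0r.
have -> : \int[mu]_(x in D) (f x * derive1 (fun x => phi x * cutoff x) x) =
    \int[mu]_(x in D) (f x * derive1 phi x).
  by apply: Rint_ext => x /D_inside h; have := cutoff_derive phi 1 h => /= ->.
move=> ->; congr (- _); apply: Rint_ext => x /D_inside h.
by rewrite cutoff_in// mulr1.
Qed.

Lemma wderiv_sq f : H1 f -> sq D (wderiv f).
Proof. by move=> /wderiv_spec[/sq_L2 s _]; exact: sqS s. Qed.

(** The embedding of H^1 into L^oo on a bounded interval: test [f] against
    [phi] and integrate by parts onto a primitive of [phi], which is bounded by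
    the L^1 norm of [phi]. *)
Lemma sobolev f : H1 f -> vanish_out f ->
  \forall x \ae mu, D x -> `|f x| <= \int[mu]_(x in D) `|wderiv f x|.
Proof.
move=> fH1 f0; have [fL2 _] := fH1.
have sf : sq D f by exact: sqS (sq_L2 fL2).
have fD : (mu D < +oo)%E by exact: mu_oo_fin.
have fi : intb D f by exact: sq_intb.
have sg := wderiv_sq fH1.
have gi : intb D (wderiv f) by exact: sq_intb.
suff : \forall x \ae mu, - L < x < L -> `|f x| <= \int[mu]_(x in D) `|wderiv f x|.
  by apply: aeS => x h; rewrite /D /= in_itv /=.
apply: dual_bound => // phi c d phis Lc cd dL phi0 phi01.
have phic := smooth_cont phis.
have phil x : x <= - L -> phi x = 0.
  by move=> xL; apply: phi0 => /andP[cx _]; have := lt_trans Lc cx; rewrite ltNge xL.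
have phir x : L <= x -> phi x = 0.
  by move=> xL; apply: phi0 => /andP[_ xd]; have := lt_trans xd dL; rewrite ltNge xL.
have pd := prim_isd phic phil; have ps := smooth_prim phic phil phis.
have -> : \int[mu]_(x in `]- L, L[) (f x * phi x) =
    \int[mu]_(x in D) (f x * derive1 (prim (- L) phi) x).
  by apply: Rint_ext => x _; rewrite (isd_funE pd).
rewrite wderiv_local// normrN.
set I := \int[mu]_(x in `]- L, L[) phi x.
have pI x : `|prim (- L) phi x| <= I.
  rewrite (le_trans (prim_le phic phil x phir))// /I.
  rewrite (Rint_ext (g := phi))// => y _.
  by rewrite ger0_norm//; case/andP: (phi01 y).
have pi : intb D (fun x => wderiv f x * prim (- L) phi x).
  by apply: (@intbMb _ _ _ _ I) => //; exact: smooth_meas.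
apply: (le_trans (Rint_norm_le mD pi)).
rewrite mulrC -RintZ//; last exact: intb_norm.
apply: Rint_le => //; [exact: intb_norm | by apply: intbZ => //; exact: intb_norm|].
by move=> x _; rewrite normrM mulrC ler_wpM2r.
Qed.

End Localised.

End WeakDerivatives.

(** * Measurability in time *)

Section TimeMeasurability.
Context {R : realType}.
Local Notation mu := (@lebesgue_measure R).
Implicit Types (f g h : R -> R).

Lemma H1norm_sqE f : H1norm f ^+ 2 =
  \int[mu]_x (f x ^+ 2) + \int[mu]_x (wderiv f x ^+ 2).
Proof. by rewrite /H1norm sqr_sqrtr// addr_ge0// Rint_sq_ge0. Qed.

Lemma Rint_sq_sub (D : set R) f : measurable D -> sq setT f ->
  \int[mu]_(x in D) (f x ^+ 2) <= \int[mu]_x (f x ^+ 2).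
Proof.
move=> mD [mf fi]; rewrite Rintegral_mkcond.
apply: Rint_le => //.
- apply: intb_patch => //; exact: intbS fi.
- move=> x _; rewrite patchE; case: ifP => // _; exact: sqr_ge0.
Qed.

Lemma H1norm_L2 (D : set R) f : measurable D -> H1 f ->
  \int[mu]_(x in D) (f x ^+ 2) <= H1norm f ^+ 2.
Proof.
move=> mD [fL2 _]; rewrite H1norm_sqE (le_trans (Rint_sq_sub mD (sq_L2 fL2)))//.
by rewrite lerDl Rint_sq_ge0.
Qed.

Lemma H1norm_dL2 (D : set R) f : measurable D -> H1 f ->
  \int[mu]_(x in D) (wderiv f x ^+ 2) <= H1norm f ^+ 2.
Proof.
move=> mD /wderiv_spec[dL2 _].
rewrite H1norm_sqE (le_trans (Rint_sq_sub mD (sq_L2 dL2)))//.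
by rewrite lerDr Rint_sq_ge0.
Qed.

Lemma Rint_L1_L2 (D : set R) f : measurable D -> (mu D < +oo)%E -> sq D f ->
  (\int[mu]_(x in D) `|f x|) ^+ 2 <=
  fine (mu D) * \int[mu]_(x in D) (f x ^+ 2).
Proof.
move=> mD fD sf.
have s1 : sq D (fun=> 1) by apply: (@sq_bounded _ _ _ 1) => // x _; rewrite normr1.
have := cauchy_schwarz mD s1 (sq_norm sf).
rewrite (Rint_ext (f := fun x => 1 * `|f x|) (g := fun x => `|f x|)); last first.
  by move=> x _; rewrite mul1r.
rewrite (Rint_ext (f := fun x => 1 ^+ 2) (g := fun=> 1)); last first.
  by move=> x _; rewrite expr1n.
rewrite Rintegral_cst// mul1r.
rewrite (Rint_ext (f := fun x => `|f x| ^+ 2) (g := fun x => f x ^+ 2))//.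
by move=> x _; rewrite real_normK ?num_real.
Qed.

Definition H1_pair g g' : Prop := [/\ L2 g, L2 g' & is_wderiv g g'].

Lemma H1_pair_H1 g g' : H1_pair g g' -> H1 g.
Proof. by case=> ? ? ?; split=> //; exists g'. Qed.

Lemma H1_pair_wderiv f : H1 f -> H1_pair f (wderiv f).
Proof. by move=> fH1; have [? ?] := wderiv_spec fH1; case: fH1; split. Qed.

Lemma H1_pair_lin f f' g g' c : H1_pair f f' -> H1_pair g g' ->
  H1_pair (fun x => f x + c * g x) (fun x => f' x + c * g' x).
Proof.
move=> [? ? ?] [? ? ?]; split; [exact/L2D/L2Z | exact/L2D/L2Z |].
exact: wderiv_lin.
Qed.

Lemma H1_pair0 : H1_pair (fun=> 0) (fun=> 0).
Proof.
have z : L2 (fun=> 0 : R).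
  have := @Lfun_addr_closed _ _ R mu 2%:E (@lee1n R 2) => -[h _]; exact: h.
have e0 (k : R -> R) : \int[mu]_x (0 * k x) = 0.
  by rewrite -[RHS](Rint0 setT); apply: Rint_ext => x _; rewrite mul0r.
by split=> // phi _; rewrite !e0 oppr0.
Qed.

Lemma H1_pair_sum n (c : 'I_n -> R) (f : 'I_n -> R -> R) :
  (forall i, H1 (f i)) ->
  H1_pair (fun x => \sum_(i < n) c i * f i x)
          (fun x => \sum_(i < n) c i * wderiv (f i) x).
Proof.
move=> fH1; have h (r : seq 'I_n) :
    H1_pair (fun x => \sum_(i <- r) c i * f i x)
            (fun x => \sum_(i <- r) c i * wderiv (f i) x).
  elim: r => [|i r IH].
    have e (F : 'I_n -> R -> R) : (fun x => \sum_(i <- [::]) F i x) = fun=> 0.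
      by apply/funext => x; rewrite big_nil.
    by rewrite !e; exact: H1_pair0.
  have e (F : 'I_n -> R -> R) : (fun x => \sum_(j <- i :: r) c j * F j x) =
      fun x => \sum_(j <- r) c j * F j x + c i * F i x.
    by apply/funext => x; rewrite big_cons addrC.
  rewrite (e f) (e (fun j => wderiv (f j))).
  by apply: H1_pair_lin => //; exact: H1_pair_wderiv.
exact: h.
Qed.

(** Such a function takes finitely many values, on the atoms of the algebra
    generated by the sets [A i]: so does any functional of a simple function. *)
Lemma finite_meas n (A : 'I_n -> set R) (G : {ffun 'I_n -> bool} -> R) :
  (forall i, measurable (A i)) ->
  measurable_fun setT (fun t => G [ffun i => t \in A i]).
Proof.
move=> mA.
have -> : (fun t => G [ffun i => t \in A i]) = fun t =>
    \sum_(b : {ffun 'I_n -> bool})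
      G b * \prod_(i < n) (if b i then \1_(A i) t else 1 - \1_(A i) t).
  apply/funext => t; rewrite (bigD1 [ffun i => t \in A i])//=.
  rewrite [X in _ * X]big1 ?mulr1 ?[X in _ + X]big1 ?addr0//.
  - move=> b bt; have [i bi] : exists i, b i != (t \in A i).
      apply: contrapT => h; move/eqP: bt; apply; apply/ffunP => i; rewrite ffunE.
      by apply/eqP/negPn/negP => bi; apply: h; exists i.
    rewrite (bigD1 i)//= indicE; move: bi.
    by case: (b i); case: (t \in A i) => //= _; rewrite ?subrr !(mul0r, mulr0).
  - by move=> i _; rewrite ffunE indicE; case: (t \in A i); rewrite ?subr0.
apply: measurable_sum => b; apply: measurable_funM => //.
apply: measurable_prod => i _; case: (b i); first exact: measurable_indic.
by apply: measurable_funB => //; exact: measurable_indic.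
Qed.

Variable L : R.
Hypothesis L_gt0 : 0 < L.
Let D : set R := `]- L, L[%classic.
Let mD : measurable D. Proof. exact: measurable_itv. Qed.
Let finD : (mu D < +oo)%E. Proof. exact: mu_oo_fin. Qed.

Variables (b : R -> R) (Kb Kl : R) (phi : R -> R) (Kp : R).
Hypotheses (b_cont : continuous b) (b_le : forall x, `|b x| <= Kb)
  (b_lip : forall x y, `|b x - b y| <= Kl * `|x - y|)
  (phi_meas : measurable_fun D phi) (phi_le : forall x, D x -> `|phi x| <= Kp).

(** The derivative [f'] is an argument of its own: for a simple function of time
    it is a combination of fixed representatives, unlike [wderiv]. *)
Definition flux f f' : R := \int[mu]_(x in D) (b (f x) * f' x * phi x).

Lemma flux_intb f f' : sq setT f -> sq setT f' -> intb D (fun x => b (f x) * f' x * phi x).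
Proof.
move=> [mf _] sf'.
have mb : measurable_fun D (fun x => b (f x)).
  by apply: measurableT_comp; [exact: continuous_measurable_fun | exact: measurable_funTS].
have f'i : intb D f' by apply: sq_intb => //; exact: sqS sf'.
apply: (@intbMb _ _ _ _ Kp) => //.
apply: (@intb_ext _ _ (fun x => f' x * b (f x))); first by move=> x; rewrite mulrC.
by apply: (@intbMb _ _ _ _ Kb).
Qed.

Let flux_diff f f' g g' : sq setT f -> sq setT f' -> sq setT g -> sq setT g' ->
  `|flux f f' - flux g g'| <=
    Kb * Kp * \int[mu]_(x in D) `|f' x - g' x| +
    Kl * Kp * \int[mu]_(x in D) (`|f x - g x| * `|f' x|).
Proof.
move=> sf sf' sg sg'.
have nsq h : sq setT h -> sq D (fun x => `|h x|).
  by move=> sh; apply: sq_norm; exact: sqS sh.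
have i1 : intb D (fun x => `|f' x - g' x|).
  by apply: sq_intb => //; apply: (nsq (fun x => f' x - g' x)); exact: sqB.
have i2 : intb D (fun x => `|f x - g x| * `|f' x|).
  apply: (@sqM_intb _ _ (fun x => `|f x - g x|) (fun x => `|f' x|)) => //.
    by apply: (nsq (fun x => f x - g x)); exact: sqB.
  exact: nsq.
have fi := flux_intb sf sf'; have gi := flux_intb sg sg'.
rewrite /flux -RintB// (le_trans (Rint_norm_le mD (intbB mD fi gi)))//.
rewrite -!RintZ// -RintD//; [|exact: intbZ..].
apply: Rint_le => //.
- by apply: intb_norm => //; exact: intbB.
- by apply: intbD => //; exact: intbZ.
move=> x Dx.
have -> : b (f x) * f' x * phi x - b (g x) * g' x * phi x =
   b (g x) * phi x * (f' x - g' x) + (b (f x) - b (g x)) * phi x * f' x by ring.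
rewrite (le_trans (ler_normD _ _))// !normrM; apply: lerD.
  by apply: ler_wpM2r => //; apply: ler_pM => //; exact: phi_le.
rewrite mulrA; apply: ler_wpM2r => //; rewrite mulrAC.
by apply: ler_pM => //; exact: phi_le.
Qed.

Let simple_flux (s : R -> R -> R) : H1_simple s ->
  exists2 s' : R -> R -> R, (forall t, H1_pair (s t) (s' t)) &
    measurable_fun setT (fun t => flux (s t) (s' t)).
Proof.
move=> [n [A [f [Af sE]]]].
exists (fun t x => \sum_(i < n) \1_(A i) t * wderiv (f i) x).
  move=> t; have -> : s t = fun x => \sum_(i < n) \1_(A i) t * f i x.
    by apply/funext => x; exact: sE.
  by apply: H1_pair_sum => i; case: (Af i).
pose G (c : {ffun 'I_n -> bool}) := flux
  (fun x => \sum_(i < n) (c i)%:R * f i x)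
  (fun x => \sum_(i < n) (c i)%:R * wderiv (f i) x).
have -> : (fun t => flux (s t) (fun x => \sum_(i < n) \1_(A i) t * wderiv (f i) x)) =
    fun t => G [ffun i => t \in A i].
  apply/funext => t; rewrite /G; congr flux; apply/funext => x; rewrite ?sE;
    by apply: eq_bigr => i _; rewrite ffunE indicE.
by apply: finite_meas => i; case: (Af i).
Qed.

(** The flux is the limit, for almost every time, of the fluxes of the simple
    functions approximating [u]; the Lipschitz bound on [b] makes the flux
    continuous for the H^1 norm. *)
Lemma flux_meas (T : R) (u : R -> R -> R) : Linfty_H1 T u ->
  exists2 Z : R -> R, measurable_fun setT Z &
    \forall t \ae mu, t \in `]0, T[ -> Z t = flux (u t) (wderiv (u t)).
Proof.
move=> [uH1 [s ssimple slim] _].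
pose q n : R -> R -> R := sval (cid2 (simple_flux (ssimple n))).
have qH1 n t : H1_pair (s n t) (q n t).
  by rewrite /q; case: cid2.
have qm n : measurable_fun setT (fun t => flux (s n t) (q n t)).
  by rewrite /q; case: cid2.
exists (fun t => fine (limn_esup (fun n => (flux (s n t) (q n t))%:E))).
  apply: (@measurableT_comp _ _ _ _ _ _ fine); first exact: fine_measurable.
  by apply: measurable_fun_limn_esup => n; exact/measurable_EFinP.
apply: (aeS2 _ uH1 slim) => t uH1t st tT.
have {}uH1t := uH1t tT; have {}st := st tT.
have mT : @measurable _ (measurableTypeR R) setT by [].
suff lim : flux (s n t) (q n t) @[n --> \oo] --> flux (u t) (wderiv (u t)).
  have limE : (flux (s n t) (q n t))%:E @[n --> \oo] --> (flux (u t) (wderiv (u t)))%:E.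
    by apply: cvg_EFin; [exact: nearW | exact: lim].
  by rewrite (cvg_limn_einf_sup limE).2.
have [su su' du] := H1_pair_wderiv uH1t.
have {}su := sq_L2 su; have {}su' := sq_L2 su'.
have diffP n : H1_pair (fun x => u t x - s n t x)
    (fun x => wderiv (u t) x - q n t x).
  have := H1_pair_lin (-1) (H1_pair_wderiv uH1t) (qH1 n t).
  by under eq_fun do rewrite mulN1r; under [X in H1_pair _ X]eq_fun do rewrite mulN1r.
have diffH1 n : H1 (fun x => u t x - s n t x) := H1_pair_H1 (diffP n).
pose e n := H1norm (fun x => u t x - s n t x).
have de n : \int[mu]_(x in D) ((u t x - s n t x) ^+ 2) <= e n ^+ 2.
  exact: (H1norm_L2 mD (diffH1 n)).
have de' n : \int[mu]_(x in D) ((wderiv (u t) x - q n t x) ^+ 2) <= e n ^+ 2.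
  rewrite (le_trans _ (H1norm_dL2 mD (diffH1 n)))// le_eqVlt; apply/orP; left.
  apply/eqP/Rint_ae.
  have [_ l2 d2] := diffP n; have [l1 d1] := wderiv_spec (diffH1 n).
  by apply: (aeS _ (wderiv_unique l2 l1 d2 d1)) => x -> _.
have sD (h : R -> R) : sq setT h -> sq D h by apply: sqS.
pose U := \int[mu]_(x in D) (wderiv (u t) x ^+ 2).
have U0 : 0 <= U by exact: Rint_sq_ge0.
pose c1 := `|Kb * Kp|; pose c2 := `|Kl * Kp|.
pose C := 2 * c1 ^+ 2 * (2 * L) + 2 * c2 ^+ 2 * U + 1.
have C0 : 0 < C.
  have L0 := ltW L_gt0; have := mulr_ge0 (sqr_ge0 c1) L0.
  by have := mulr_ge0 (sqr_ge0 c2) U0; rewrite /C; nra.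
have est n : `|flux (u t) (wderiv (u t)) - flux (s n t) (q n t)| ^+ 2 <= C * e n ^+ 2.
  have [ss sq' _] := qH1 n t.
  have {}ss := sq_L2 ss; have {}sq' := sq_L2 sq'.
  have h := flux_diff su su' ss sq'.
  set X := \int[mu]_(x in D) `|_| in h; set Y := \int[mu]_(x in D) (_ * _) in h.
  have X0 : 0 <= X by apply: Rintegral_ge0.
  have Y0 : 0 <= Y by apply: Rintegral_ge0 => x _; rewrite mulr_ge0.
  have X2 : X ^+ 2 <= 2 * L * e n ^+ 2.
    have := Rint_L1_L2 mD finD (sD _ (sqB mT su' sq')).
    rewrite mu_oo; last by rewrite (gt0_cp L_gt0).
    have -> : L - - L = 2 * L by ring.
    move=> /le_trans; apply; apply: ler_wpM2l; first by rewrite mulr_ge0// ltW.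
    exact: de'.
  have Y2 : Y ^+ 2 <= U * e n ^+ 2.
    have := cauchy_schwarz mD (sq_norm (sD _ (sqB mT su ss))) (sq_norm (sD _ su')).
    move=> /le_trans; apply; rewrite mulrC.
    have nE (k : R -> R) : \int[mu]_(x in D) (`|k x| ^+ 2) = \int[mu]_(x in D) (k x ^+ 2).
      by apply: Rint_ext => x _; rewrite real_normK ?num_real.
    by rewrite !nE; apply: ler_wpM2l => //; exact: de.
  have {}h : `|flux (u t) (wderiv (u t)) - flux (s n t) (q n t)| <= c1 * X + c2 * Y.
    apply: (le_trans h); apply: lerD; apply: ler_wpM2r => //; exact: ler_norm.
  have c10 : 0 <= c1 by exact: normr_ge0.
  have c20 : 0 <= c2 by exact: normr_ge0.
  have en0 := sqr_ge0 (e n).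
  apply: (@le_trans _ _ ((c1 * X + c2 * Y) ^+ 2)).
    by rewrite lerXn2r ?nnegrE ?addr_ge0 ?mulr_ge0.
  apply: (@le_trans _ _ (2 * c1 ^+ 2 * X ^+ 2 + 2 * c2 ^+ 2 * Y ^+ 2)).
    have := sqr_ge0 (c1 * X - c2 * Y); nra.
  have a1 : 2 * c1 ^+ 2 * X ^+ 2 <= 2 * c1 ^+ 2 * (2 * L * e n ^+ 2).
    by apply: ler_wpM2l => //; rewrite mulr_ge0// sqr_ge0.
  have a2 : 2 * c2 ^+ 2 * Y ^+ 2 <= 2 * c2 ^+ 2 * (U * e n ^+ 2).
    by apply: ler_wpM2l => //; rewrite mulr_ge0// sqr_ge0.
  apply: (le_trans (lerD a1 a2)); rewrite -subr_ge0 /C.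
  have -> : (2 * c1 ^+ 2 * (2 * L) + 2 * c2 ^+ 2 * U + 1) * e n ^+ 2 -
    (2 * c1 ^+ 2 * (2 * L * e n ^+ 2) + 2 * c2 ^+ 2 * (U * e n ^+ 2)) = e n ^+ 2 by ring.
  by [].
have e2 : C * e n ^+ 2 @[n --> \oo] --> (0 : R).
  have -> : (0 : R) = C * (0 * 0) by rewrite !mulr0.
  apply: cvgMr; under eq_fun do rewrite expr2.
  by apply: cvgM; exact: st.
apply/cvgrPdist_le => eps eps0.
have eps2 : 0 < eps ^+ 2 by rewrite exprn_gt0.
have /cvgr0_norm_le /(_ _ eps2) H := e2.
apply: filterS H => n Hn.
rewrite -(@ler_pXn2r _ 2%N) ?nnegrE ?(ltW eps0)//.
apply: (le_trans (est n)).
by move: Hn; rewrite ger0_norm// mulr_ge0 ?sqr_ge0// ltW.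
Qed.

End TimeMeasurability.

(** * The equation tested against products *)

Section WeakEquation.
Context {R : realType}.
Local Notation mu := (@lebesgue_measure R).
Implicit Types (f g h : R -> R).

Lemma pspace_prod f g : smooth g ->
  pspace (fun t x => f t * g x) = fun t x => f t * derive1 g x.
Proof.
move=> gs; apply/funext => t; apply/funext => x; rewrite /pspace.
by have [_ ->] := isdE (isdZ (f t) (smooth_isd x gs)).
Qed.

Lemma ptime_prod f g : smooth f ->
  ptime (fun t x => f t * g x) = fun t x => derive1 f t * g x.
Proof.
move=> fs; apply/funext => t; apply/funext => x; rewrite /ptime.
have := isdE (isdM (smooth_isd t fs) (is_derive_cst (g x) t 1)).
by rewrite mulr0 addr0 => -[].
Qed.

Lemma smooth2_prod f g : smooth f -> smooth g ->
  smooth2 (fun t x => f t * g x).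
Proof.
move=> fs gs w.
have [f' [g' [fs' gs' ->]]] : exists f' g', [/\ smooth f', smooth g' &
    partials w (fun t x => f t * g x) = fun t x => f' t * g' x].
  elim: w => [|b w [f' [g' [fs' gs' e]]]]; first by exists f, g.
  rewrite /partials /= -/(partials w _) e; case: b.
    by exists (derive1 f'), g'; split; [exact: smooth_d | | exact: ptime_prod].
  by exists f', (derive1 g'); split; [| exact: smooth_d | exact: pspace_prod].
split=> [t x|z].
  split.
    by have [] := isdE (isdM (smooth_isd t fs') (is_derive_cst (g' x) t 1)).
  by have [] := isdE (isdZ (f' t) (smooth_isd x gs')).
apply: cvgM.
  apply: (@continuous_comp _ _ _ fst f'); first exact: cvg_fst.
  exact: smooth_cont.
apply: (@continuous_comp _ _ _ snd g'); first exact: cvg_snd.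
exact: smooth_cont.
Qed.

Lemma test_fun2_prod (T al be r : R) f g : 0 < al -> be < T ->
  smooth f -> (forall t, ~ (al <= t <= be) -> f t = 0) ->
  smooth g -> (forall x, ~ (- r <= x <= r) -> g x = 0) ->
  test_fun2 T (fun t x => f t * g x).
Proof.
move=> al0 beT fs f0 gs g0; split; first exact: smooth2_prod.
exists (`[al, be] `*` `[- r, r])%classic; split.
- by apply: compact_setX; exact: segment_compact.
- move=> [t x] [/=]; rewrite in_itv /= => /andP[h1 h2] _.
  by rewrite (lt_le_trans al0 h1) (le_lt_trans h2 beT).
- move=> t x h; have [ht|ht] := boolP (al <= t <= be); last first.
    by rewrite f0 ?mul0r//; apply/negP.
  rewrite g0 ?mulr0// => hx; apply: h; split; rewrite /= in_itv /=; [exact: ht | exact: hx].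
Qed.

Variables (T L : R) (a : R -> R) (u : R -> R -> R).
Hypotheses (L_gt0 : 0 < L) (u_sol : KdVB_solution T a u)
  (u_H1 : \forall t \ae mu, t \in `]0, T[ -> H1 (u t))
  (u_out : vanishes_on T (`]-oo, (- L)[ `|` `]L, +oo[) u).

(* [b] stands for [a] truncated outside the range of [u]. *)
Variables (b : R -> R) (Kb : R).
Hypotheses (b_cont : continuous b) (b_le : forall x, `|b x| <= Kb)
  (u_b : \forall t \ae mu, t \in `]0, T[ ->
     \forall x \ae mu, - L < x < L -> a (u t x) = b (u t x)).

Let D : set R := `]- L, L[%classic.
Let I : set R := `]0, T[%classic.

(** Once [phi] is an exponential mode, these are the coefficients of the weighted
    derivative and of the weighted nonlinear term. *)
Definition uxp (phi : R -> R) (t : R) : R :=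
  \int[mu]_(x in D) (wderiv (u t) x * phi x).
Definition nlp (phi : R -> R) (t : R) : R :=
  \int[mu]_(x in D) (b (u t x) * wderiv (u t) x * phi x).

Let pair_u (psi phi chi : R -> R) : smooth phi ->
  (forall x, D x -> chi x = derive1 phi x) ->
  \int[mu]_(t in I) \int[mu]_x (u t x * (psi t * chi x)) =
  \int[mu]_(t in I) - (psi t * uxp phi t).
Proof.
move=> phis chiE; apply: Rint_ae; apply: (aeS2 _ u_H1 u_out) => t ut ot tI.
have {}ut := ut tI; have {}ot := ot tI.
rewrite (Rint_setT_sub (D := D)); last first.
  by apply: (aeS _ (vanish_outD ot)) => x h /h ->; rewrite mul0r.
have mD : @measurable _ (measurableTypeR R) D by exact: measurable_itv.
transitivity (psi t * \int[mu]_(x in D) (u t x * derive1 phi x)).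
  rewrite -RintZ//; first by apply: Rint_ext => x Dx; rewrite chiE//; ring.
  have [M _ hM] := cont_bounded (- L) L (smooth_cont (smooth_d phis)).
  apply: (@intbMb _ _ _ _ M) => //.
  - by apply: smooth_meas => //; exact: smooth_d.
  - by move=> x; rewrite /D /= in_itv /= => /andP[? ?]; apply: hM; rewrite !ltW.
  - apply: sq_intb => //; first exact: mu_oo_fin.
    by apply: (@sqS _ _ setT) => //; apply: sq_L2; case: ut.
by rewrite (wderiv_local L_gt0 ut ot phis) mulrN.
Qed.

(** The equation paired with psi(t) phi'(x): one derivative of [phi] is spent on
    turning [u] into its spatial derivative. *)
Lemma weak_equation (al be : R) (psi phi : R -> R) : 0 < al -> be < T ->
  smooth psi -> (forall t, ~ (al <= t <= be) -> psi t = 0) -> smooth phi ->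
  \int[mu]_(t in I) - (derive1 psi t * uxp phi t)
  + \int[mu]_(t in I) - (psi t * uxp (derive1n 2 phi) t)
  + \int[mu]_(t in I) - (psi t * uxp (derive1n 3 phi) t)
  = \int[mu]_(t in I) (psi t * nlp (derive1 phi) t).
Proof.
move=> al0 beT psis psi0 phis.
pose chi x := derive1 phi x * cutoff L x.
have phis' : smooth (derive1 phi) by exact: smooth_d.
have chis : smooth chi by apply: smoothM => //; exact: cutoff_smooth.
have chi0 x : ~ (- (L + 2) <= x <= L + 2) -> chi x = 0.
  move=> h; rewrite /chi /cutoff plateau_out ?mulr0//.
  by apply: contra_not h => /andP[? ?]; rewrite !ltW.
have chiE n x : D x -> derive1n n chi x = derive1n n.+1 phi x.
  by move=> Dx; rewrite (cutoff_derive _ _ (D_inside Dx)) /derive1n [in RHS]iterSr.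
have key (d0 d2 d3 d4 : R) : - d0 - - - d2 + - - - d3 + d4 = 0 ->
  d0 + d2 + d3 = d4 by lra.
have /key := u_sol (test_fun2_prod al0 beT psis psi0 chis chi0).
rewrite ptime_prod// !pspace_prod//; [|by do ?apply: smooth_d..].
rewrite /regular_distr.
have phis2 : smooth (derive1n 2 phi) by do 2 apply: smooth_d.
have phis3 : smooth (derive1n 3 phi) by apply: smooth_d.
have e0 := pair_u (derive1 psi) phis (chiE 0%N).
have e2 := pair_u psi phis2 (chiE 2%N).
have e3 := pair_u psi phis3 (chiE 3%N).
have sub (x0 x2 x3 y0 y2 y3 n : R) : x0 = y0 -> x2 = y2 -> x3 = y3 ->
  x0 + x2 + x3 = n -> y0 + y2 + y3 = n by move=> -> -> ->.
move=> /(sub _ _ _ _ _ _ _ e0 e2 e3) ->.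
apply: Rint_ae; apply: (aeS2 _ (aeI u_H1 u_b) u_out) => t [ut bt] ot tI.
  have {}ut := ut tI; have {}ot := ot tI; have {}bt := bt tI.
  have mD : @measurable _ (measurableTypeR R) D by exact: measurable_itv.
  rewrite (Rint_setT_sub (D := D)); last first.
    apply: (aeS _ (vanish_outD (wderiv_vanish L_gt0 ut ot))) => x h /h ->.
    by rewrite mulr0 mul0r.
  have su : sq D (u t) by apply: (@sqS _ _ setT) => //; apply: sq_L2; case: ut.
  have [M _ hM] := cont_bounded (- L) L (smooth_cont phis').
  rewrite -RintZ//; last first.
    apply: (@intbMb _ _ _ _ M) => //; first exact: smooth_meas.
      by move=> x; rewrite /D /= in_itv /= => /andP[? ?]; apply: hM; rewrite !ltW.
    apply: (@intb_ext _ _ (fun x => wderiv (u t) x * b (u t x))).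
      by move=> x; rewrite mulrC.
    apply: (@intbMb _ _ _ _ Kb) => //.
      apply: measurableT_comp; first exact: continuous_measurable_fun.
      by case: su.
    apply: sq_intb => //; [exact: mu_oo_fin | exact: wderiv_sq].
  apply: Rint_ae; apply: (aeS _ bt) => x bx Dx.
  rewrite bx; last by move: Dx; rewrite /D /= in_itv.
  have -> : chi x = derive1 phi x := chiE 0%N x Dx.
  by ring.
Qed.

End WeakEquation.

(** * The estimate in time *)

Section TimeEstimate.
Context {R : realType}.
Local Notation mu := (@lebesgue_measure R).

Lemma energy_mono (A B : R) (f : R -> R) m n : A < B -> (m <= n)%N ->
  energy A B f m <= energy A B f n.
Proof.
move=> AB /subnK <-; elim: (n - m)%N => [//|k IH]; rewrite addSn energyS.
rewrite (le_trans IH)// lerDl mulr_ge0//; first exact/ltW/wt_gt0.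
by rewrite addr_ge0 ?sqr_ge0.
Qed.

Lemma parseval2 (A B M : R) (f g : R -> R) : A < B -> sq `]A, B[ f -> sq `]A, B[ g ->
  (forall n, energy A B f n + energy A B g n <= M) ->
  \int[mu]_(x in `]A, B[) (f x ^+ 2) + \int[mu]_(x in `]A, B[) (g x ^+ 2) <= M.
Proof.
move=> AB sf sg fg; rewrite -lerBrDl; apply: parseval => // n.
rewrite lerBrDl -lerBrDr; apply: parseval => // m.
rewrite lerBrDr; apply: le_trans (fg (maxn m n)).
by apply: lerD; apply: energy_mono => //; rewrite ?leq_maxl ?leq_maxr.
Qed.

Variable T : R.
Hypothesis T_gt0 : 0 < T.
Let I : set R := `]0, T[%classic.
Let mI : measurable I. Proof. exact: measurable_itv. Qed.
Let finI : (mu I < +oo)%E. Proof. exact: mu_oo_fin. Qed.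
Let w := freq 0 T.

Let fcP (f g : R -> R) c k : intb I f -> intb I g ->
  fc 0 T (fun t => f t + c * g t) k = fc 0 T f k + c * fc 0 T g k /\
  fs 0 T (fun t => f t + c * g t) k = fs 0 T f k + c * fs 0 T g k.
Proof.
move=> fi gi.
have e (h : R -> R) : smooth h -> (forall x, `|h x| <= 1) ->
    \int[mu]_(t in I) ((f t + c * g t) * h t) =
    \int[mu]_(t in I) (f t * h t) + c * \int[mu]_(t in I) (g t * h t).
  move=> hs h1; have mh : measurable_fun I h by exact: smooth_meas.
  have fhi : intb I (fun t => f t * h t) by apply: (@intbMb _ _ _ _ 1).
  have ghi : intb I (fun t => g t * h t) by apply: (@intbMb _ _ _ _ 1).
  rewrite -RintZ// -(RintD mI fhi (intbZ c mI ghi)).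
  by apply: Rint_ext => t _; ring.
split; apply: e; [exact: smooth_cs|exact: cs_le1|exact: smooth_sn|exact: sn_le1].
Qed.

Variables (P Q G1 G2 : R -> R) (M : R).
Hypotheses (mP : measurable_fun I P) (mQ : measurable_fun I Q)
  (mG1 : measurable_fun I G1) (mG2 : measurable_fun I G2)
  (bP : forall t, I t -> `|P t| <= M) (bQ : forall t, I t -> `|Q t| <= M)
  (bG1 : forall t, I t -> `|G1 t| <= M) (bG2 : forall t, I t -> `|G2 t| <= M).
Variables (rho : R -> R) (s o l x : R).
Hypothesis rho_smooth : smooth rho.
Hypotheses
  (E1 : forall h, smooth h -> let psi := fun t => rho t * h t in
    \int[mu]_(t in I) (derive1 psi t * P t + psi t * (s * P t - o * Q t)
       + psi t * (l * G1 t - x * G2 t)) = 0)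
  (E2 : forall h, smooth h -> let psi := fun t => rho t * h t in
    \int[mu]_(t in I) (derive1 psi t * Q t + psi t * (s * Q t + o * P t)
       + psi t * (l * G2 t + x * G1 t)) = 0).

Let sqm (f g : R -> R) : smooth f -> measurable_fun I g ->
  (forall t, I t -> `|g t| <= M) -> sq I (fun t => f t * g t).
Proof.
move=> fs mg gM; have [K K0 hK] := cont_bounded 0 T (smooth_cont fs).
apply: (@sq_bounded _ _ _ (K * M)) => //.
  by apply: measurable_funM => //; exact: smooth_meas.
move=> t It; rewrite normrM ler_pM// ?gM// hK//.
by move: It; rewrite /I /= in_itv /= => /andP[? ?]; rewrite !ltW.
Qed.

Let rP t := rho t * P t.
Let rQ t := rho t * Q t.
Let H1 t := derive1 rho t * P t + rho t * (l * G1 t - x * G2 t).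
Let H2 t := derive1 rho t * Q t + rho t * (l * G2 t + x * G1 t).

Let sqP : sq I rP. Proof. exact: sqm. Qed.
Let sqQ : sq I rQ. Proof. exact: sqm. Qed.
Let rs' : smooth (derive1 rho). Proof. exact: smooth_d. Qed.

Let sqH1 : sq I H1.
Proof.
apply: sqD => //; first exact: sqm.
have e t : l * (rho t * G1 t) - x * (rho t * G2 t) = rho t * (l * G1 t - x * G2 t) by ring.
by rewrite -(funext e); apply: sqB => //; apply: sqZ => //; exact: sqm.
Qed.

Let sqH2 : sq I H2.
Proof.
apply: sqD => //; first exact: sqm.
have e t : l * (rho t * G2 t) + x * (rho t * G1 t) = rho t * (l * G2 t + x * G1 t) by ring.
by rewrite -(funext e); apply: sqD => //; apply: sqZ => //; exact: sqm.
Qed.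

Let dpsi (h h' : R -> R) t : smooth h -> derive1 h = h' ->
  derive1 (fun t => rho t * h t) t = derive1 rho t * h t + rho t * h' t.
Proof.
move=> hs <-; by have [_ ->] := isdE (isdM (smooth_isd t rho_smooth) (smooth_isd t hs)).
Qed.

(** The coefficients, at the frequency [tau] in time, of an equation
    X' = s X + o' Y + H in weak form. *)
Let coef (X Y H : R -> R) (o' : R) k : sq I X -> sq I Y -> sq I H ->
  (forall (h h' : R -> R), smooth h -> derive1 h = h' ->
    \int[mu]_(t in I) ((H t + s * X t + o' * Y t) * h t + X t * h' t) = 0) ->
  let tau := k%:R * w in
  fc 0 T H k + s * fc 0 T X k + o' * fc 0 T Y k - tau * fs 0 T X k = 0 /\
  fs 0 T H k + s * fs 0 T X k + o' * fs 0 T Y k + tau * fc 0 T X k = 0.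
Proof.
move=> sX sY sH E /=.
have iX : intb I X by exact: sq_intb. have iY : intb I Y by exact: sq_intb.
have iH : intb I H by exact: sq_intb.
have iHX : intb I (fun t => H t + s * X t) by apply: intbD => //; exact: intbZ.
have iF : intb I (fun t => H t + s * X t + o' * Y t) by apply: intbD => //; exact: intbZ.
have [c1 s1] := fcP o' k iHX iY; have [c2 s2] := fcP s k iH iX.
have iM (f h : R -> R) : intb I f -> smooth h -> (forall x, `|h x| <= 1) -> intb I (fun t => f t * h t).
  by move=> fi hs h1; apply: (@intbMb _ _ _ _ 1) => //; exact: smooth_meas.
have sc := smooth_cs 0 T k; have ss := smooth_sn 0 T k.
have ic f : intb I f -> intb I (fun t => f t * cs 0 T k t).
  by move=> fi; apply: iM => //; exact: cs_le1.
have is_ f : intb I f -> intb I (fun t => f t * sn 0 T k t).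
  by move=> fi; apply: iM => //; exact: sn_le1.
split.
  rewrite -c2 -c1 -[RHS](E _ _ sc (isd_funE (cs_isd 0 T k))) -mulNr /fc /fs.
  rewrite -(RintZ (- (k%:R * w)) mI (is_ _ iX)) -(RintD mI (ic _ iF)); last first.
    by apply: intbZ => //; exact: is_.
  by apply: Rint_ext => t _; rewrite /w; ring.
rewrite -s2 -s1 -[RHS](E _ _ ss (isd_funE (sn_isd 0 T k))) /fc /fs.
rewrite -(RintZ (k%:R * w) mI (ic _ iX)) -(RintD mI (is_ _ iF)); last first.
  by apply: intbZ => //; exact: ic.
by apply: Rint_ext => t _; rewrite /w; ring.
Qed.

(** The system for the coefficients of [rP] and [rQ] has a matrix that is [s]
    plus an antisymmetric one, so it dilates norms by at least |s|. *)
Let coef_le k :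
  s ^+ 2 * (fc 0 T rP k ^+ 2 + fs 0 T rP k ^+ 2 + (fc 0 T rQ k ^+ 2 + fs 0 T rQ k ^+ 2)) <=
  fc 0 T H1 k ^+ 2 + fs 0 T H1 k ^+ 2 + (fc 0 T H2 k ^+ 2 + fs 0 T H2 k ^+ 2).
Proof.
have [|c1 s1] := @coef rP rQ H1 (- o) k sqP sqQ sqH1.
  move=> h h' hs hE.
  rewrite -[RHS](E1 hs); apply: Rint_ext => t _.
  by rewrite (dpsi t hs hE) /H1 /rP /rQ; ring.
have [|c2 s2] := @coef rQ rP H2 o k sqQ sqP sqH2.
  move=> h h' hs hE.
  rewrite -[RHS](E2 hs); apply: Rint_ext => t _.
  by rewrite (dpsi t hs hE) /H2 /rP /rQ; ring.
move: c1 s1 c2 s2; set tau := k%:R * w.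
move: (fc 0 T rP k) (fs 0 T rP k) (fc 0 T rQ k) (fs 0 T rQ k) => a b c d.
move: (fc 0 T H1 k) (fs 0 T H1 k) (fc 0 T H2 k) (fs 0 T H2 k) => r1 r2 r3 r4.
move=> c1 s1 c2 s2.
have -> : r1 = tau * b - s * a + o * c by lra.
have -> : r2 = - tau * a - s * b + o * d by lra.
have -> : r3 = tau * d - s * c - o * a by lra.
have -> : r4 = - tau * c - s * d - o * b by lra.
rewrite -subr_ge0.
have -> : (tau * b - s * a + o * c) ^+ 2 + (- tau * a - s * b + o * d) ^+ 2 +
  ((tau * d - s * c - o * a) ^+ 2 + (- tau * c - s * d - o * b) ^+ 2) -
  s ^+ 2 * (a ^+ 2 + b ^+ 2 + (c ^+ 2 + d ^+ 2)) =
  (tau * b + o * c) ^+ 2 + (- tau * a + o * d) ^+ 2 +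
  ((tau * d - o * a) ^+ 2 + (- tau * c - o * b) ^+ 2) by ring.
by rewrite !addr_ge0 ?sqr_ge0.
Qed.

(** Away from the zeros of [s] the system is elliptic in time, uniformly in its
    antisymmetric part [o]. *)
Lemma time_estimate :
  s ^+ 2 * \int[mu]_(t in I) (rho t ^+ 2 * (P t ^+ 2 + Q t ^+ 2)) <=
  2 * \int[mu]_(t in I) (derive1 rho t ^+ 2 * (P t ^+ 2 + Q t ^+ 2)) +
  2 * (l ^+ 2 + x ^+ 2) * \int[mu]_(t in I) (rho t ^+ 2 * (G1 t ^+ 2 + G2 t ^+ 2)).
Proof.
have iz (f g : R -> R) : sq I f -> sq I g -> intb I (fun t => f t ^+ 2 + g t ^+ 2).
  by move=> [_ fi] [_ gi]; exact: intbD.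
have step1 : \int[mu]_(t in I) ((s * rP t) ^+ 2) + \int[mu]_(t in I) ((s * rQ t) ^+ 2)
    <= \int[mu]_(t in I) (H1 t ^+ 2) + \int[mu]_(t in I) (H2 t ^+ 2).
  apply: parseval2 => //; [exact: sqZ.. |] => n.
  apply: (@le_trans _ _ (energy 0 T H1 n + energy 0 T H2 n)); last first.
    by apply: lerD; apply: bessel.
  rewrite /energy -!big_split; apply: ler_sum => k _ /=; rewrite -!mulrDr.
  apply: ler_wpM2l; first exact/ltW/wt_gt0.
  have z0 : intb I (fun=> 0) by exact: integrable0.
  have zc (f : R -> R) : intb I f -> fc 0 T (fun t => s * f t) k = s * fc 0 T f k /\
      fs 0 T (fun t => s * f t) k = s * fs 0 T f k.
    move=> fi; have [h1 h2] := fcP s k z0 fi.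
    have e : (fun t => s * f t) = (fun t => 0 + s * f t).
      by apply/funext => t; rewrite add0r.
    rewrite e h1 h2; split; rewrite -[RHS]add0r; congr (_ + _);
      by rewrite -[RHS](Rint0 I); apply: Rint_ext => t _; rewrite mul0r.
  have [-> ->] := zc _ (sq_intb mI finI sqP).
  have [-> ->] := zc _ (sq_intb mI finI sqQ).
  by apply: le_trans (coef_le k); rewrite le_eqVlt; apply/orP; left; apply/eqP; ring.
have -> : s ^+ 2 * \int[mu]_(t in I) (rho t ^+ 2 * (P t ^+ 2 + Q t ^+ 2)) =
    \int[mu]_(t in I) ((s * rP t) ^+ 2) + \int[mu]_(t in I) ((s * rQ t) ^+ 2).
  have [_ i1] := sqZ s mI sqP; have [_ i2] := sqZ s mI sqQ.
  rewrite -(RintD mI i1 i2) -RintZ//.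
    by apply: Rint_ext => t _; rewrite /rP /rQ; ring.
  by apply: intb_ext (iz _ _ sqP sqQ) => t; rewrite /rP /rQ; ring.
apply: (le_trans step1).
have sr1 := sqm rs' mP bP; have sr2 := sqm rs' mQ bQ.
have sg1 := sqm rho_smooth mG1 bG1; have sg2 := sqm rho_smooth mG2 bG2.
have i1 := iz _ _ sr1 sr2; have i2 := iz _ _ sg1 sg2.
have -> : \int[mu]_(t in I) (derive1 rho t ^+ 2 * (P t ^+ 2 + Q t ^+ 2)) =
    \int[mu]_(t in I) ((derive1 rho t * P t) ^+ 2 + (derive1 rho t * Q t) ^+ 2).
  by apply: Rint_ext => t _; ring.
have -> : \int[mu]_(t in I) (rho t ^+ 2 * (G1 t ^+ 2 + G2 t ^+ 2)) =
    \int[mu]_(t in I) ((rho t * G1 t) ^+ 2 + (rho t * G2 t) ^+ 2).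
  by apply: Rint_ext => t _; ring.
have [_ h1] := sqH1; have [_ h2] := sqH2.
rewrite -(RintD mI h1 h2) -(RintZ _ mI i1) -(RintZ _ mI i2).
rewrite -(RintD mI (intbZ _ mI i1) (intbZ _ mI i2)).
apply: Rint_le => //; [exact: intbD | by apply: intbD => //; exact: intbZ |].
move=> t _; rewrite /H1 /H2.
set p := derive1 rho t * P t; set q := derive1 rho t * Q t.
set r := rho t; set g1 := G1 t; set g2 := G2 t.
have := sqr_ge0 (p - r * (l * g1 - x * g2)).
have := sqr_ge0 (q - r * (l * g2 + x * g1)).
rewrite -subr_ge0 => h3 h4; rewrite -subr_ge0.
have -> : 2 * (p ^+ 2 + q ^+ 2) + 2 * (l ^+ 2 + x ^+ 2) * ((r * g1) ^+ 2 + (r * g2) ^+ 2) -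
  ((p + r * (l * g1 - x * g2)) ^+ 2 + (q + r * (l * g2 + x * g1)) ^+ 2) =
  (p - r * (l * g1 - x * g2)) ^+ 2 + (q - r * (l * g2 + x * g1)) ^+ 2 by ring.
by rewrite addr_ge0 ?sqr_ge0.
Qed.

End TimeEstimate.

(** * Exponential modes, frequencies and weights *)

Section Modes.
Context {R : realType}.

Variables (L l : R) (k : nat).
Let xi : R := k%:R * freq (- L) L.

(** Real and imaginary parts of exp((l + i xi) x). *)
Definition ec (x : R) : R := expR (l * x) * cs (- L) L k x.
Definition es (x : R) : R := expR (l * x) * sn (- L) L k x.

Let expl_isd (x : R) : is_derive x (1 : R) (fun y => expR (l * y)) (l * expR (l * x)).
Proof.
apply: isd_eq (isd_comp (is_derive_expR _) (isdZ l (is_derive_id _ _))) _.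
by rewrite mulr1 mulrC.
Qed.

Let ec_isd (x : R) : is_derive x (1 : R) ec (l * ec x - xi * es x).
Proof.
by apply: isd_eq (isdM (expl_isd x) (cs_isd _ _ k x)) _; rewrite /ec /es /xi; ring.
Qed.

Let es_isd (x : R) : is_derive x (1 : R) es (l * es x + xi * ec x).
Proof.
by apply: isd_eq (isdM (expl_isd x) (sn_isd _ _ k x)) _; rewrite /ec /es /xi; ring.
Qed.

Let smooth_expl : smooth (fun x : R => expR (l * x)).
Proof.
apply: (smooth_comp smooth_expR).
by apply: smoothM; [exact: smooth_cst | exact: smooth_id].
Qed.

Lemma smooth_ec : smooth ec.
Proof. by apply: smoothM; [exact: smooth_expl | exact: smooth_cs]. Qed.

Lemma smooth_es : smooth es.
Proof. by apply: smoothM; [exact: smooth_expl | exact: smooth_sn]. Qed.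

Let lin_d (c d : R) : derive1 (fun x => c * ec x + d * es x) =
  fun x => (l * c + xi * d) * ec x + (l * d - xi * c) * es x.
Proof.
apply: isd_funE => x; apply: isd_eq (isdD (isdZ c (ec_isd x)) (isdZ d (es_isd x))) _.
ring.
Qed.

(** Real and imaginary parts of zeta^2 + zeta^3, for zeta = l + i xi: the
    factor by which the operator d^2 + d^3, acting on test functions, multiplies
    exp(zeta x). *)
Definition symb_re : R := l ^+ 2 - xi ^+ 2 + l ^+ 3 - 3 * l * xi ^+ 2.
Definition symb_im : R := 2 * l * xi + 3 * l ^+ 2 * xi - xi ^+ 3.

Let ecE : ec = fun x => 1 * ec x + 0 * es x.
Proof. by apply/funext => x; ring. Qed.
Let esE : es = fun x => 0 * ec x + 1 * es x.
Proof. by apply/funext => x; ring. Qed.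

Lemma ec_d x : derive1 ec x = l * ec x - xi * es x.
Proof. by rewrite {1}ecE lin_d; ring. Qed.

Lemma es_d x : derive1 es x = l * es x + xi * ec x.
Proof. by rewrite {1}esE lin_d; ring. Qed.

Lemma ec_d2 x : derive1n 2 ec x =
  (l ^+ 2 - xi ^+ 2) * ec x - (2 * l * xi) * es x.
Proof. by rewrite /derive1n /= {1}ecE !lin_d; ring. Qed.

Lemma ec_d3 x : derive1n 3 ec x =
  (l ^+ 3 - 3 * l * xi ^+ 2) * ec x - (3 * l ^+ 2 * xi - xi ^+ 3) * es x.
Proof. by rewrite /derive1n /= {1}ecE !lin_d; ring. Qed.

Lemma es_d2 x : derive1n 2 es x =
  (l ^+ 2 - xi ^+ 2) * es x + (2 * l * xi) * ec x.
Proof. by rewrite /derive1n /= {1}esE !lin_d; ring. Qed.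

Lemma es_d3 x : derive1n 3 es x =
  (l ^+ 3 - 3 * l * xi ^+ 2) * es x + (3 * l ^+ 2 * xi - xi ^+ 3) * ec x.
Proof. by rewrite /derive1n /= {1}esE !lin_d; ring. Qed.

End Modes.

Section Frequencies.
Context {R : realType}.

(** The exponent [l] can be taken arbitrarily large with the zeros of the real
    part of zeta^2 + zeta^3 halfway between two consecutive frequencies. There
    this polynomial in xi has slope of order l^2, which makes it larger, at every
    frequency, than any prescribed multiple of |zeta|. Since the zeros are at
    about (l + 1/3) / sqrt 3, this is the value to place. *)
Lemma frequency_choice (L K l0 : R) : 0 < L -> 0 < K -> exists2 l, l0 <= l &
  forall k, K ^+ 2 * (l ^+ 2 + (k%:R * freq (- L) L) ^+ 2) <= symb_re L l k ^+ 2.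
Proof.
move=> L0 K0; set nu := freq (- L) L.
have nu0 : 0 < nu.
  by rewrite /nu /freq divr_gt0 ?mulr_gt0 ?pi_gt0// opprK addr_gt0.
pose q : R := Num.sqrt 3; have q2 : q ^+ 2 = 3 by rewrite sqr_sqrtr.
have q0 : 0 <= q by exact: sqrtr_ge0.
have q1 : 1 <= q.
  by rewrite -(@ler_pXn2r _ 2%N)// ?nnegrE// q2 expr1n; lra.
pose X := `|l0| + 2 + nu^-1 + 2 * K / nu.
have inu : 0 < nu^-1 by rewrite invr_gt0.
have Kn : 0 < 2 * K / nu by rewrite divr_gt0// mulr_gt0.
have [n nX] : exists n : nat, X <= nu * (n%:R + 2^-1).
  exists (Num.bound (X / nu)).
  have := archi_boundP (normr_ge0 (X / nu)); rewrite /Num.bound normr_id.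
  set m := (Num.bound _)%:R; move=> /ltW h.
  have h2 : X / nu <= m by rewrite (le_trans (ler_norm _)).
  rewrite -ler_pdivrMl// mulrC (le_trans h2)// lerDl.
  by rewrite invr_ge0.
set y := nu * (n%:R + 2^-1) in nX *.
have l0n := normr_ge0 l0; have l0l := ler_norm l0.
have y2 : 2 <= y by rewrite /X in nX; lra.
have ynu : 1 <= nu * y.
  have : nu * nu^-1 <= nu * y by rewrite ler_pM2l//; rewrite /X in nX; lra.
  by rewrite mulfV ?gt_eqF.
have yK : 2 * K <= nu * y.
  have : nu * (2 * K / nu) <= nu * y by rewrite ler_pM2l//; rewrite /X in nX; lra.
  by rewrite mulrC divfK ?gt_eqF.
pose c := q * y; have c2 : c ^+ 2 = 3 * y ^+ 2 by rewrite exprMn q2.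
have yc : y <= c by rewrite ler_peMl//; lra.
exists (c - 3^-1); first by rewrite /X in nX; lra.
move=> k; rewrite /symb_re -/nu; set xi := k%:R * nu.
have xi0 : 0 <= xi by rewrite mulr_ge0// ltW.
set s := (X in _ <= X ^+ 2).
have sE : s = 3 * c * (y ^+ 2 - xi ^+ 2) - c / 3 + 2 / 27.
  have -> : y ^+ 2 = c ^+ 2 / 3 by rewrite c2; field.
  by rewrite /s; field.
have c0 : 0 < c by lra.
have gap : (y + xi) * (c * nu) <= `|s|.
  have d : nu / 2 <= `|y - xi|.
    have -> : y - xi = nu * (n%:R + 2^-1 - k%:R) by rewrite /y /xi; ring.
    rewrite normrM (gtr0_norm nu0) ler_pM2l// ler_normr.
    have [kn|kn] := leqP k n; apply/orP; [left | right].
      by move: kn; rewrite -(ler_nat R); lra.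
    by move: kn; rewrite -(ler_nat R) -natr1; lra.
  have h : nu / 2 * (y + xi) <= `|y ^+ 2 - xi ^+ 2|.
    have yxi : 0 <= y + xi by rewrite addr_ge0//; lra.
    have -> : y ^+ 2 - xi ^+ 2 = (y - xi) * (y + xi) by ring.
    by rewrite normrM (ger0_norm yxi) ler_wpM2r.
  have {}h : c * (nu / 2 * (y + xi)) <= c * `|y ^+ 2 - xi ^+ 2| by rewrite ler_pM2l.
  have sge : 3 * (c * `|y ^+ 2 - xi ^+ 2|) <= `|s| + c / 3.
    have sa := ler_norm s; have := ler_norm (- s); rewrite normrN.
    move: sa; move: (`|s|) => S; rewrite sE.
    case: ger0P => _; move: (y ^+ 2 - xi ^+ 2) => W.
      by rewrite -[3 * c * W]mulrA; lra.
    by rewrite mulrN -[3 * c * W]mulrA; lra.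
  have h3 : c * 1 <= c * (nu * y) by rewrite ler_pM2l.
  have h4 : 0 <= c * (nu * xi) := mulr_ge0 (ltW c0) (mulr_ge0 (ltW nu0) xi0).
  have e2 : c * (nu / 2 * (y + xi)) = (c * (nu * y) + c * (nu * xi)) / 2 by field.
  have -> : (y + xi) * (c * nu) = c * (nu * y) + c * (nu * xi) by ring.
  by rewrite e2 in h; lra.
have z1 : (2 * K) * (y + xi) <= `|s|.
  apply: le_trans gap.
  rewrite mulrC ler_wpM2l//; first by rewrite addr_ge0//; lra.
  apply: (le_trans yK); rewrite mulrC ler_wpM2r// ltW//.
have z2 : (2 * K * (y + xi)) ^+ 2 <= s ^+ 2.
  rewrite -[leRHS]real_normK ?num_real// lerXn2r ?nnegrE//.
  by rewrite !mulr_ge0 ?(ltW K0)// addr_ge0//; lra.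
apply: le_trans z2.
have -> : (2 * K * (y + xi)) ^+ 2 = K ^+ 2 * (4 * (y + xi) ^+ 2) by ring.
rewrite ler_wpM2l ?sqr_ge0//.
have lc : (c - 3^-1) ^+ 2 <= c ^+ 2.
  by rewrite lerXn2r ?nnegrE//; lra.
apply: (le_trans (lerD lc (lexx _))); rewrite c2.
have : 0 <= y * xi by rewrite mulr_ge0//; lra.
have := sqr_ge0 y; have := sqr_ge0 xi; nra.
Qed.

End Frequencies.

Section Weight.
Context {R : realType}.
Variables (N al be : R).
Hypothesis N0 : 0 < N.

(** The weight exp(-N (1/(t - al) + 1/(be - t))), flat at both ends. *)
Definition rho (t : R) : R := flat ((t - al) / N) * flat ((be - t) / N).

Let left_isd (t : R) : is_derive t (1 : R) (fun t => (t - al) / N) N^-1.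
Proof.
have := isdM (isdD (is_derive_id t (1 : R)) (is_derive_cst (- al) t 1))
  (is_derive_cst N^-1 t 1).
by rewrite addr0 mul1r mulr0 addr0.
Qed.

Let right_isd (t : R) : is_derive t (1 : R) (fun t => (be - t) / N) (- N^-1).
Proof.
have := isdM (isdD (is_derive_cst be t 1) (isdZ (-1) (is_derive_id t (1 : R))))
  (is_derive_cst N^-1 t 1).
rewrite add0r mulr1 mulN1r mulr0 addr0.
by apply: isd_ext => y; rewrite mulN1r.
Qed.

Lemma smooth_rho : smooth rho.
Proof.
apply: smoothM; apply: (smooth_comp smooth_flat).
  have -> : (fun x => (x - al) / N) = (fun x => N^-1 * x + (- al / N)).
    by apply/funext => x; ring.
  exact: smooth_affine.
have -> : (fun x => (be - x) / N) = (fun x => - N^-1 * x + be / N).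
  by apply/funext => x; ring.
exact: smooth_affine.
Qed.

Lemma rho_out t : ~ (al <= t <= be) -> rho t = 0.
Proof.
move=> /negP; rewrite negb_and -!ltNge /rho => /orP[h|h].
  by rewrite flat_le0 ?mul0r// pmulr_lle0 ?invr_gt0// subr_le0 ltW.
by rewrite (@flat_le0 _ ((be - t) / N)) ?mulr0// pmulr_lle0 ?invr_gt0// subr_le0 ltW.
Qed.

Lemma rho_in (t : R) : al < t < be ->
  rho t = expR (- (N * ((t - al)^-1 + (be - t)^-1))).
Proof.
move=> /andP[h1 h2]; rewrite /rho !flatE !ifT ?divr_gt0 ?subr_gt0//.
by rewrite -expRD !invfM invrK; congr expR; ring.
Qed.

Let rho_d (t : R) : derive1 rho t =
  N^-1 * (flatm 2 ((t - al) / N) * flat ((be - t) / N) -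
          flat ((t - al) / N) * flatm 2 ((be - t) / N)).
Proof.
have h := isdM (isd_comp (flatm_isd 0 _) (left_isd t)) (isd_comp (flatm_isd 0 _) (right_isd t)).
by have [_ ->] := isdE h; rewrite !mul0r !subr0 /flat; ring.
Qed.

(** Where the weight is not small, its logarithmic derivative is at most of order
    [N]; the threshold [th] separates the two regimes. *)
Lemma rho_d_le (th t : R) : 1 <= N -> 0 <= th ->
  derive1 rho t ^+ 2 <= (N * th ^+ 2) ^+ 2 * rho t ^+ 2 +
    (2 * N * expR (- ((N - 1) * th))) ^+ 2.
Proof.
move=> N1 th0; rewrite rho_d.
have [tin|] := boolP (al < t < be); last first.
  rewrite negb_and -!leNgt => tout.
  have -> : N^-1 * (flatm 2 ((t - al) / N) * flat ((be - t) / N) -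
          flat ((t - al) / N) * flatm 2 ((be - t) / N)) = 0.
    case/orP: tout => h.
      have h0 : ((t - al) / N <= 0) by rewrite pmulr_lle0 ?invr_gt0// subr_le0.
      by rewrite /flat /flatm [0 < (t - al) / N]ltNge h0 /=; ring.
    have h0 : ((be - t) / N <= 0) by rewrite pmulr_lle0 ?invr_gt0// subr_le0.
    by rewrite /flat /flatm [0 < (be - t) / N]ltNge h0 /=; ring.
  by rewrite expr0n /= addr_ge0 ?sqr_ge0// mulr_ge0 ?sqr_ge0.
have /andP[t1 t2] := tin.
set r := rho t; have rE := rho_in tin.
pose a := (t - al)^-1; pose c := (be - t)^-1; pose y := a + c.
have a0 : 0 < a by rewrite invr_gt0 subr_gt0.
have c0 : 0 < c by rewrite invr_gt0 subr_gt0.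
have x0 : 0 < (t - al) / N by rewrite divr_gt0// subr_gt0.
have y0 : 0 < (be - t) / N by rewrite divr_gt0// subr_gt0.
have -> : N^-1 * (flatm 2 ((t - al) / N) * flat ((be - t) / N) -
          flat ((t - al) / N) * flatm 2 ((be - t) / N)) =
    N * (a ^+ 2 - c ^+ 2) * r.
  have f2 (z : R) : 0 < z -> flatm 2 z = z^-1 ^+ 2 * flat z.
    by move=> z0; rewrite /flat /flatm z0 expr0 mul1r.
  rewrite !f2// /r /rho !invfM !invrK -/a -/c.
  set F := flat _; set G := flat _; field; rewrite gt_eqF//.
have r0 : 0 <= r by rewrite /r rE expR_ge0.
have bnd : (N * (a ^+ 2 - c ^+ 2) * r) ^+ 2 <= (N * y ^+ 2 * r) ^+ 2.
  rewrite -[leLHS]real_normK ?num_real// lerXn2r ?nnegrE//.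
    exact: (mulr_ge0 (mulr_ge0 (ltW N0) (sqr_ge0 y)) r0).
  rewrite normrM (ger0_norm r0) ler_wpM2r// normrM (gtr0_norm N0) ler_pM2l//.
  have ac : 0 <= a * c by rewrite mulr_ge0 ?ltW.
  have := sqr_ge0 a; have := sqr_ge0 c; rewrite /y => h1 h2.
  by rewrite ler_norml; apply/andP; split; nra.
apply: (le_trans bnd).
have yy : 0 <= y by rewrite addr_ge0// ltW.
have [yth|thy] := leP y th.
  apply: (@le_trans _ _ ((N * th ^+ 2) ^+ 2 * r ^+ 2)); last by rewrite lerDl sqr_ge0.
  have p1 : 0 <= N * y ^+ 2 * r := mulr_ge0 (mulr_ge0 (ltW N0) (sqr_ge0 y)) r0.
  have p2 : 0 <= N * th ^+ 2 * r := mulr_ge0 (mulr_ge0 (ltW N0) (sqr_ge0 th)) r0.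
  have -> : (N * th ^+ 2) ^+ 2 * r ^+ 2 = (N * th ^+ 2 * r) ^+ 2 by ring.
  apply: lerXn2r; rewrite ?nnegrE//.
  by apply: ler_wpM2r => //; rewrite ler_pM2l//; apply: lerXn2r; rewrite ?nnegrE.
apply: (@le_trans _ _ ((2 * N * expR (- ((N - 1) * th))) ^+ 2)); last first.
  by rewrite lerDr mulr_ge0 ?sqr_ge0.
apply: lerXn2r; rewrite ?nnegrE.
- exact: (mulr_ge0 (mulr_ge0 (ltW N0) (sqr_ge0 y)) r0).
- by rewrite mulr_ge0 ?expR_ge0// mulr_ge0// ltW.
have -> : 2 * N * expR (- ((N - 1) * th)) = N * (2 * expR (- ((N - 1) * th))) by ring.
rewrite -mulrA ler_pM2l//.
have e2 : y ^+ 2 <= 2 * expR y.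
  have := @expR_ge1Dxn R y 1 yy; rewrite (_ : 2`!%:R = 2)//; lra.
have -> : r = expR (- y) * expR (- ((N - 1) * y)).
  by rewrite /r rE -expRD -/a -/c -/y; congr expR; ring.
rewrite mulrA; apply: ler_pM.
- by rewrite mulr_ge0 ?expR_ge0// sqr_ge0.
- exact: expR_ge0.
  by rewrite expRN ler_pdivrMr ?expR_gt0.
by rewrite ler_expR lerN2 ler_wpM2l ?(ltW thy)// subr_ge0.
Qed.

Lemma rho_ge (eta t : R) : 0 < eta -> al + eta <= t <= be - eta ->
  expR (- (N * (2 / eta))) <= rho t.
Proof.
move=> e0 /andP[h1 h2].
have tin : al < t < be by apply/andP; split; lra.
rewrite (rho_in tin) ler_expR lerN2 ler_pM2l//.
have -> : 2 / eta = eta^-1 + eta^-1 by ring.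
by apply: lerD; rewrite lef_pV2 ?posrE; lra.
Qed.

End Weight.

(** * The Carleman inequality *)

Section Carleman.
Context {R : realType}.
Local Notation mu := (@lebesgue_measure R).
Variables (T L Mu : R) (a b : R -> R) (Kb Kl : R) (u : R -> R -> R).
Hypotheses (T_gt0 : 0 < T) (L_gt0 : 0 < L) (u_LH1 : Linfty_H1 T u)
  (u_bound : \forall t \ae mu, t \in `]0, T[ -> H1norm (u t) <= Mu)
  (u_sol : KdVB_solution T a u)
  (u_out : vanishes_on T (`]-oo, (- L)[ `|` `]L, +oo[) u)
  (b_cont : continuous b) (b_le : forall x, `|b x| <= Kb)
  (b_lip : forall x y, `|b x - b y| <= Kl * `|x - y|)
  (u_b : \forall t \ae mu, t \in `]0, T[ ->
     \forall x \ae mu, - L < x < L -> a (u t x) = b (u t x)).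

Let D : set R := `]- L, L[%classic.
Let I : set R := `]0, T[%classic.
Let mD : measurable D. Proof. exact: measurable_itv. Qed.
Let finD : (mu D < +oo)%E. Proof. exact: mu_oo_fin. Qed.
Let mI : measurable I. Proof. exact: measurable_itv. Qed.
Let finI : (mu I < +oo)%E. Proof. exact: mu_oo_fin. Qed.

Definition good_time t : Prop :=
  [/\ H1 (u t), vanish_out L (u t) & H1norm (u t) <= Mu].

Lemma ae_good_time : \forall t \ae mu, t \in `]0, T[ -> good_time t.
Proof.
have [uH1 _ _] := u_LH1.
by apply: (aeS2 _ (aeI uH1 u_bound) u_out) => t [h1 h2] h3 tI; split;
  [exact: h1 | exact: h3 | exact: h2].
Qed.

Lemma good_sq t : good_time t -> sq D (wderiv (u t)) /\
  \int[mu]_(x in D) (wderiv (u t) x ^+ 2) <= Mu ^+ 2.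
Proof.
move=> [h1 h2 h3]; split; first exact: wderiv_sq.
rewrite (le_trans (H1norm_dL2 mD h1))// lerXn2r ?nnegrE ?sqrtr_ge0//.
by rewrite (le_trans _ h3)// sqrtr_ge0.
Qed.

Let mulrD : mu D = (2 * L)%:E.
Proof.
rewrite -[LHS]fineK; last by rewrite ge0_fin_numE.
rewrite mu_oo; last by rewrite (gt0_cp L_gt0).
by congr EFin; ring.
Qed.

Lemma good_L1 t : good_time t ->
  \int[mu]_(x in D) `|wderiv (u t) x| <= 2 * L + Mu ^+ 2.
Proof.
move=> /good_sq[s h]; have := Rint_L1_L2 mD finD s; rewrite mulrD /=.
set X := \int[mu]_(x in D) `|_|; set Y := \int[mu]_(x in D) _ in h *.
move=> XY; have L0 : 0 <= 2 * L by rewrite mulr_ge0// ltW.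
have M0 := sqr_ge0 Mu.
rewrite leNgt; apply/negP => hX.
have h1 : (2 * L + Mu ^+ 2) ^+ 2 < X ^+ 2.
  by rewrite ltrXn2r ?nnegrE ?addr_ge0// (le_trans _ (ltW hX))// addr_ge0.
have h2 : 2 * L * Y <= 2 * L * Mu ^+ 2 by rewrite ler_wpM2l.
have := mulr_ge0 L0 M0; have := sqr_ge0 (2 * L); have := sqr_ge0 (Mu ^+ 2).
move: XY h1 h2; rewrite sqrrD; lra.
Qed.

(** At almost all times the pairing is bounded by the norm of [u], so that its
    measurable version can be truncated. *)
Let rep (b' : R -> R) (Kb' Kl' : R) (phi : R -> R) : continuous b' ->
  (forall x, `|b' x| <= Kb') -> (forall x y, `|b' x - b' y| <= Kl' * `|x - y|) ->
  smooth phi -> exists ZC : (R -> R) * R,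
  [/\ measurable_fun setT ZC.1, forall t, `|ZC.1 t| <= ZC.2 &
      \forall t \ae mu, t \in `]0, T[ ->
        ZC.1 t = flux L b' phi (u t) (wderiv (u t))].
Proof.
move=> b'c b'le b'lip phis.
have [Kp Kp0 hK] := cont_bounded (- L) L (smooth_cont phis).
have phi_m : measurable_fun D phi by exact: smooth_meas.
have phi_le x : D x -> `|phi x| <= Kp.
  by rewrite /D /= in_itv /= => /andP[? ?]; apply: hK; rewrite !ltW.
have [Z mZ Zeq] := flux_meas L_gt0 b'c b'le b'lip phi_m phi_le u_LH1.
have Kb0 : 0 <= Kb' by exact: le_trans (b'le 0).
pose C := Kb' * Kp * (2 * L + Mu ^+ 2).
have C0 : 0 <= C.
  by rewrite !mulr_ge0// addr_ge0 ?sqr_ge0// mulr_ge0// ltW.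
exists (fun t => clip C (Z t), C); split.
- exact: clip_meas.
- by move=> t; exact: clip_le.
apply: (aeS2 _ Zeq ae_good_time) => t Zt gt tI /=.
rewrite Zt// clip_id//; have {}gt := gt tI.
have [su sq'] : sq setT (u t) /\ sq setT (wderiv (u t)).
  by have [h _ _] := gt; have [? ?] := wderiv_spec h; split; apply: sq_L2 => //; case: h.
have fi := flux_intb b'c b'le phi_m phi_le su sq'.
rewrite (le_trans (Rint_norm_le mD fi))//.
have wi : intb D (fun x => `|wderiv (u t) x|).
  apply: intb_norm => //; apply: sq_intb => //; by case: (good_sq gt).
apply: (@le_trans _ _ (Kb' * Kp * \int[mu]_(x in D) `|wderiv (u t) x|)); last first.
  by rewrite ler_wpM2l ?mulr_ge0// good_L1.
rewrite -RintZ//; apply: Rint_le => //; [exact: intb_norm | exact: intbZ |].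
move=> x Dx; rewrite !normrM mulrAC ler_wpM2r// ler_pM//; exact: phi_le.
Qed.

Let one_cont : continuous ((fun=> 1) : R -> R). Proof. by move=> x; exact: cvg_cst. Qed.
Let one_le (x : R) : `|(1 : R)| <= 1. Proof. by rewrite normr1. Qed.
Let one_lip (x y : R) : `|(1 : R) - 1| <= 0 * `|x - y|.
Proof. by rewrite subrr normr0 mul0r. Qed.

Let repU (phi : R -> R) : smooth phi -> exists ZC : (R -> R) * R,
  [/\ measurable_fun setT ZC.1, forall t, `|ZC.1 t| <= ZC.2 &
      \forall t \ae mu, t \in `]0, T[ -> ZC.1 t = uxp L u phi t].
Proof.
move=> phis; have [ZC [h1 h2 h3]] := rep one_cont one_le one_lip phis.
exists ZC; split=> //; apply: (aeS _ h3) => t h tI; rewrite h//.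
by apply: Rint_ext => x _; rewrite mul1r.
Qed.

Let repN (phi : R -> R) : smooth phi -> exists ZC : (R -> R) * R,
  [/\ measurable_fun setT ZC.1, forall t, `|ZC.1 t| <= ZC.2 &
      \forall t \ae mu, t \in `]0, T[ -> ZC.1 t = nlp L u b phi t].
Proof. exact: rep. Qed.

Section Exponent.
Variable l : R.

Definition wux t x : R := wderiv (u t) x * expR (l * x).
Definition wnorm t : R := \int[mu]_(x in D) (wux t x ^+ 2).

Let expl_smooth : smooth (fun x : R => expR (l * x)).
Proof.
apply: (smooth_comp smooth_expR).
by apply: smoothM; [exact: smooth_cst | exact: smooth_id].
Qed.

Let expl_bound (x : R) : D x -> `|expR (l * x)| <= expR (`|l| * L).
Proof.
rewrite /D /= in_itv /= => /andP[h1 h2].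
rewrite ger0_norm ?expR_ge0// ler_expR (le_trans (ler_norm _))// normrM.
by rewrite ler_wpM2l// ler_norml !ltW.
Qed.

Lemma wux_sq t : good_time t -> sq D (wux t).
Proof.
move=> /good_sq[s _]; apply: (@sqMb _ _ _ _ (expR (`|l| * L))) => //.
exact: smooth_meas.
Qed.

Lemma wnorm_le t : good_time t ->
  wnorm t <= expR (`|l| * L) ^+ 2 * \int[mu]_(x in D) (wderiv (u t) x ^+ 2).
Proof.
move=> gt; have [s _] := good_sq gt; rewrite -RintZ//; last by case: s.
apply: Rint_le => //; [by case: (wux_sq gt) | by apply: intbZ => //; case: s |].
move=> x Dx; rewrite /wux exprMn mulrC ler_wpM2r ?sqr_ge0//.
rewrite -[leLHS]real_normK ?num_real// lerXn2r ?nnegrE ?expR_ge0//.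
exact: expl_bound.
Qed.

Lemma wnorm_ge t : good_time t ->
  \int[mu]_(x in D) (wderiv (u t) x ^+ 2) <= expR (`|l| * L) ^+ 2 * wnorm t.
Proof.
move=> gt; have [s _] := good_sq gt; have [_ wi] := wux_sq gt.
rewrite -RintZ//; apply: Rint_le => //; [by case: s | exact: intbZ |].
move=> x Dx; rewrite /wux exprMn [_ ^+ 2 * _ ^+ 2 in leRHS]mulrC mulrA.
rewrite ler_peMl ?sqr_ge0// -exprMn -expRD exprn_ege1// -expR0 ler_expR.
have : `|l * x| <= `|l| * L.
  by rewrite normrM ler_wpM2l//; move: Dx; rewrite /D /= in_itv /= => /andP[? ?]; rewrite ler_norml !ltW.
by rewrite ler_norml => /andP[h _]; rewrite addrC -lerBlDr sub0r.
Qed.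

Let wux_fc t k : fc (- L) L (wux t) k = uxp L u (ec L l k) t.
Proof. by apply: Rint_ext => x _; rewrite /wux /ec; ring. Qed.

Let wux_fs t k : fs (- L) L (wux t) k = uxp L u (es L l k) t.
Proof. by apply: Rint_ext => x _; rewrite /wux /es; ring. Qed.

Let NL : - L < L. Proof. by rewrite (gt0_cp L_gt0). Qed.

Let wnorm_lim t : good_time t ->
  energy (- L) L (wux t) n @[n --> \oo] --> wnorm t.
Proof.
move=> gt; have s := wux_sq gt; apply/cvgrPdist_le => e e0.
have [n hn] : exists n, wnorm t - e < energy (- L) L (wux t) n.
  apply: contrapT => h; suff : wnorm t <= wnorm t - e.
    by rewrite -lerBDr opprK gerDl leNgt e0.
  apply: parseval => // n; rewrite leNgt; apply/negP => hn.
  by apply: h; exists n.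
exists n => // m /= nm; have h1 := bessel NL m s.
have h2 := energy_mono (wux t) NL nm.
rewrite ger0_norm ?subr_ge0//; rewrite /wnorm in hn *; lra.
Qed.

(** The norm is a limit of partial sums of squares of Fourier coefficients, which
    have measurable versions. Capping it at its a priori bound makes that bound
    hold at every time. *)
Lemma wnorm_meas : exists N : R -> R,
  [/\ measurable_fun setT N,
      forall t, 0 <= N t <= expR (`|l| * L) ^+ 2 * Mu ^+ 2 &
      \forall t \ae mu, t \in `]0, T[ -> N t = wnorm t].
Proof.
have [P hP] := choice (fun k => repU (smooth_ec L l k)).
have [Q hQ] := choice (fun k => repU (smooth_es L l k)).
pose Nn n t : R := \sum_(k < n) wt (- L) L k * ((P k).1 t ^+ 2 + (Q k).1 t ^+ 2).
have mN n : measurable_fun setT (Nn n).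
  apply: measurable_sum => k; apply: measurable_funM => //.
  by apply: measurable_funD; apply: measurable_funX; [case: (hP k) | case: (hQ k)].
pose C := expR (`|l| * L) ^+ 2 * Mu ^+ 2.
have C0 : 0 <= C by rewrite mulr_ge0 ?sqr_ge0.
exists (fun t => `|clip C (fine (limn_esup (fun n => (Nn n t)%:E)))|); split.
- apply: measurableT_comp; first exact: normr_measurable.
  apply: clip_meas; apply: (@measurableT_comp _ _ _ _ _ _ fine); first exact: fine_measurable.
  by apply: measurable_fun_limn_esup => n; exact/measurable_EFinP.
- by move=> t; rewrite normr_ge0 clip_le.
have aP : \forall t \ae mu, forall k, t \in `]0, T[ -> (P k).1 t = uxp L u (ec L l k) t.
  by apply: ae_all => k; case: (hP k).
have aQ : \forall t \ae mu, forall k, t \in `]0, T[ -> (Q k).1 t = uxp L u (es L l k) t.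
  by apply: ae_all => k; case: (hQ k).
apply: (aeS2 _ (aeI aP aQ) ae_good_time) => t [pt qt] gt tI; have {}gt := gt tI.
have NE n : Nn n t = energy (- L) L (wux t) n.
  by apply: eq_bigr => k _; rewrite pt// qt// -wux_fc -wux_fs.
have lim : (Nn n t)%:E @[n --> \oo] --> (wnorm t)%:E.
  apply: cvg_EFin; first exact: nearW.
  by rewrite (_ : _ \o _ = energy (- L) L (wux t)); [exact: wnorm_lim | apply/funext].
have w0 : 0 <= wnorm t by exact: Rint_sq_ge0.
rewrite /= (cvg_limn_einf_sup lim).2 /= clip_id ger0_norm//.
rewrite (le_trans (wnorm_le gt))//.
by rewrite ler_wpM2l ?sqr_ge0//; case: (good_sq gt).
Qed.

Variables (K : R).
Hypotheses (l_gt0 : 0 < l)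
  (freqP : forall k, K ^+ 2 * (l ^+ 2 + (k%:R * freq (- L) L) ^+ 2) <=
     symb_re L l k ^+ 2).
Variables (N : R -> R) (C : R).
Hypotheses (mN : measurable_fun setT N) (N_le : forall t, `|N t| <= C)
  (NE : \forall t \ae mu, t \in `]0, T[ -> N t = wnorm t).
Variables (r : R -> R) (al be : R).
Hypotheses (al0 : 0 < al) (beT : be < T) (rs : smooth r)
  (r_out : forall t, ~ (al <= t <= be) -> r t = 0).

Let pair_lin (v phi f g : R -> R) (c d : R) : intb D v -> smooth f -> smooth g ->
  (forall x, phi x = c * f x + d * g x) ->
  \int[mu]_(x in D) (v x * phi x) =
  c * \int[mu]_(x in D) (v x * f x) + d * \int[mu]_(x in D) (v x * g x).
Proof.
move=> vi fs gs e.
have im h : smooth h -> intb D (fun x => v x * h x).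
  move=> hs; have [K' _ hK] := cont_bounded (- L) L (smooth_cont hs).
  apply: (@intbMb _ _ _ _ K') => //; first exact: smooth_meas.
  by move=> x; rewrite /D /= in_itv /= => /andP[? ?]; apply: hK; rewrite !ltW.
rewrite -(Rint_lin _ _ mD (im f fs) (im g gs)).
by apply: Rint_ext => x _; rewrite e; ring.
Qed.

Let ux_intb t : good_time t -> intb D (wderiv (u t)).
Proof. by move=> /good_sq[? _]; exact: sq_intb. Qed.

Let nonlin_intb t : good_time t -> intb D (fun x => b (u t x) * wderiv (u t) x).
Proof.
move=> gt; have [h1 _ _] := gt.
apply: (@intb_ext _ _ (fun x => wderiv (u t) x * b (u t x))).
  by move=> x; rewrite mulrC.
apply: (@intbMb _ _ _ _ Kb) => //; last exact: ux_intb.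
apply: measurableT_comp; first exact: continuous_measurable_fun.
by apply: measurable_funTS; case: h1 => /sq_L2[].
Qed.

(** One equation of the real system that stands for Y' = (zeta^2 + zeta^3) Y +
    zeta G: [phi] and [chi] are the real and imaginary parts of exp(zeta x), in
    this order or the other, [X] and [Y] their pairings with u_x, and [G] and [H]
    those with the nonlinear term. *)
Let mode_equation (phi chi X Y G H : R -> R) (CX CY CG CH c2 d2 c3 d3 e1 e2 : R) :
  smooth phi -> smooth chi ->
  measurable_fun setT X -> measurable_fun setT Y ->
  measurable_fun setT G -> measurable_fun setT H ->
  (forall t, `|X t| <= CX) -> (forall t, `|Y t| <= CY) ->
  (forall t, `|G t| <= CG) -> (forall t, `|H t| <= CH) ->
  (\forall t \ae mu, t \in `]0, T[ -> X t = uxp L u phi t) ->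
  (\forall t \ae mu, t \in `]0, T[ -> Y t = uxp L u chi t) ->
  (\forall t \ae mu, t \in `]0, T[ -> G t = nlp L u b phi t) ->
  (\forall t \ae mu, t \in `]0, T[ -> H t = nlp L u b chi t) ->
  (forall x, derive1 phi x = e1 * phi x + e2 * chi x) ->
  (forall x, derive1n 2 phi x = c2 * phi x + d2 * chi x) ->
  (forall x, derive1n 3 phi x = c3 * phi x + d3 * chi x) ->
  forall h, smooth h -> let psi := fun t => r t * h t in
    \int[mu]_(t in I) (derive1 psi t * X t +
      psi t * ((c2 + c3) * X t + (d2 + d3) * Y t) +
      psi t * (e1 * G t + e2 * H t)) = 0.
Proof.
move=> phis chis mX mY mG mH bX bY bG bH aX aY aG aH E1 E2 E3 h hs psi.
have psis : smooth psi by exact: smoothM.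
have psi0 t : ~ (al <= t <= be) -> psi t = 0.
  by move=> /r_out e; rewrite /psi e mul0r.
have [uH1 _ _] := u_LH1.
have W := weak_equation L_gt0 u_sol uH1 u_out b_cont b_le u_b al0 beT psis psi0 phis.
have im (f g : R -> R) (c : R) : smooth f -> measurable_fun setT g ->
    (forall t, `|g t| <= c) -> intb I (fun t => f t * g t).
  move=> fs mg gc; have [K' K0' hK] := cont_bounded 0 T (smooth_cont fs).
  apply: (@intb_bounded _ _ _ (K' * c)) => //.
    by apply: measurable_funM; [exact: smooth_meas | exact: measurable_funTS].
  move=> t; rewrite /I /= in_itv /= => /andP[? ?].
  by rewrite normrM ler_pM// hK// !ltW.
have psis' : smooth (derive1 psi) by exact: smooth_d.
have iX := im _ _ _ psis mX bX; have iY := im _ _ _ psis mY bY.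
have iG := im _ _ _ psis mG bG; have iH := im _ _ _ psis mH bH.
have iX' := im _ _ _ psis' mX bX.
have w0 : \int[mu]_(t in I) - (derive1 psi t * uxp L u phi t) =
    - \int[mu]_(t in I) (derive1 psi t * X t).
  rewrite -RintN//; apply: Rint_ae; apply: (aeS _ aX) => t e tI.
  by rewrite e.
have lin (c d : R) F : (forall x, F x = c * phi x + d * chi x) ->
    \int[mu]_(t in I) - (psi t * uxp L u F t) =
    - c * \int[mu]_(t in I) (psi t * X t) + - d * \int[mu]_(t in I) (psi t * Y t).
  move=> FE.
  transitivity (\int[mu]_(t in I) (- c * (psi t * X t) + - d * (psi t * Y t))).
    apply: Rint_ae; apply: (aeS2 _ (aeI aX aY) ae_good_time) => t [e e'] gt tI.
    rewrite /uxp (pair_lin (ux_intb (gt tI)) phis chis FE).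
    by rewrite -/(uxp L u phi t) -/(uxp L u chi t) e// e'//; ring.
  exact: (Rint_lin (- c) (- d) mI iX iY).
have w1 : \int[mu]_(t in I) (psi t * nlp L u b (derive1 phi) t) =
    e1 * \int[mu]_(t in I) (psi t * G t) + e2 * \int[mu]_(t in I) (psi t * H t).
  transitivity (\int[mu]_(t in I) (e1 * (psi t * G t) + e2 * (psi t * H t))).
    apply: Rint_ae; apply: (aeS2 _ (aeI aG aH) ae_good_time) => t [e e'] gt tI.
    rewrite /nlp (pair_lin (nonlin_intb (gt tI)) phis chis E1).
    rewrite -/(nlp L u b phi t) -/(nlp L u b chi t).
    by rewrite e// e'//; ring.
  exact: (Rint_lin e1 e2 mI iG iH).
have sub (x0 x2 x3 y0 y2 y3 n m : R) : x0 = y0 -> x2 = y2 -> x3 = y3 -> n = m ->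
  x0 + x2 + x3 = n -> y0 + y2 + y3 = m by move=> -> -> -> ->.
have {W} := sub _ _ _ _ _ _ _ _ w0 (lin _ _ _ E2) (lin _ _ _ E3) w1 W.
have -> : \int[mu]_(t in I) (derive1 psi t * X t +
      psi t * ((c2 + c3) * X t + (d2 + d3) * Y t) + psi t * (e1 * G t + e2 * H t)) =
    \int[mu]_(t in I) (derive1 psi t * X t) +
    ((c2 + c3) * \int[mu]_(t in I) (psi t * X t) +
     (d2 + d3) * \int[mu]_(t in I) (psi t * Y t)) +
    (e1 * \int[mu]_(t in I) (psi t * G t) + e2 * \int[mu]_(t in I) (psi t * H t)).
  have j1 := intbD mI (intbZ (c2 + c3) mI iX) (intbZ (d2 + d3) mI iY).
  have j2 := intbD mI (intbZ e1 mI iG) (intbZ e2 mI iH).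
  transitivity (\int[mu]_(t in I) (derive1 psi t * X t +
      ((c2 + c3) * (psi t * X t) + (d2 + d3) * (psi t * Y t)) +
      (e1 * (psi t * G t) + e2 * (psi t * H t)))).
    by apply: Rint_ext => t _; ring.
  rewrite (RintD mI (intbD mI iX' j1) j2) (RintD mI iX' j1).
  by rewrite (Rint_lin _ _ mI iX iY) (Rint_lin _ _ mI iG iH).
move: (\int[mu]_(t in I) (derive1 psi t * X t)) => A0.
move: (\int[mu]_(t in I) (psi t * X t)) => A1.
move: (\int[mu]_(t in I) (psi t * Y t)) => A2.
move: (\int[mu]_(t in I) (psi t * G t)) => A3.
move: (\int[mu]_(t in I) (psi t * H t)) => A4 eq.
rewrite -eq; ring.
Qed.

(** Bessel's inequality; multiplication by [b u] is bounded by [Kb]. *)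
Let nonlin_energy t n : good_time t ->
  \sum_(k < n) wt (- L) L k * (nlp L u b (ec L l k) t ^+ 2 + nlp L u b (es L l k) t ^+ 2)
  <= Kb ^+ 2 * wnorm t.
Proof.
move=> gt; pose z x := wux t x * b (u t x).
have [h1 _ _] := gt; have s := wux_sq gt.
have mu_t : measurable_fun D (u t).
  by apply: measurable_funTS; case: h1 => /sq_L2[].
have sz : sq D z.
  apply: (@sqMb _ _ _ _ Kb) => //.
  by apply: measurableT_comp => //; exact: continuous_measurable_fun.
have -> : \sum_(k < n) wt (- L) L k * (nlp L u b (ec L l k) t ^+ 2 +
    nlp L u b (es L l k) t ^+ 2) = energy (- L) L z n.
  apply: eq_bigr => k _; congr (_ * (_ ^+ 2 + _ ^+ 2));
    by apply: Rint_ext => x _; rewrite /z /wux /ec /es; ring.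
apply: (le_trans (bessel NL n sz)); rewrite -RintZ//; last by case: s.
apply: Rint_le => //; [by case: sz | by apply: intbZ => //; case: s |].
move=> x _; rewrite /z exprMn mulrC ler_wpM2r ?sqr_ge0//.
rewrite -[leLHS]real_normK ?num_real// lerXn2r ?nnegrE//.
exact: le_trans (b_le 0).
Qed.

(** The estimate in time holds for each mode, and the choice of [l] lets it be
    divided by |zeta|^2, which makes up for the derivative on the nonlinear term.
    It is linear in the squares of the coefficients, hence passes to their sums,
    and in the limit to the norms. *)
Lemma carleman :
  K ^+ 2 * \int[mu]_(t in I) (r t ^+ 2 * N t) <=
  2 / l ^+ 2 * \int[mu]_(t in I) (derive1 r t ^+ 2 * N t) +
  2 * Kb ^+ 2 * \int[mu]_(t in I) (r t ^+ 2 * N t).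
Proof.
have [P hP] := choice (fun k => repU (smooth_ec L l k)).
have [Q hQ] := choice (fun k => repU (smooth_es L l k)).
have [G hG] := choice (fun k => repN (smooth_ec L l k)).
have [H hH] := choice (fun k => repN (smooth_es L l k)).
pose Nk k t := (P k).1 t ^+ 2 + (Q k).1 t ^+ 2.
pose Gk k t := (G k).1 t ^+ 2 + (H k).1 t ^+ 2.
have l2 : 0 < l ^+ 2 by rewrite exprn_gt0.
have rs' : smooth (derive1 r) by exact: smooth_d.
have mode_le k : K ^+ 2 * \int[mu]_(t in I) (r t ^+ 2 * Nk k t) <=
    2 / l ^+ 2 * \int[mu]_(t in I) (derive1 r t ^+ 2 * Nk k t) +
    2 * \int[mu]_(t in I) (r t ^+ 2 * Gk k t).
  have [mP bP aP] := hP k; have [mQ bQ aQ] := hQ k.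
  have [mG bG aG] := hG k; have [mH bH aH] := hH k.
  pose C' := (P k).2 + (Q k).2 + (G k).2 + (H k).2.
  have p1 := le_trans (normr_ge0 _) (bP 0); have p2 := le_trans (normr_ge0 _) (bQ 0).
  have p3 := le_trans (normr_ge0 _) (bG 0); have p4 := le_trans (normr_ge0 _) (bH 0).
  pose xi := k%:R * freq (- L) L.
  have E1 h : smooth h -> let psi := fun t => r t * h t in
      \int[mu]_(t in I) (derive1 psi t * (P k).1 t +
        psi t * (symb_re L l k * (P k).1 t - symb_im L l k * (Q k).1 t) +
        psi t * (l * (G k).1 t - xi * (H k).1 t)) = 0.
    move=> hs psi.
    have d1 x : derive1 (ec L l k) x = l * ec L l k x + - xi * es L l k x.
      by rewrite ec_d /xi; ring.
    have d2 x : derive1n 2 (ec L l k) x = (l ^+ 2 - xi ^+ 2) * ec L l k x +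
        - (2 * l * xi) * es L l k x by rewrite ec_d2 /xi; ring.
    have d3 x : derive1n 3 (ec L l k) x = (l ^+ 3 - 3 * l * xi ^+ 2) * ec L l k x +
        - (3 * l ^+ 2 * xi - xi ^+ 3) * es L l k x by rewrite ec_d3 /xi; ring.
    rewrite -[RHS](mode_equation (smooth_ec L l k) (smooth_es L l k) mP mQ mG mH
      bP bQ bG bH aP aQ aG aH d1 d2 d3 hs).
    by apply: Rint_ext => t _; rewrite /symb_re /symb_im -/xi /psi; ring.
  have E2 h : smooth h -> let psi := fun t => r t * h t in
      \int[mu]_(t in I) (derive1 psi t * (Q k).1 t +
        psi t * (symb_re L l k * (Q k).1 t + symb_im L l k * (P k).1 t) +
        psi t * (l * (H k).1 t + xi * (G k).1 t)) = 0.
    move=> hs psi.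
    have d1 x : derive1 (es L l k) x = l * es L l k x + xi * ec L l k x.
      by rewrite es_d /xi; ring.
    have d2 x : derive1n 2 (es L l k) x = (l ^+ 2 - xi ^+ 2) * es L l k x +
        (2 * l * xi) * ec L l k x by rewrite es_d2 /xi; ring.
    have d3 x : derive1n 3 (es L l k) x = (l ^+ 3 - 3 * l * xi ^+ 2) * es L l k x +
        (3 * l ^+ 2 * xi - xi ^+ 3) * ec L l k x by rewrite es_d3 /xi; ring.
    rewrite -[RHS](mode_equation (smooth_es L l k) (smooth_ec L l k) mQ mP mH mG
      bQ bP bH bG aQ aP aH aG d1 d2 d3 hs).
    by apply: Rint_ext => t _; rewrite /symb_re /symb_im -/xi /psi; ring.
  have mT (f : R -> R) : measurable_fun setT f -> measurable_fun I f.
    by move=> mf; exact: measurable_funTS.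
  have le1 t : `|(P k).1 t| <= C' by rewrite (le_trans (bP t))// /C'; lra.
  have le2 t : `|(Q k).1 t| <= C' by rewrite (le_trans (bQ t))// /C'; lra.
  have le3 t : `|(G k).1 t| <= C' by rewrite (le_trans (bG t))// /C'; lra.
  have le4 t : `|(H k).1 t| <= C' by rewrite (le_trans (bH t))// /C'; lra.
  have := time_estimate T_gt0 (mT _ mP) (mT _ mQ) (mT _ mG) (mT _ mH)
    (fun t _ => le1 t) (fun t _ => le2 t) (fun t _ => le3 t) (fun t _ => le4 t)
    rs E1 E2.
  have := freqP k; rewrite -/xi.
  have A0 : 0 <= \int[mu]_(t in I) (r t ^+ 2 * Nk k t).
    by apply: Rintegral_ge0 => t _; rewrite mulr_ge0 ?sqr_ge0// addr_ge0 ?sqr_ge0.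
  have B0 : 0 <= \int[mu]_(t in I) (derive1 r t ^+ 2 * Nk k t).
    by apply: Rintegral_ge0 => t _; rewrite mulr_ge0 ?sqr_ge0// addr_ge0 ?sqr_ge0.
  move: A0 B0; rewrite -/(Nk k) -/(Gk k) -/I.
  move: (\int[mu]_(t in I) (r t ^+ 2 * Nk k t)) => A.
  move: (\int[mu]_(t in I) (derive1 r t ^+ 2 * Nk k t)) => B.
  move: (\int[mu]_(t in I) (r t ^+ 2 * Gk k t)) => Ga.
  move: (symb_re L l k) => s A0 B0 h1 h2.
  have x2 := sqr_ge0 xi; have z0 : 0 < l ^+ 2 + xi ^+ 2 by rewrite ltr_wpDr.
  rewrite -(ler_pM2l z0); apply: (@le_trans _ _ (s ^+ 2 * A)).
    by rewrite mulrA [_ * K ^+ 2]mulrC ler_wpM2r.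
  apply: (le_trans h2).
  have -> : (l ^+ 2 + xi ^+ 2) * (2 / l ^+ 2 * B + 2 * Ga) =
      2 * B + 2 * (l ^+ 2 + xi ^+ 2) * Ga + xi ^+ 2 * (2 / l ^+ 2 * B).
    by field; rewrite gt_eqF.
  by rewrite lerDl mulr_ge0// mulr_ge0// divr_ge0// ltW.
pose w := wt (- L) L.
pose Nn n t : R := \sum_(k < n) w k * Nk k t.
pose Gn n t : R := \sum_(k < n) w k * Gk k t.
have w0 k : 0 < w k by exact: wt_gt0.
have mNk k : measurable_fun setT (Nk k).
  by apply: measurable_funD; apply: measurable_funX; [case: (hP k) | case: (hQ k)].
have mGk k : measurable_fun setT (Gk k).
  by apply: measurable_funD; apply: measurable_funX; [case: (hG k) | case: (hH k)].
have sq_le (f : R -> R) c : (forall t, `|f t| <= c) -> forall t, `|f t ^+ 2| <= c ^+ 2.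
  by move=> h t; rewrite normrX lerXn2r ?nnegrE// (le_trans _ (h t)).
have bNk k t : `|Nk k t| <= (P k).2 ^+ 2 + (Q k).2 ^+ 2.
  rewrite (le_trans (ler_normD _ _))// lerD//; apply: sq_le.
    by case: (hP k).
  by case: (hQ k).
have bGk k t : `|Gk k t| <= (G k).2 ^+ 2 + (H k).2 ^+ 2.
  rewrite (le_trans (ler_normD _ _))// lerD//; apply: sq_le.
    by case: (hG k).
  by case: (hH k).
have im (f g : R -> R) c : smooth f -> measurable_fun setT g -> (forall t, `|g t| <= c) ->
    intb I (fun t => f t ^+ 2 * g t).
  move=> fs mg gc; have [c' c'0 hc] := cont_bounded 0 T (smooth_cont fs).
  apply: (@intb_bounded _ _ _ (c' ^+ 2 * c)) => //.
    apply: measurable_funM; last exact: measurable_funTS.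
    by apply: measurable_funX; exact: smooth_meas.
  move=> t; rewrite /I /= in_itv /= => /andP[t1 t2].
  by rewrite normrM ler_pM// normrX lerXn2r ?nnegrE// hc// !ltW.
have split_sum (f : R -> R) (F : nat -> R -> R) n : smooth f ->
    (forall k, intb I (fun t => f t ^+ 2 * F k t)) ->
    \int[mu]_(t in I) (f t ^+ 2 * \sum_(k < n) w k * F k t) =
    \sum_(k < n) w k * \int[mu]_(t in I) (f t ^+ 2 * F k t).
  move=> fs Fi.
  transitivity (\int[mu]_(t in I) (\sum_(k < n) w k * (f t ^+ 2 * F k t))).
    by apply: Rint_ext => t _; rewrite mulr_sumr; apply: eq_bigr => k _; ring.
  rewrite (@Rint_sum _ I n (fun k t => w k * (f t ^+ 2 * F k t)) mI); last first.
    by move=> k; exact: intbZ.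
  by apply: eq_bigr => k _; rewrite RintZ.
have iN k := im _ _ _ rs (mNk k) (bNk k).
have iN' k := im _ _ _ rs' (mNk k) (bNk k).
have iG k := im _ _ _ rs (mGk k) (bGk k).
have sum_le n : K ^+ 2 * \int[mu]_(t in I) (r t ^+ 2 * Nn n t) <=
    2 / l ^+ 2 * \int[mu]_(t in I) (derive1 r t ^+ 2 * Nn n t) +
    2 * \int[mu]_(t in I) (r t ^+ 2 * Gn n t).
  rewrite !split_sum// !mulr_sumr -big_split; apply: ler_sum => k _ /=.
  have -> : 2 / l ^+ 2 * (w k * \int[mu]_(t in I) (derive1 r t ^+ 2 * Nk k t)) +
    2 * (w k * \int[mu]_(t in I) (r t ^+ 2 * Gk k t)) =
    w k * (2 / l ^+ 2 * \int[mu]_(t in I) (derive1 r t ^+ 2 * Nk k t) +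
      2 * \int[mu]_(t in I) (r t ^+ 2 * Gk k t)) by ring.
  by rewrite mulrCA ler_pM2l.
have aP : \forall t \ae mu, forall k, t \in `]0, T[ -> (P k).1 t = uxp L u (ec L l k) t.
  by apply: ae_all => k; case: (hP k).
have aQ : \forall t \ae mu, forall k, t \in `]0, T[ -> (Q k).1 t = uxp L u (es L l k) t.
  by apply: ae_all => k; case: (hQ k).
have aG : \forall t \ae mu, forall k, t \in `]0, T[ -> (G k).1 t = nlp L u b (ec L l k) t.
  by apply: ae_all => k; case: (hG k).
have aH : \forall t \ae mu, forall k, t \in `]0, T[ -> (H k).1 t = nlp L u b (es L l k) t.
  by apply: ae_all => k; case: (hH k).
have ptw : \forall t \ae mu, I t ->
    [/\ forall n, Nn n t <= N t, forall n, Gn n t <= Kb ^+ 2 * N t &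
        Nn n t @[n --> \oo] --> N t].
  apply: (aeS2 _ (aeI (aeI aP aQ) (aeI aG aH)) (aeI NE ae_good_time)).
  move=> t [[pt qt] [ht ht']] [nt gt] It.
  have tI : t \in `]0, T[ by [].
  have {}gt := gt tI.
  have NnE n : Nn n t = energy (- L) L (wux t) n.
    by apply: eq_bigr => k _; rewrite /Nk pt// qt// -wux_fc -wux_fs.
  rewrite nt//; split.
  - by move=> n; rewrite NnE; apply: bessel => //; exact: wux_sq.
  - move=> n; apply: le_trans (nonlin_energy n gt).
    by rewrite le_eqVlt; apply/orP; left; apply/eqP/eq_bigr => k _; rewrite /Gk ht// ht'.
  - by rewrite (_ : Nn^~ t = energy (- L) L (wux t)); [exact: wnorm_lim | apply/funext].
have Nn_sumi (f : R -> R) (F : nat -> R -> R) n : smooth f ->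
    (forall k, intb I (fun t => f t ^+ 2 * F k t)) ->
    intb I (fun t => f t ^+ 2 * \sum_(k < n) w k * F k t).
  move=> fs Fi; apply: (@intb_ext _ _ (fun t => \sum_(k < n) w k * (f t ^+ 2 * F k t))).
    by move=> t; rewrite mulr_sumr; apply: eq_bigr => k _; ring.
  by apply: (@intb_sum _ I n (fun k t => w k * (f t ^+ 2 * F k t))) => // k; exact: intbZ.
have iNl := im _ _ _ rs mN N_le; have iNl' := im _ _ _ rs' mN N_le.
have bound n : K ^+ 2 * \int[mu]_(t in I) (r t ^+ 2 * Nn n t) <=
    2 / l ^+ 2 * \int[mu]_(t in I) (derive1 r t ^+ 2 * N t) +
    2 * Kb ^+ 2 * \int[mu]_(t in I) (r t ^+ 2 * N t).
  apply: (le_trans (sum_le n)); apply: lerD.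
    apply: ler_wpM2l; first by rewrite divr_ge0// ltW.
    apply: Rint_le_ae => //; first exact: Nn_sumi.
    by apply: (aeS _ ptw) => t h /h[h1 _ _]; rewrite ler_wpM2l ?sqr_ge0.
  rewrite -mulrA; apply: ler_wpM2l => //; rewrite -RintZ//.
  apply: Rint_le_ae => //; [exact: Nn_sumi | exact: intbZ |].
  apply: (aeS _ ptw) => t h /h[_ h2 _]; rewrite mulrCA.
  by rewrite ler_wpM2l ?sqr_ge0.
have mNn n : measurable_fun setT (Nn n).
  by apply: measurable_sum => k; apply: measurable_funM.
have lim : \int[mu]_(t in I) (r t ^+ 2 * Nn n t) @[n --> \oo] -->
    \int[mu]_(t in I) (r t ^+ 2 * N t).
  have mr : measurable_fun I (fun t => r t ^+ 2).
    by apply: measurable_funX; exact: smooth_meas.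
  apply: (@Rint_dominated _ _ _ _ (fun t => r t ^+ 2 * N t)) => //.
  - by move=> n; apply: measurable_funM => //; exact: measurable_funTS.
  - by apply: measurable_funM => //; exact: measurable_funTS.
  - by apply: (aeS _ ptw) => t h /h[_ _ h3]; apply: cvgMr.
  - apply: (aeS _ ptw) => t h n /h[h1 _ _].
    rewrite ger0_norm; first by rewrite ler_wpM2l ?sqr_ge0.
    rewrite mulr_ge0 ?sqr_ge0// sumr_ge0// => k _.
    by rewrite mulr_ge0 ?(ltW (w0 k))// addr_ge0 ?sqr_ge0.
have lim' : K ^+ 2 * \int[mu]_(t in I) (r t ^+ 2 * Nn n t) @[n --> \oo] -->
    K ^+ 2 * \int[mu]_(t in I) (r t ^+ 2 * N t) by apply: cvgMr.
by apply: ler_cvg_to lim' (cvg_cst _) _; apply: nearW.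
Qed.

End Exponent.

End Carleman.

(** * Letting the exponent tend to infinity *)

Section Vanishing.
Context {R : realType}.
Local Notation mu := (@lebesgue_measure R).
Variables (T L Mu : R) (a b : R -> R) (Kb Kl : R) (u : R -> R -> R).
Hypotheses (T_gt0 : 0 < T) (L_gt0 : 0 < L) (u_LH1 : Linfty_H1 T u)
  (u_bound : \forall t \ae mu, t \in `]0, T[ -> H1norm (u t) <= Mu)
  (u_sol : KdVB_solution T a u)
  (u_out : vanishes_on T (`]-oo, (- L)[ `|` `]L, +oo[) u)
  (b_cont : continuous b) (b_le : forall x, `|b x| <= Kb)
  (b_lip : forall x y, `|b x - b y| <= Kl * `|x - y|)
  (u_b : \forall t \ae mu, t \in `]0, T[ ->
     \forall x \ae mu, - L < x < L -> a (u t x) = b (u t x)).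

Let D : set R := `]- L, L[%classic.
Let I : set R := `]0, T[%classic.
Let mD : measurable D. Proof. exact: measurable_itv. Qed.
Let finD : (mu D < +oo)%E. Proof. exact: mu_oo_fin. Qed.
Let mI : measurable I. Proof. exact: measurable_itv. Qed.
Let finI : (mu I < +oo)%E. Proof. exact: mu_oo_fin. Qed.
Let good := ae_good_time u_LH1 u_bound u_out.

Let grad t : R := \int[mu]_(x in D) (wderiv (u t) x ^+ 2).

Section Middle.
Variable eta : R.
Hypothesis eta_gt0 : 0 < eta.

(* On the middle interval the exponent of the weight is at most 2 n / eta; the
   added 1 leaves a gap of n above it. *)
Let th : R := 2 / eta + 1.
(* 18 L^2 th^4 is 2 / l^2 times (n th^2)^2, where n = 3 L l. *)
Let Q : R := 2 * Kb ^+ 2 + 18 * L ^+ 2 * th ^+ 4 + 1.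

Let th_ge0 : 0 <= th.
Proof. by rewrite addr_ge0// divr_ge0// ltW. Qed.

Let Q_ge1 : 1 <= Q.
Proof.
have h : 0 <= L ^+ 2 * th ^+ 4.
  by apply: mulr_ge0; apply: exprn_ge0 => //; exact: ltW.
by have := sqr_ge0 Kb; rewrite /Q; lra.
Qed.

Section Weighted.
Variables (l : R) (N : R -> R).
Hypotheses (l_gt0 : 0 < l) (n_ge1 : 1 <= 3 * L * l)
  (freqP : forall k : nat,
     Q * (l ^+ 2 + (k%:R * freq (- L) L) ^+ 2) <= symb_re L l k ^+ 2)
  (mN : measurable_fun setT N)
  (N_le : forall t, 0 <= N t <= expR (`|l| * L) ^+ 2 * Mu ^+ 2)
  (NE : \forall t \ae mu, t \in `]0, T[ -> N t = wnorm L u l t).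

Let n := 3 * L * l.
Let n_gt0 : 0 < n. Proof. exact: lt_le_trans n_ge1. Qed.
Let r := rho n eta (T - eta).
Let C := expR (`|l| * L) ^+ 2 * Mu ^+ 2.

Let N_norm t : `|N t| <= C.
Proof. by have /andP[h ?] := N_le t; rewrite ger0_norm. Qed.

Let N_intb : intb I N.
Proof.
by apply: (@intb_bounded _ _ _ C) => //; exact: measurable_funTS.
Qed.

Let r_smooth : smooth r. Proof. exact: smooth_rho. Qed.

Lemma weighted_intb (f : R -> R) : smooth f -> intb I (fun t => f t ^+ 2 * N t).
Proof.
move=> fs; have [M M0 fM] := cont_bounded 0 T (smooth_cont fs).
have mf : measurable_fun I f by exact: smooth_meas.
have h : intb I (fun t => N t * f t ^+ 2).
  apply: (@intbMb _ _ _ _ (M ^+ 2)) => //; first exact: measurable_funX.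
  move=> t; rewrite /I /= in_itv /= => /andP[t0 tT].
  by rewrite normrX lerXn2r ?nnegrE// fM// !ltW.
exact: (intb_ext (fun t => mulrC _ _) h).
Qed.

(** With this value of [Q], the part of [r'] dominated by [r] and the nonlinear
    term are both absorbed; the right-hand side comes from the times where [r] is
    exponentially small. *)
Lemma weighted_decay : \int[mu]_(t in I) (r t ^+ 2 * N t) <=
  72 * L ^+ 2 * T * C * expR (- ((n - 1) * th)) ^+ 2.
Proof.
have Q0 : 0 <= Q by exact: le_trans Q_ge1.
have K0 : 0 < Num.sqrt Q by rewrite sqrtr_gt0 (lt_le_trans _ Q_ge1).
have freqP' k : Num.sqrt Q ^+ 2 * (l ^+ 2 + (k%:R * freq (- L) L) ^+ 2) <=
    symb_re L l k ^+ 2 by rewrite sqr_sqrtr.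
have beT : T - eta < T by rewrite ltrBlDr ltrDl.
have out t : ~ (eta <= t <= T - eta) -> r t = 0 by exact: (rho_out n_gt0).
have := carleman T_gt0 L_gt0 u_LH1 u_bound u_sol u_out b_cont b_le b_lip u_b
  l_gt0 freqP' mN N_norm NE eta_gt0 beT r_smooth out.
rewrite sqr_sqrtr//.
pose d := (2 * n * expR (- ((n - 1) * th))) ^+ 2.
have ri := weighted_intb r_smooth; have r'i := weighted_intb (smooth_d r_smooth).
have : \int[mu]_(t in I) (derive1 r t ^+ 2 * N t) <=
    (n * th ^+ 2) ^+ 2 * \int[mu]_(t in I) (r t ^+ 2 * N t) +
    d * \int[mu]_(t in I) N t.
  rewrite -(Rint_lin _ _ mI ri N_intb); apply: Rint_le => //.
    by apply: intbD => //; apply: intbZ.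
  move=> t _; have /andP[Nt _] := N_le t.
  have := ler_wpM2r Nt (rho_d_le eta (T - eta) n_gt0 t n_ge1 th_ge0).
  by rewrite mulrDl -!mulrA.
have : \int[mu]_(t in I) N t <= C * T.
  have := @Rint_bound _ 0 T C N (ltW T_gt0) N_intb (fun t _ => N_norm t).
  by rewrite subr0; apply: le_trans; exact: ler_norm.
rewrite -/r; set A := \int[mu]_(t in I) (r t ^+ 2 * N t).
move: A (\int[mu]_(t in I) (derive1 r t ^+ 2 * N t)) (\int[mu]_(t in I) N t).
move=> A B J hJ hB hA.
have l2 : 0 <= 2 / l ^+ 2 by rewrite divr_ge0// sqr_ge0.
have d0 : 0 <= d by exact: sqr_ge0.
have := ler_wpM2l l2 (le_trans hB (lerD (lexx _) (ler_wpM2l d0 hJ))).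
have -> : 2 / l ^+ 2 * ((n * th ^+ 2) ^+ 2 * A + d * (C * T)) =
    18 * L ^+ 2 * th ^+ 4 * A +
    72 * L ^+ 2 * T * C * expR (- ((n - 1) * th)) ^+ 2.
  by rewrite /d /n; field; rewrite gt_eqF.
move=> h; have := le_trans hA (lerD h (lexx _)).
by rewrite {1}/Q; lra.
Qed.
End Weighted.

Let M : set R := `[2 * eta, T - 2 * eta]%classic.

(** The bound X exp(2 l L) <= c for the integral [X] of the squared norm of
    u_x over the middle interval, with [c] independent of [l], forces [X] to be 0 as [l] grows. *)
Lemma grad_eq0 : \forall t \ae mu, 2 * eta <= t <= T - 2 * eta -> grad t = 0.
Proof.
have [E [mE E_le EE]] := wnorm_meas L_gt0 u_LH1 u_bound u_out 0.
pose G t := E t * \1_M t.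
have E0 t : 0 <= E t by have /andP[] := E_le t.
have G0 t : 0 <= G t by rewrite mulr_ge0.
have mG : measurable_fun I G.
  apply: measurable_funM; first exact: measurable_funTS.
  by apply: measurable_indic; exact: measurable_itv.
have Gi : intb I G.
  apply: (@intb_bounded _ _ _ (expR (`|0 : R| * L) ^+ 2 * Mu ^+ 2)) => // t _.
  rewrite ger0_norm// /G indicE; have /andP[e0 e1] := E_le t.
  by case: (t \in M); rewrite /= ?mulr1 ?mulr0 //; exact: le_trans e1.
have Ggrad : \forall t \ae mu, t \in `]0, T[ -> G t = grad t * \1_M t.
  apply: (aeS _ EE) => t Et tI; rewrite /G Et//; congr (_ * _).
  by apply: Rint_ext => x _; rewrite /wux mul0r expR0 mulr1.
suff X0 : \int[mu]_(t in I) G t = 0.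
  apply: (aeS2 _ Ggrad (Rint_eq0 mI Gi (fun t _ => G0 t) X0)) => t h1 h2 tM.
  have tI : t \in `]0, T[.
    by move: tM (eta_gt0); rewrite in_itv /=; lra.
  have Mt : M t by rewrite /M /= in_itv.
  by have := h1 tI; rewrite h2// indicE mem_set// mulr1.
set X := \int[mu]_(t in I) _.
have X0 : 0 <= X by apply: Rintegral_ge0.
apply/eqP; rewrite eq_le X0 andbT leNgt; apply/negP => Xgt0.
pose c := 72 * L ^+ 2 * T * Mu ^+ 2 * expR th ^+ 2.
have c0 : 0 <= c.
  by rewrite mulr_ge0 ?sqr_ge0// mulr_ge0 ?sqr_ge0// mulr_ge0 ?(ltW T_gt0)// mulr_ge0 ?sqr_ge0.
suff [l hl Xl] : exists2 l, c / X <= l * L & X * expR (2 * (l * L)) <= c.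
  suff : c < X * expR (2 * (l * L)) by rewrite ltNge Xl.
  move: hl; rewrite ler_pdivrMr// => hl; rewrite (le_lt_trans hl)// mulrC ltr_pM2l//.
  have := expR_ge1Dx (2 * (l * L)).
  have : 0 <= l * L by rewrite -(pmulr_lge0 _ Xgt0) (le_trans c0).
  lra.
have Q0 : 0 < Num.sqrt Q by rewrite sqrtr_gt0 (lt_le_trans _ Q_ge1).
have [l l0 freqP] := frequency_choice (1 + (3 * L)^-1 + c / X / L) L_gt0 Q0.
have cXL0 : 0 <= c / X / L by rewrite !divr_ge0// ltW.
have L3 : 0 < (3 * L)^-1 by rewrite invr_gt0 mulr_gt0.
have l_gt0 : 0 < l by lra.
have n_ge1 : 1 <= 3 * L * l.
  rewrite -[leLHS](@mulfV _ (3 * L)); last by rewrite gt_eqF// mulr_gt0.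
  by rewrite ler_pM2l ?mulr_gt0//; lra.
exists l; first by rewrite -ler_pdivrMr//; lra.
have [N [mN N_le NE]] := wnorm_meas L_gt0 u_LH1 u_bound u_out l.
rewrite sqr_sqrtr in freqP; last exact: le_trans Q_ge1.
have hA := weighted_decay l_gt0 n_ge1 freqP mN N_le NE.
have ri := weighted_intb mN N_le (smooth_rho (3 * L * l) eta (T - eta)).
have l_norm : `|l| = l by rewrite ger0_norm// ltW.
rewrite l_norm in hA.
set n := 3 * L * l in ri hA n_ge1; set r := rho n eta (T - eta) in ri hA.
have n_gt0 : 0 < n by exact: lt_le_trans n_ge1.
pose e := (expR (l * L) * expR (n * (2 / eta))) ^+ 2.
have XA : X <= e * \int[mu]_(t in I) (r t ^+ 2 * N t).
  rewrite /X -(RintZ e mI ri); apply: Rint_le_ae => //; first exact: intbZ.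
  apply: (aeS2 _ (aeI NE Ggrad) good) => t [Nt Gt] gt tI; rewrite (Gt tI) (Nt tI) indicE.
  have [tM|_] := boolP (t \in M); last first.
    by rewrite mulr0 mulr_ge0 ?sqr_ge0// mulr_ge0 ?sqr_ge0// Rint_sq_ge0.
  rewrite mulr1 (le_trans (wnorm_ge l (gt tI)))// l_norm.
  have -> : e * (r t ^+ 2 * wnorm L u l t) = expR (l * L) ^+ 2 *
      ((expR (n * (2 / eta)) * r t) ^+ 2 * wnorm L u l t) by rewrite /e; ring.
  rewrite ler_wpM2l ?sqr_ge0// ler_peMl ?Rint_sq_ge0//.
  have tm : eta + eta <= t <= T - eta - eta.
    by move: tM; rewrite inE /M /= in_itv /=; lra.
  have rt := rho_ge n_gt0 eta_gt0 tm; rewrite -/r in rt.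
  rewrite expr_ge1//; last first.
    by rewrite mulr_ge0 ?expR_ge0// (le_trans _ rt) ?expR_ge0.
  have := ler_wpM2l (expR_ge0 (n * (2 / eta))) rt.
  by rewrite -expRD subrr expR0.
have e0 : 0 <= e by exact: sqr_ge0.
(* n = 3 L l makes the exponents 4 L l - 2 n of the two bounds add up to
   - 2 L l. *)
have eE : e * expR (l * L) ^+ 2 * expR (- ((n - 1) * th)) ^+ 2 =
    expR (- (2 * (l * L))) * expR th ^+ 2.
  rewrite /e -!expRD -!expRM_natl -!expRD; congr expR.
  by rewrite /th /n; field; rewrite gt_eqF.
have := le_trans XA (ler_wpM2l e0 hA).
move: (X) => X' hX.
rewrite mulrC -ler_pdivlMl ?expR_gt0// -expRN (le_trans hX)//.
rewrite le_eqVlt; apply/orP; left; apply/eqP.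
transitivity (72 * L ^+ 2 * T * Mu ^+ 2 *
  (e * expR (l * L) ^+ 2 * expR (- ((n - 1) * th)) ^+ 2)); first by ring.
by rewrite eE /c; ring.
Qed.
End Middle.

Lemma solution_eq0 : vanishes_on T setT u.
Proof.
have h : \forall t \ae mu, forall k : nat,
    2 * k.+1%:R^-1 <= t <= T - 2 * k.+1%:R^-1 -> grad t = 0.
  by apply: ae_all => k; apply: grad_eq0; rewrite invr_gt0.
apply: (aeS2 _ h good) => t gt0 gt tI.
have {}gt := gt tI; have [sq_ux _] := good_sq gt; have [uH1 uout _] := gt.
have {}gt0 : grad t = 0.
  have /andP[t0 tT] : 0 < t < T by move: tI; rewrite in_itv.
  pose d := Num.min t (T - t) / 2.
  have d0 : 0 < d by rewrite divr_gt0// lt_min t0 subr_gt0.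
  have [k _ /(_ _ (leqnn k)) kd] := near_infty_natSinv_lt (PosNum d0).
  have {}kd : k.+1%:R^-1 < d := kd.
  apply: (gt0 k); have : d * 2 <= t by rewrite /d divfK// ge_min lexx.
  have : d * 2 <= T - t by rewrite /d divfK// ge_min lexx orbT.
  by move: kd; move: (_^-1) => e ? ? ?; apply/andP; split; lra.
have i0 : \int[mu]_(x in D) `|wderiv (u t) x| = 0.
  have := Rint_L1_L2 mD finD sq_ux; rewrite -/(grad t) gt0 mulr0.
  by move=> h2; apply/eqP; rewrite -sqrf_eq0 eq_le h2 sqr_ge0.
apply: (aeS2 _ (sobolev L_gt0 uH1 uout) (vanish_outD uout)) => x h1 h2 _.
have [xD|xD] := pselect (D x); last exact: h2.
by apply/eqP; rewrite -normr_le0 -i0; exact: h1.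
Qed.
End Vanishing.

(** * Truncation of the nonlinearity *)

Lemma growth_derivable (R : realType) (p : R) (a : R -> R) : growth p a ->
  forall x, derivable a x 1.
Proof.
move=> [C _ h] x; have [|h1 _] := h 1%N _ x; first by case: ifP.
exact: (h1 0%N).
Qed.

(** The bound on the derivative makes a Lipschitz on bounded intervals, which
    is the regularity that the measurability of the nonlinear term needs. *)
Lemma growth_lipschitz (R : realType) (p : R) (a : R -> R) (B : R) : 1 <= p ->
  growth p a -> exists K, forall x y, `|x| <= B -> `|y| <= B ->
    `|a x - a y| <= K * `|x - y|.
Proof.
move=> p1 ga; have ad := growth_derivable ga.
have [C C0 h] := ga; exists (C * (1 + B `^ (p - 1))).
have da (m : R) : `|m| <= B -> `|derive1 a m| <= C * (1 + B `^ (p - 1)).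
  move=> mB; have [|_] := h 1%N _ m; first by case: ifP.
  move=> hm; apply: (le_trans hm); rewrite ler_wpM2l ?(ltW C0)// lerD2l.
  by apply: ge0_ler_powR; rewrite ?nnegrE ?subr_ge0// (le_trans _ mB).
have is_da (x : R) : is_derive x (1 : R) a (derive1 a x).
  by apply: DeriveDef; [exact: ad | rewrite derive1E].
have mono (x y : R) : x < y -> `|x| <= B -> `|y| <= B ->
    `|a x - a y| <= C * (1 + B `^ (p - 1)) * `|x - y|.
  move=> xy xB yB; have [c /andP[xc cy] e] := mean_value is_da xy.
  rewrite distrC e normrM (distrC x) ler_wpM2r// da//.
  move: xB yB; rewrite !ler_norml => /andP[? ?] /andP[? ?].
  by apply/andP; split; lra.
move=> x y xB yB; have [xy|xy|->] := ltgtP x y; first exact: mono.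
  by rewrite distrC (distrC x); exact: mono.
by rewrite !subrr normr0 mulr0.
Qed.

Theorem lemma3p6 (R : realType) (T p : R) (a : R -> R) (u : R -> R -> R) (L : R)
  (T_gt0 : 0 < T) (p_ge1 : 1 <= p)
  (a_cont : continuous a) (a_growth : growth p a)
  (u_LinftyH1 : Linfty_H1 T u)
  (u_sol : KdVB_solution T a u)
  (L_gt0 : 0 < L)
  (u_outside : vanishes_on T (`]-oo, (- L)[ `|` `]L, +oo[) u) :
  vanishes_on T setT u.
Proof.
have [_ _ [Mu uM]] := u_LinftyH1.
(* [B] bounds the values of [u], by the Sobolev inequality. *)
pose B := 2 * L + Mu ^+ 2.
have B0 : 0 <= B by rewrite addr_ge0 ?sqr_ge0// mulr_ge0// ltW.
have clipB (x : R) : - B <= clip B x <= B by rewrite -ler_norml clip_le.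
pose b x := a (clip B x).
have [Kb _ aKb] := cont_bounded (- B) B a_cont.
have [Kl aKl] := growth_lipschitz B p_ge1 a_growth.
apply: (@solution_eq0 _ T L Mu a b Kb `|Kl| u) => //.
- by move=> x; apply: continuous_comp; [exact: clip_cont | exact: a_cont].
- by move=> x; exact: aKb.
- move=> x y; rewrite (le_trans (aKl _ _ _ _)) ?clip_le//.
  rewrite (@le_trans _ _ (`|Kl| * `|clip B x - clip B y|))//.
    by rewrite ler_wpM2r// ler_norm.
  by rewrite ler_wpM2l// clip_lip.
- apply: (aeS _ (ae_good_time u_LinftyH1 uM u_outside)) => t gt tI.
  have {}gt := gt tI; have [uH1 uout _] := gt.
  apply: (aeS _ (sobolev L_gt0 uH1 uout)) => x ux xL.
  by rewrite /b clip_id// (le_trans (ux _))// (le_trans (good_L1 L_gt0 gt)).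
Qed.
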